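(* Fix a real number $p\ge 1$. Let $K\subset\mathbb{R}^d$ be a real, simple $d$-cone with vertex at the origin, and let $s\in\mathbb{C}^d$. Then the solid-angle generating function $\alpha_K$ of $K$ satisfies $$\alpha_K(-s)=(-1)^d\,\alpha_K(s),$$ understood as an identity of meromorphic functions of $s\in\mathbb{C}^d$.
   Context: A convex cone in $\mathbb{R}^d$ is an intersection of finitely many half-spaces $\{x\in\mathbb{R}^d: a\cdot x\le b\}$ whose bounding hyperplanes $\{x : a\cdot x=b\}$ meet in at least one point. It is pointed if these hyperplanes meet in exactly one point (the vertex, or apex). Throughout, ''cone'' means pointed cone. ''Real'' means that no rationality is assumed: the coefficients and generators are arbitrary real numbers. A $d$-cone is a cone of dimension $d$. A $d$-cone with vertex at the origin is simple if it is generated by exactly $d$ linearly independent vectors $w_1,\dots,w_d\in\mathbb{R}^d$, i.e. $K=\{\sum_j\lambda_j w_j:\lambda_j\ge 0\}$. Notation: $\|t\|_p=(|t_1|^p+\dots+|t_d|^p)^{1/p}$, and $\langle x,y\rangle=\sum_k x_ky_k$ (bilinear, extended to complex vectors without conjugation). $l^p$-solid angle of $x\in\mathbb{R}^d$ with respect to $K$: $$\omega_K(x)=\omega_{p,K}(x):=\lim_{\epsilon\to0^+}\frac{1}{\epsilon^{d/p}}\int_K e^{-\frac{c}{\epsilon}\|t-x\|_p^p}\,dt,\qquad c=\bigl(2\,\Gamma(\tfrac1p+1)\bigr)^p.$$ Equivalently, it is the proportion of a sufficiently small $l^p$-ball centered at $x$ that lies in $K$. Solid-angle generating function: $$\alpha_K(s):=\sum_{m\in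 K\cap\mathbb{Z}^d}\omega_K(m)\,e^{2\pi i\langle s,m\rangle}.$$ For $K$ with vertex at the origin the series is considered for $s\in\mathbb{C}^d$ with $-\mathrm{Im}(s)\in K^*$, where $K^*=\{x\in\mathbb{R}^d:\langle x,y\rangle<0\ \text{for all nonzero } y\in K\}$ is the polar cone. Elsewhere, $\alpha_K$ is understood through meromorphic continuation in $s$.
   Formalization: The identity is stated for every meromorphic continuation of the series; existence is assumed, not claimed. If some extreme ray of K contains no nonzero lattice point, e.g. generators (1,0),(1,√2), there is no meromorphic continuation, so the statement has content only for the other cones. *)

(* Defs.v *)
From HB Require Import structures.
From mathcomp Require Import all_boot all_order all_algebra.
From mathcomp Require Import all_classical all_reals all_analysis.
From mathcomp Require Import complex.
From mathcomp Require summability.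

Set Implicit Arguments.
Unset Strict Implicit.
Unset Printing Implicit Defensive.

Import Order.TTheory GRing.Theory Num.Theory.
Import numFieldNormedType.Exports.

Local Open Scope classical_set_scope.
Local Open Scope ring_scope.
Local Open Scope complex_scope.

(* The topology of R[i] is the one given by the complex modulus. *)
HB.instance Definition _ (R : rcfType) := NormedModule.copy R[i] R[i]^o.

(* No conjugation, also when A is a ring of complex numbers. *)
Definition dotp (A : pzRingType) (d : nat) (x y : 'rV[A]_d) : A :=
  \sum_(k < d) x 0 k * y 0 k.

Section Cones.
Context {R : realType} {d : nat}.

(* The rows of [w] are the generators. Being linearly independent, they make
   the cone pointed and [d]-dimensional. *)
Definition cone_of (w : 'M[R]_d) : set 'rV[R]_d :=
  [set x | exists2 lam : 'I_d -> R,
     (forall j, 0 <= lam j) & x = \sum_(j < d) lam j *: row j w].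

Definition simple_cone (K : set 'rV[R]_d) : Prop :=
  exists2 w : 'M[R]_d, row_free w & K = cone_of w.

Definition polar_cone (K : set 'rV[R]_d) : set 'rV[R]_d :=
  [set x | forall y, K y -> y != 0 -> dotp x y < 0].

End Cones.

(* Lebesgue measure on R^d as a d-fold product measure. It lives on tuples
   because row vectors carry no sigma-algebra in the library. *)
Fixpoint lebesgue_tuple (R : realType) (d : nat) :
    set (d.-tuple (measurableTypeR R)) -> \bar R :=
  match d with
  | 0 => dirac [tuple]
  | n.+1 => pushforward
      (product_measure1 (@lebesgue_measure R) (@lebesgue_tuple R n))
      (fun u => [tuple of u.1 :: u.2])
  end.

Section SolidAngle.
Context {R : realType}.

Definition Gamma (a : R) : R :=
  \int[lebesgue_measure]_(t in `]0, +oo[) (t `^ (a - 1) * expR (- t)).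

Definition lpnorm (p : R) (d : nat) (t : 'rV[R]_d) : R :=
  (\sum_(k < d) `|t 0 k| `^ p) `^ p^-1.

Definition gauss_const (p : R) : R := (2 * Gamma (p^-1 + 1)) `^ p.

Definition row_of_tuple (d : nat) (t : d.-tuple (measurableTypeR R)) :
    'rV[R]_d := \row_k tnth t k.

Definition solid_angle (p : R) (d : nat) (K : set 'rV[R]_d) (x : 'rV[R]_d) : R :=
  lim ((eps `^ (d%:R / p))^-1 *
       fine (\int[@lebesgue_tuple R d]_(t in @row_of_tuple d @^-1` K)
          (expR (- (gauss_const p / eps)
                 * lpnorm p (row_of_tuple t - x) `^ p))%:E)
       @[eps --> 0^'+]).

Definition cexp (z : R[i]) : R[i] :=
  (expR (complex.Re z))%:C * (cos (complex.Im z) +i* sin (complex.Im z)).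

(* [summability.sum] is unconditional summation, along the finite subsets of
   Z^d. The notation [f \_ A] extends [f] by 0 outside of [A]. *)
Definition solid_angle_series (p : R) (d : nat) (K : set 'rV[R]_d)
    (s : 'rV[R[i]]_d) : R[i] :=
  summability.sum
    ((fun m : 'rV[int]_d =>
        (solid_angle p K (map_mx intr m))%:C *
        cexp ((0 +i* (2 * pi)) * dotp s (map_mx intr m)))
     \_ [set m : 'rV[int]_d | K (map_mx intr m)]).

Definition series_domain (d : nat) (K : set 'rV[R]_d) : set 'rV[R[i]]_d :=
  [set s | polar_cone K (- map_mx (@complex.Im R) s)].

End SolidAngle.

Section Meromorphic.
Context {R : realType} {d : nat}.

(* ['rV[R[i]]_d] is a normed space over [R[i]], so [differentiable] is complex
   differentiability. *)
Definition holomorphic_on (U : set 'rV[R[i]]_d) (f : 'rV[R[i]]_d -> R[i]) :=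
  forall z, U z -> differentiable f z.

(* A meromorphic function on C^d is represented by a total function that is
   locally a quotient [g / h] of holomorphic functions, [h] vanishing
   identically on no nonempty open set. Its values on the zero set of [h] are
   unconstrained. *)
Definition meromorphic (F : 'rV[R[i]]_d -> R[i]) : Prop :=
  forall a, exists U : set 'rV[R[i]]_d, exists g h : 'rV[R[i]]_d -> R[i],
    [/\ open_nbhs a U,
        holomorphic_on U g,
        holomorphic_on U h,
        U `<=` closure [set z | h z != 0] &
        forall z, U z -> h z != 0 -> F z = g z / h z].

Definition regular_at (F : 'rV[R[i]]_d -> R[i]) (z : 'rV[R[i]]_d) : Prop :=
  exists2 U, open_nbhs z U & holomorphic_on U F.

(* For meromorphic functions the common regular points form a dense open set,
   so this is equality of meromorphic functions. *)
Definition mero_eq (F G : 'rV[R[i]]_d -> R[i]) : Prop :=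
  forall z, regular_at F z -> regular_at G z -> F z = G z.

(* As the domain of the series is open and nonempty for a simple cone [K], the
   continuation is unique up to [mero_eq]. Its existence is not part of the
   definition. *)
Definition is_solid_angle_gf (p : R) (K : set 'rV[R]_d)
    (F : 'rV[R[i]]_d -> R[i]) : Prop :=
  meromorphic F /\
  forall s, series_domain K s -> F s = solid_angle_series p K s.

End Meromorphic.

(* Main.v *)
(** Write [w_j] for the generators and [omega] for the solid angle at a lattice
    point.  After rescaling, [omega x] is a Gaussian-type integral over the
    tangent cone of [K] at [x]; so it is constant in the interior of [K], and the
    alternating sum of its translates by a set of multiples of the generators is
    supported in a parallelepiped and invariant under central symmetry.

    If every extreme ray contains a nonzero lattice point [y_j], then multiplying
    the series by [Q s = \prod_j (1 - e^(2 pi i <s, y_j>))] leaves the finite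
    exponential sum [P] of these alternating sums, and the symmetry says that
    [P (-s)] and [(-1)^d Q (-s)] arise from [P s] and [Q s] by the same factor.
    The identity [Q * alpha = P] extends from the domain of convergence by
    uniqueness of continuation.

    If some extreme ray contains no nonzero lattice point, there is no meromorphic
    continuation.  Let [xi] and [eta] be real with [<xi, w_i> = <eta, w_i> = 0] and
    [<eta, w_k> > 0] for [k != i].  If the sum were bounded near
    [xi + n + i eta], with [n] a lattice point, then the averages
    [1/N \sum_m omega(m) e^(-2 pi <eta + u/N, m>) e^(2 pi i t <xi, m>)] would tend
    to 0 for [t] near 1.  Exponential moments propagate this to [t = 0], where
    the lattice points near the ray keep the averages away from 0.  By
    irrationality the numbers [<n, w_i>] are dense, so a local denominator
    vanishes on the real hypersurface [Im <s, w_i> = 0], hence on an open set. *)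

(* Function theory enters through uniqueness, which is reached without power series: Goursat's
   theorem bounds a holomorphic function at the centre of a disc by its values on the circle, and
   dividing a function that vanishes near [a] by high powers of [w - a] spreads its zeros. A
   meromorphic representative is unconstrained where its denominator vanishes; so an identity is
   transported as a statement on small balls arbitrarily near a point, and becomes pointwise only at
   regular points.

   In the irrational case, [u/N] and [1/N] imitate the simple pole that a rational ray would create.
   For [t] near 1 the characters may cancel; at [t = 0] all summands are nonnegative, and about [N]
   lattice points at bounded distance from the ray have weights of order 1. The averages are
   analytic in [t] and uniformly bounded on a strip around the real axis, so a limit 0 on an
   interval should spread along the axis, as in Vitali's theorem. The proof works instead with the
   space of test functions whose averages tend to 0; the exponential moments make it closed in an
   exponentially weighted norm. *)
Require Import Defs.
From HB Require Import structures.
From mathcomp Require Import all_boot all_order all_algebra.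
From mathcomp Require Import all_classical all_reals all_analysis.
From mathcomp Require Import measurable_realfun complex.
From mathcomp Require Import finmap zify ring lra.
From mathcomp Require summability.

Import Order.TTheory GRing.Theory Num.Theory.
Import numFieldNormedType.Exports.

Set Implicit Arguments.
Unset Strict Implicit.
Unset Printing Implicit Defensive.

Local Open Scope classical_set_scope.
Local Open Scope ring_scope.

(** * Complex analysis in one variable *)

Section RealIntegral.
Context {R : realType}.
Implicit Types (g : R -> R) (a b : R).

Definition rint g a b : R := \int[@lebesgue_measure R]_(x in `[a, b]) g x.

Lemma integrable_itv g a b : {in `[a, b], continuous g} ->
  (@lebesgue_measure R).-integrable `[a, b] (EFin \o g).
Proof.
move=> gc; apply: continuous_compact_integrable; first exact: segment_compact.
by apply: continuous_in_subspaceT => x; rewrite in_setE => xab; apply: gc.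
Qed.

Lemma rint_cst a b (k : R) : a <= b -> rint (fun=> k) a b = k * (b - a).
Proof.
move=> ab; rewrite /rint Rintegral_cst//= lebesgue_measure_itv/= lte_fin.
by case: ltgtP ab => //= -> _; rewrite subrr.
Qed.

Lemma rintB g1 g2 a b : {in `[a, b], continuous g1} ->
  {in `[a, b], continuous g2} ->
  rint (fun x => g1 x - g2 x) a b = rint g1 a b - rint g2 a b.
Proof. by move=> c1 c2; rewrite /rint RintegralB//; exact: integrable_itv. Qed.

Lemma rint_split g a m b : a <= m <= b -> {in `[a, b], continuous g} ->
  rint g a b = rint g a m + rint g m b.
Proof.
move=> /andP[am mb] gc.
have gi := integrable_itv gc.
have gmb : (@lebesgue_measure R).-integrable `]m, b] (EFin \o g).
  by apply: (integrableS _ _ _ gi) => //; apply: subset_itvr; rewrite bnd_simp.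
rewrite /rint -(Rintegral_itv_obnd_cbnd gmb) -(@Rintegral_itvB R g (BLeft a) (BRight b) m gi) ?bnd_simp//.
by rewrite subrKC.
Qed.

Lemma rint_near g a b (k e : R) : a <= b -> {in `[a, b], continuous g} ->
  (forall x, x \in `[a, b] -> `|g x - k| <= e) ->
  `|rint g a b - k * (b - a)| <= e * (b - a).
Proof.
move=> ab gc ge.
have kc : {in `[a, b], continuous (fun _ : R => k)} by move=> x _; apply: cvg_cst.
have gk : {in `[a, b], continuous (fun x => g x - k)}.
  by move=> x xab; apply: cvgB; [exact: gc|exact: kc].
rewrite -rint_cst// -rintB// -(rint_cst e ab).
apply: le_trans (le_normr_Rintegral _ _) _ => //; first exact: integrable_itv.
apply: le_Rintegral => //.
- have := integrable_itv gk; exact: integrable_norm.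
- by apply: integrable_itv => x _; apply: cvg_cst.
Qed.

End RealIntegral.

Notation nc := (@ComplexField.Normc.normc _).

Section ComplexNorm.
Context {R : realType}.
Implicit Types (z w : R[i]).
Local Open Scope complex_scope.

Lemma normr_nc z : `|z| = (nc z)%:C.
Proof. by []. Qed.

Lemma nc_ge0 z : 0 <= nc z.
Proof. by case: z => a b; rewrite sqrtr_ge0. Qed.

Lemma Re_le_nc z : `|complex.Re z| <= nc z.
Proof. by have := normc_ge_Re z; rewrite lecR. Qed.

Lemma Im_le_nc z : `|complex.Im z| <= nc z.
Proof.
by case: z => a b /=; rewrite -sqrtr_sqr ler_wsqrtr// lerDr sqr_ge0.
Qed.

Lemma nc_real (x : R) : nc x%:C = `|x|.
Proof. by rewrite /= expr0n/= addr0 sqrtr_sqr. Qed.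

Lemma nc_imag (x : R) : nc (0 +i* x) = `|x|.
Proof. by rewrite /= expr0n/= add0r sqrtr_sqr. Qed.

Lemma nc_le_ReIm z : nc z <= `|complex.Re z| + `|complex.Im z|.
Proof.
case: z => a b /=; rewrite -(nc_real a) -(nc_imag b).
apply: le_trans (le_normcD _ _) => /=.
by rewrite addr0 add0r.
Qed.

Lemma ncB z w : nc (z - w) = nc (w - z).
Proof. by rewrite -normcN opprB. Qed.

Lemma nc_dist z w : `|nc z - nc w| <= nc (z - w).
Proof.
have h1 := le_normcD (z - w) w; have h2 := le_normcD (w - z) z.
move: h1 h2; rewrite !subrK (ncB w z) ler_norml => h1 h2; apply/andP; split; lra.
Qed.

End ComplexNorm.

(** * Goursat's theorem on rectangles *)

Section Goursat.
Context {R : realType}.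
Local Open Scope complex_scope.
Implicit Types (f : R[i] -> R[i]) (z w : R[i]).

(** The epsilon form of complex differentiability with the real-valued modulus [nc], which keeps the
    estimates in the totally ordered field [R]; [cdiffP] identifies it with [differentiable]. *)
Definition cdiff f z : Prop := exists D : R[i], forall e : R, 0 < e ->
  exists2 dl : R, 0 < dl &
    forall w, nc w < dl -> nc (f (z + w) - f z - D * w) <= e * nc w.

Lemma cdiff_cont f z : cdiff f z -> forall e : R, 0 < e ->
  exists2 dl : R, 0 < dl & forall w, nc w < dl -> nc (f (z + w) - f z) <= e.
Proof.
move=> [D /(_ 1 ltr01)[dl dl0 H]] e e0.
have k0 : 0 < 1 + nc D by rewrite ltr_pwDl ?nc_ge0.
exists (Num.min dl (e / (1 + nc D))); first by rewrite lt_min dl0 divr_gt0.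
move=> w; rewrite lt_min => /andP[/H{}H].
rewrite ltr_pdivlMr// => we.
have -> : f (z + w) - f z = (f (z + w) - f z - D * w) + D * w by rewrite subrK.
apply: le_trans (le_normcD _ _) _; rewrite ComplexField.Normc.normcM.
by apply: le_trans (ltW we); lra.
Qed.

(* Real part of the integral of [f] along the boundary of the rectangle. *)
Definition rect_int f (a b c d : R) : R :=
  rint (fun x => complex.Re (f (x +i* c)) - complex.Re (f (x +i* d))) a b -
  rint (fun y => complex.Im (f (b +i* y)) - complex.Im (f (a +i* y))) c d.

Definition hol_rect f (a b c d : R) : Prop :=
  forall x y, x \in `[a, b] -> y \in `[c, d] -> cdiff f (x +i* y).

(** Stated for any 1-Lipschitz [phi] and path [g], so as to cover the real part, the imaginary part
    and the modulus along horizontal and vertical segments. *)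
Lemma cdiff_path_cont f (phi : R[i] -> R) (g : R -> R[i]) (x : R) :
  (forall z w, `|phi z - phi w| <= nc (z - w)) ->
  (forall t, nc (g t - g x) <= `|t - x|) ->
  cdiff f (g x) -> {for x, continuous (fun t => phi (f (g t)))}.
Proof.
move=> hphi hg /cdiff_cont H; apply/cvgrPdist_le => e /H[dl dl0 {}H].
near=> t; rewrite distrC; apply: le_trans (hphi _ _) _.
rewrite -(subrKC (g x) (g t)); apply: H; apply: le_lt_trans (hg _) _.
by rewrite distrC; near: t; exact: (@cvgr_dist_lt _ _ _ _ _ id x).
Unshelve. all: by end_near. Qed.

Lemma hol_rect_cont f (a b c d : R) : hol_rect f a b c d ->
  [/\ forall y, y \in `[c, d] ->
        {in `[a, b], continuous (fun x => complex.Re (f (x +i* y)))} &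
      forall x, x \in `[a, b] ->
        {in `[c, d], continuous (fun y => complex.Im (f (x +i* y)))}].
Proof.
move=> H; split=> [y yi x xi|x xi y yi].
- apply: (@cdiff_path_cont f (@complex.Re R) (fun x => x +i* y) x); last exact: H.
    by move=> z w; rewrite -raddfB Re_le_nc.
  move=> t; have -> : t +i* y - (x +i* y) = (t - x)%:C.
    by apply/eqP; rewrite eq_complex/= subrr !eqxx.
  by rewrite nc_real.
- apply: (@cdiff_path_cont f (@complex.Im R) (fun y => x +i* y) y); last exact: H.
    by move=> z w; rewrite -raddfB Im_le_nc.
  move=> t; have -> : x +i* t - (x +i* y) = 0 +i* (t - y).
    by apply/eqP; rewrite eq_complex/= subrr !eqxx.
  by rewrite nc_imag.
Qed.

Lemma hol_rect_cont2 f (a b c d : R) : a <= b -> c <= d -> hol_rect f a b c d ->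
  {in `[a, b], continuous
     (fun x => complex.Re (f (x +i* c)) - complex.Re (f (x +i* d)))} /\
  {in `[c, d], continuous
     (fun y => complex.Im (f (b +i* y)) - complex.Im (f (a +i* y)))}.
Proof.
move=> ab cd /hol_rect_cont[H1 H2]; split=> t ti.
- by apply: cvgB; apply: H1; rewrite // in_itv/= lexx cd.
- by apply: cvgB; apply: H2; rewrite // in_itv/= lexx ab.
Qed.

Lemma sub_hol_rect f (a b c d a' b' c' d' : R) :
  a <= a' -> b' <= b -> c <= c' -> d' <= d ->
  hol_rect f a b c d -> hol_rect f a' b' c' d'.
Proof.
move=> aa bb cc dd H x y; rewrite !in_itv/= => /andP[x1 x2] /andP[y1 y2].
by apply: H; rewrite in_itv/=; apply/andP; split; apply: le_trans; eassumption.
Qed.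

Lemma rect_int_splitx f (a m b c d : R) : a <= m <= b -> c <= d ->
  hol_rect f a b c d ->
  rect_int f a b c d = rect_int f a m c d + rect_int f m b c d.
Proof.
move=> amb cd H; have /andP[am mb] := amb.
have ab := le_trans am mb.
rewrite /rect_int (rint_split amb); last by have [] := hol_rect_cont2 ab cd H.
have [_ H2] := hol_rect_cont H.
have aI : a \in `[a, b] by rewrite in_itv/= lexx.
have bI : b \in `[a, b] by rewrite in_itv/= lexx andbT.
have mI : m \in `[a, b] by rewrite in_itv/= am.
rewrite !(@rintB _ _ _ c d); try exact: H2.
ring.
Qed.

Lemma rect_int_splity f (a b c m d : R) : a <= b -> c <= m <= d ->
  hol_rect f a b c d ->
  rect_int f a b c d = rect_int f a b c m + rect_int f a b m d.
Proof.
move=> ab cmd H; have /andP[cm md] := cmd.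
have cd := le_trans cm md.
rewrite /rect_int (@rint_split _ _ c m d cmd); last by have [] := hol_rect_cont2 ab cd H.
have [H1 _] := hol_rect_cont H.
have aI : c \in `[c, d] by rewrite in_itv/= lexx.
have bI : d \in `[c, d] by rewrite in_itv/= lexx andbT.
have mI : m \in `[c, d] by rewrite in_itv/= cm.
rewrite !(@rintB _ _ _ a b); try exact: H1.
ring.
Qed.

(* The real part of the boundary integral of an affine function vanishes. *)
Lemma rect_int_near f (a b c d : R) (p D : R[i]) (e : R) : a <= b -> c <= d ->
  hol_rect f a b c d ->
  (forall x y, x \in `[a, b] -> y \in `[c, d] ->
     nc (f (x +i* y) - f p - D * (x +i* y - p)) <= e) ->
  `|rect_int f a b c d| <= 2 * e * ((b - a) + (d - c)).
Proof.
move=> ab cd H He.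
have [c1 c2] := hol_rect_cont2 ab cd H.
have aI : a \in `[a, b] by rewrite in_itv/= lexx.
have bI : b \in `[a, b] by rewrite in_itv/= lexx andbT.
have cI : c \in `[c, d] by rewrite in_itv/= lexx.
have dI : d \in `[c, d] by rewrite in_itv/= lexx andbT.
have key z w : nc (f z - f p - D * (z - p)) <= e ->
    nc (f w - f p - D * (w - p)) <= e -> nc (f z - f w - D * (z - w)) <= 2 * e.
  move=> h1 h2.
  have -> : f z - f w - D * (z - w) =
      (f z - f p - D * (z - p)) - (f w - f p - D * (w - p)) by ring.
  apply: le_trans (le_normcD _ _) _; rewrite normcN; lra.
(* For an affine function of slope [D] the horizontal integrand is the real part of [D] times
   [i (c - d)], that is [Im D * (d - c)], and the vertical one is [Im D * (b - a)]. After
   integration the two constants cancel. *)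
have h1 := @rint_near _ _ _ _ (complex.Im D * (d - c)) (2 * e) ab c1 _.
have h2 := @rint_near _ _ _ _ (complex.Im D * (b - a)) (2 * e) cd c2 _.
rewrite /rect_int; move: h1 h2; set A := rint _ _ _; set B := rint _ _ _.
move=> h1 h2.
have {}h1 : `|A - complex.Im D * (d - c) * (b - a)| <= 2 * e * (b - a).
  apply: h1 => x xi.
  apply: le_trans (key _ _ (He _ _ xi cI) (He _ _ xi dI)).
  apply: le_trans _ (Re_le_nc _); rewrite le_eqVlt; apply/orP; left; apply/eqP.
  congr `| _ |; case: (f _) => f1 f2; case: (f _) => f3 f4; case: (D) => D1 D2 /=.
  ring.
have {}h2 : `|B - complex.Im D * (b - a) * (d - c)| <= 2 * e * (d - c).
  apply: h2 => y yi.
  apply: le_trans (key _ _ (He _ _ bI yi) (He _ _ aI yi)).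
  apply: le_trans _ (Im_le_nc _); rewrite le_eqVlt; apply/orP; left; apply/eqP.
  congr `| _ |; case: (f _) => f1 f2; case: (f _) => f3 f4; case: (D) => D1 D2 /=.
  ring.
move: h1 h2; rewrite !ler_norml => /andP[? ?] /andP[? ?]; apply/andP; split; lra.
Qed.

End Goursat.

Section GoursatTheorem.
Context {R : realType}.
Local Open Scope complex_scope.
Implicit Types (f : R[i] -> R[i]).

Lemma nested_intervals (u v : nat -> R) :
  (forall n, u n <= u n.+1) -> (forall n, v n.+1 <= v n) ->
  (forall n, u n <= v n) -> exists x, forall n, u n <= x <= v n.
Proof.
move=> uS vS uv.
have /nondecreasing_seqP um := uS.
have /nonincreasing_seqP vm := vS.
have uvmn m n : u m <= v n.
  have [/um h|/ltnW/vm h] := leqP m n; first exact: le_trans h (uv n).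
  exact: le_trans (uv m) h.
exists (sup (range u)) => n; apply/andP; split.
  apply: ub_le_sup; last by exists n.
  by exists (v 0%N) => _ [m _ <-].
apply: ge_sup; first by exists (u 0%N), 0%N.
by move=> _ [m _ <-].
Qed.

Lemma rect_int_quarter f (a b s t : R) : 0 <= s -> 0 <= t ->
  hol_rect f a (a + 2 * s) b (b + 2 * t) ->
  exists i j : bool, `|rect_int f a (a + 2 * s) b (b + 2 * t)| <=
    4 * `|rect_int f (a + i%:R * s) (a + i%:R * s + s)
                     (b + j%:R * t) (b + j%:R * t + t)|.
Proof.
move=> s0 t0 H.
have ab : a <= a + 2 * s by lra.
have as_ : a <= a + s <= a + 2 * s by lra.
have bt : b <= b + t <= b + 2 * t by lra.
rewrite (rect_int_splity ab bt H).
rewrite (rect_int_splitx as_ (m := a + s)); [|lra|]; last first.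
  by apply: sub_hol_rect H => //; lra.
rewrite (rect_int_splitx as_ (m := a + s)); [|lra|]; last first.
  by apply: sub_hol_rect H => //; lra.
have e00 : a + 0%:R * s = a by rewrite mul0r addr0.
have e01 : b + 0%:R * t = b by rewrite mul0r addr0.
have e10 : a + 1%:R * s = a + s by rewrite mul1r.
have e11 : b + 1%:R * t = b + t by rewrite mul1r.
have -> : a + 2 * s = a + s + s by ring.
have -> : b + 2 * t = b + t + t by ring.
set A := rect_int f a _ b _; set B := rect_int f _ _ b _.
set C := rect_int f a _ _ _; set D := rect_int f (a + s) _ (b + t) _.
have hn : `|A + B + (C + D)| <= `|A| + `|B| + (`|C| + `|D|).
  by apply: le_trans (ler_normD _ _) _; apply: lerD; exact: ler_normD.
have [hA|hA] := leP `|A + B + (C + D)| (4 * `|A|).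
  by exists false, false; rewrite e00 e01.
have [hB|hB] := leP `|A + B + (C + D)| (4 * `|B|).
  by exists true, false; rewrite e10 e01.
have [hC|hC] := leP `|A + B + (C + D)| (4 * `|C|).
  by exists false, true; rewrite e00 e11.
have [hD|hD] := leP `|A + B + (C + D)| (4 * `|D|).
  by exists true, true; rewrite e10 e11.
lra.
Qed.

Lemma goursat f (a b c d : R) : a < b -> c < d -> hol_rect f a b c d ->
  rect_int f a b c d = 0.
Proof.
move=> ab cd H; apply/eqP; rewrite -normr_eq0 eq_le normr_ge0 andbT leNgt.
apply/negP => K0; set K := `|_| in K0.
pose s n : R := (b - a) / 2 ^+ n; pose t n : R := (d - c) / 2 ^+ n.
have p0 n : 0 < 2 ^+ n :> R by rewrite exprn_gt0.
have s0 n : 0 < s n by rewrite divr_gt0// subr_gt0.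
have t0 n : 0 < t n by rewrite divr_gt0// subr_gt0.
have sS n : s n = 2 * s n.+1.
  by rewrite /s exprS; field; rewrite lt0r_neq0.
have tS n : t n = 2 * t n.+1.
  by rewrite /t exprS; field; rewrite lt0r_neq0.
pose good (q : R * R * nat) := let: (x, y, n) := q in
  [/\ a <= x, x + s n <= b, c <= y, y + t n <= d &
    K <= 4 ^+ n * `|rect_int f x (x + s n) y (y + t n)|].
(* The step is conditional on [good q] because [dependent_choice] asks for a successor of every
   triple. *)
pose step (q q' : R * R * nat) := good q ->
  let: (x, y, n) := q in let: (x', y', n') := q' in
  [/\ good q', n' = n.+1, x <= x', x' + s n' <= x + s n &
     y <= y' /\ y' + t n' <= y + t n].
have [F [F0 FS]] : {F : nat -> R * R * nat | F 0%N = (a, c, 0%N) /\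
    forall n, step (F n) (F n.+1)}.
  apply: dependent_choice => -[[x y] n]; apply: cid.
  have [g|ng] := pselect (good (x, y, n)); last by exists (x, y, n) => /ng.
  have [h1 h2 h3 h4 h5] := g.
  have := @rect_int_quarter f x y _ _ (ltW (s0 n.+1)) (ltW (t0 n.+1)).
  rewrite -sS -tS; case; first by apply: sub_hol_rect H.
  move=> i [j ij].
  have i0 : 0 <= i%:R * s n.+1 <= s n.+1.
    by case: (i); rewrite ?mul1r ?mul0r lexx ltW.
  have j0 : 0 <= j%:R * t n.+1 <= t n.+1.
    by case: (j); rewrite ?mul1r ?mul0r lexx ltW.
  have := sS n; have := tS n => tn sn.
  exists (x + i%:R * s n.+1, y + j%:R * t n.+1, n.+1) => _; split=> //; [|lra|lra|lra].
  split; [lra|lra|lra|lra|].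
  apply: le_trans h5 _; rewrite exprSr -mulrA ler_pM2l ?exprn_gt0//.
have Fg n : good (F n) /\ (F n).2 = n.
  elim: n => [|n [g e]].
    rewrite F0; split=> //.
    by split; rewrite ?/s ?/t ?expr0 ?divr1 ?mul1r ?subrKC.
  have := FS n g; case: (F n) (F n.+1) e => [[x y] m] [[x' y'] m'] /= -> [gg e2 _ _ _].
  by rewrite -e2.
pose xs n := (F n).1.1; pose ys n := (F n).1.2.
have Fe n : F n = (xs n, ys n, n).
  by have [_] := Fg n; rewrite /xs /ys; case: (F n) => [[x y] m] /= ->.
have gn n : good (xs n, ys n, n) by rewrite -Fe; have [] := Fg n.
have Sn n := FS n (proj1 (Fg n)).
have [X HX] : exists x, forall n, xs n <= x <= xs n + s n.
  apply: (@nested_intervals xs (fun n => xs n + s n)) => n.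
  - by have := Sn n; rewrite !Fe => -[].
  - by have := Sn n; rewrite !Fe => -[].
  - by rewrite lerDl ltW.
have [Y HY] : exists x, forall n, ys n <= x <= ys n + t n.
  apply: (@nested_intervals ys (fun n => ys n + t n)) => n.
  - by have := Sn n; rewrite !Fe => -[_ _ _ _ []].
  - by have := Sn n; rewrite !Fe => -[_ _ _ _ []].
  - by rewrite lerDl ltW.
have XY0 : cdiff f (X +i* Y).
  apply: H; rewrite in_itv/=.
    by have := HX 0%N; have [] := gn 0%N => *; lra.
  by have := HY 0%N; have [] := gn 0%N => *; lra.
have L0 : 0 < (b - a) + (d - c) by rewrite addr_gt0 ?subr_gt0.
pose L := (b - a) + (d - c); rewrite -/L in L0.
(* The [n]-th rectangle has half-perimeter [L / 2 ^+ n], so that differentiability with error [e]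
   gives [K <= 2 * e * L ^+ 2], which is [K / 2] for this choice. *)
pose e := K / (4 * L ^+ 2).
have e0 : 0 < e by rewrite divr_gt0// mulr_gt0// exprn_gt0.
have [D /(_ _ e0)[dl dl0 Hd]] := XY0.
have [n nd] : exists n, L / 2 ^+ n < dl.
  exists (Num.bound (L / dl)).
  rewrite ltr_pdivrMr// mulrC -ltr_pdivrMr//.
  apply: lt_trans (archi_boundP _) _; first by rewrite ltW// divr_gt0.
  by rewrite -natrX ltr_nat ltn_expl.
have [h1 h2 h3 h4 h5] := gn n.
have stL : s n + t n = L / 2 ^+ n by rewrite /s /t -mulrDl.
have : `|rect_int f (xs n) (xs n + s n) (ys n) (ys n + t n)| <=
    2 * (e * (L / 2 ^+ n)) * ((xs n + s n - xs n) + (ys n + t n - ys n)).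
  apply: (@rect_int_near _ _ _ _ _ _ (X +i* Y) D).
  - by rewrite lerDl ltW.
  - by rewrite lerDl ltW.
  - exact: sub_hol_rect H.
  move=> x y; rewrite !in_itv/= => xi yi.
  have hw : nc (x +i* y - (X +i* Y)) <= L / 2 ^+ n.
    apply: le_trans (nc_le_ReIm _) _ => /=; rewrite -stL; apply: lerD.
      by have := HX n => ?; rewrite ler_norml; lra.
    by have := HY n => ?; rewrite ler_norml; lra.
  rewrite -[in f _](subrKC (X +i* Y) (x +i* y)).
  apply: le_trans (Hd _ (le_lt_trans hw nd)) _.
  by rewrite ler_pM2l.
rewrite !(addrC _ (s n)) !(addrC _ (t n)) !addrK stL => h6.
have : K <= 4 ^+ n * (2 * (e * (L / 2 ^+ n)) * (L / 2 ^+ n)).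
  by apply: le_trans h5 _; rewrite ler_pM2l ?exprn_gt0// !(addrC _ (s n)) !(addrC _ (t n)).
have -> : 4 ^+ n * (2 * (e * (L / 2 ^+ n)) * (L / 2 ^+ n)) = K / 2.
  have -> : 4 ^+ n = 2 ^+ n * 2 ^+ n :> R by rewrite -exprMn -natrM.
  rewrite /e; field; rewrite !lt0r_neq0//.
lra.
Qed.

End GoursatTheorem.

(** * Rules of complex differentiation *)

Section ComplexDerivative.
Context {R : realType}.
Local Open Scope complex_scope.
Implicit Types (f g : R[i] -> R[i]) (z w : R[i]).

Lemma pos_complex (e : R[i]) : 0 < e -> exists2 r : R, 0 < r & e = r%:C.
Proof.
case: e => a b; rewrite ltcE/= => /andP[/eqP -> a0]; by exists a.
Qed.

Lemma nbhs_ncP z (P : set R[i]) :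
  nbhs z P <-> exists2 r : R, 0 < r & forall w, nc (w - z) < r -> P w.
Proof.
split.
  move=> /nbhs_ballP[e /= /pos_complex[r r0 ->] h]; exists r => // w wz.
  by apply: h; rewrite -ball_normE /ball_/= -normrN opprB normr_nc ltcR.
move=> [r r0 h]; apply/nbhs_ballP; exists r%:C; first by rewrite /= ltcR.
move=> w; rewrite -ball_normE /ball_/= -normrN opprB normr_nc ltcR; exact: h.
Qed.

Lemma cdiffP f z : cdiff f z <-> differentiable (f : R[i]^o -> R[i]^o) z.
Proof.
split=> [[D H]|/derivable1_diffP].
- apply/derivable1_diffP/cvg_ex; exists D.
  apply/cvgrPdist_le => /= e /pos_complex[r r0 ->].
  have [dl dl0 {}H] := H _ r0.
  apply/nbhs_ncP; exists dl => // w; rewrite subr0 => wd w0.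
  rewrite /GRing.scale/= mulr1 distrC normr_nc lecR (addrC w).
  have -> : w^-1 * (f (z + w) - f z) - D = w^-1 * (f (z + w) - f z - D * w).
    by rewrite [RHS]mulrBr mulrCA mulVf// mulr1.
  have n0 : 0 < nc w.
    rewrite lt_def nc_ge0 andbT; apply/eqP => /ComplexField.Normc.eq0_normc w0'.
    by rewrite w0' eqxx in w0.
  rewrite ComplexField.Normc.normcM ComplexField.Normc.normcV ler_pdivrMl// [leRHS]mulrC.
  exact: H.
- rewrite /derivable => /cvg_ex[/= D /cvgrPdist_le H].
  exists D => e e0; have /H/nbhs_ncP[/= dl dl0 {}H] : 0 < e%:C by rewrite ltcR.
  exists dl => // w wd; have [->|w0] := eqVneq w 0.
    by rewrite addr0 mulr0 !subrr ComplexField.Normc.normc0 mulr0.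
  have := H w; rewrite subr0 => /(_ wd w0).
  rewrite /GRing.scale/= mulr1 distrC normr_nc lecR (addrC w) => h.
  have -> : f (z + w) - f z - D * w = w * (w^-1 * (f (z + w) - f z) - D).
    by rewrite mulrBr mulrA mulfV// mul1r [w * D]mulrC.
  by rewrite ComplexField.Normc.normcM mulrC ler_wpM2r ?nc_ge0.
Qed.

Lemma cdiff_near f g z (r : R) : 0 < r ->
  (forall w, nc (w - z) < r -> f w = g w) -> cdiff f z -> cdiff g z.
Proof.
move=> r0 fg [D H]; exists D => e /H[dl dl0 {}H].
exists (Num.min dl r); first by rewrite lt_min dl0.
move=> w; rewrite lt_min => /andP[/H h wr].
by rewrite -!fg ?subrr ?ComplexField.Normc.normc0// addrAC subrr add0r.
Qed.

Lemma cdiff_cst k z : cdiff (fun=> k) z.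
Proof. by apply/cdiffP; exact: differentiable_cst. Qed.

Lemma cdiff_id z : cdiff id z.
Proof.
exists 1 => e e0; exists 1 => // w _.
have -> : z + w - z - 1 * w = 0 by ring.
by rewrite ComplexField.Normc.normc0 mulr_ge0 ?nc_ge0// ltW.
Qed.

Lemma cdiffD f g z : cdiff f z -> cdiff g z -> cdiff (fun w => f w + g w) z.
Proof. by move=> /cdiffP hf /cdiffP hg; apply/cdiffP; exact: differentiableD. Qed.

Lemma cdiffB f g z : cdiff f z -> cdiff g z -> cdiff (fun w => f w - g w) z.
Proof. by move=> /cdiffP hf /cdiffP hg; apply/cdiffP; exact: differentiableB. Qed.

Lemma cdiffM f g z : cdiff f z -> cdiff g z -> cdiff (fun w => f w * g w) z.
Proof. by move=> /cdiffP hf /cdiffP hg; apply/cdiffP; exact: differentiableM. Qed.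

Lemma cdiffV f z : f z != 0 -> cdiff f z -> cdiff (fun w => (f w)^-1) z.
Proof.
by move=> fz /cdiffP hf; apply/cdiffP; exact: differentiableV.
Qed.

Lemma cdiffX f n z : cdiff f z -> cdiff (fun w => f w ^+ n) z.
Proof.
move=> hf; elim: n => [|n IH]; first exact: cdiff_cst.
have -> : (fun w => f w ^+ n.+1) = fun w => f w * f w ^+ n.
  by apply/funext => w; rewrite exprS.
exact: cdiffM.
Qed.

Lemma cdiff_comp f g z : cdiff g z -> cdiff f (g z) -> cdiff (fun w => f (g w)) z.
Proof.
move=> [Dg Hg] [Df Hf]; exists (Df * Dg) => e e0.
have k0 : 0 < 1 + nc Dg by rewrite ltr_pwDl ?nc_ge0.
have l0 : 0 < 1 + nc Df by rewrite ltr_pwDl ?nc_ge0.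
have e1 : 0 < e / 2 / (1 + nc Dg) by rewrite !divr_gt0.
have e2 : 0 < e / 2 / (1 + nc Df) by rewrite !divr_gt0.
have [d1 d10 {}Hf] := Hf _ e1; have [d2 d20 Hg1] := Hg _ ltr01.
have [d3 d30 Hg2] := Hg _ e2.
exists (Num.min (Num.min d2 d3) (d1 / (1 + nc Dg))).
  by rewrite !lt_min d20 d30 divr_gt0.
move=> w; rewrite !lt_min => /andP[/andP[/Hg1 h1 /Hg2 h2]]; rewrite ltr_pdivlMr// => wd.
pose v := g (z + w) - g z.
have hv : nc v <= nc w * (1 + nc Dg).
  have -> : v = (v - Dg * w) + Dg * w by rewrite subrK.
  apply: le_trans (le_normcD _ _) _; rewrite ComplexField.Normc.normcM.
  by apply: le_trans (lerD h1 (lexx _)) _; rewrite mul1r mulrDr mulr1 mulrC.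
have := Hf v (le_lt_trans hv wd); rewrite {1}/v subrKC => h3.
have -> : f (g (z + w)) - f (g z) - Df * Dg * w =
  (f (g (z + w)) - f (g z) - Df * v) + Df * (v - Dg * w) by ring.
apply: le_trans (le_normcD _ _) _; rewrite ComplexField.Normc.normcM.
have n0 := nc_ge0 w.
have h4 : e / 2 / (1 + nc Dg) * nc v <= e / 2 * nc w.
  rewrite mulrAC ler_pdivrMr// -[leRHS]mulrA; apply: ler_wpM2l => //.
  by rewrite ltW// divr_gt0.
have h5 : nc Df * nc (v - Dg * w) <= e / 2 * nc w.
  apply: (@le_trans _ _ ((1 + nc Df) * (e / 2 / (1 + nc Df) * nc w))).
    by apply: ler_pM h2; rewrite ?nc_ge0// lerDr.
  by rewrite mulrA [(1 + _) * _]mulrC divfK ?gt_eqF.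
rewrite [leRHS](_ : _ = e / 2 * nc w + e / 2 * nc w); last by field.
exact: lerD (le_trans h3 h4) h5.
Qed.

Lemma cdiff_sum (I : Type) (r : seq I) (P : pred I) (F : I -> R[i] -> R[i]) z :
  (forall i, P i -> cdiff (F i) z) ->
  cdiff (fun w => \sum_(i <- r | P i) F i w) z.
Proof.
move=> H; elim: r => [|i r IH].
  have -> : (fun w => \sum_(i <- [::] | P i) F i w) = fun=> 0.
    by apply/funext => w; rewrite big_nil.
  exact: cdiff_cst.
have [Pi|Pi] := boolP (P i).
  have -> : (fun w => \sum_(i <- i :: r | P i) F i w) =
      fun w => F i w + \sum_(i <- r | P i) F i w.
    by apply/funext => w; rewrite big_cons Pi.
  by apply: cdiffD => //; exact: H.
have -> // : (fun w => \sum_(i <- i :: r | P i) F i w) =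
    fun w => \sum_(i <- r | P i) F i w.
by apply/funext => w; rewrite big_cons (negbTE Pi).
Qed.

Lemma cdiff_prod (I : Type) (r : seq I) (F : I -> R[i] -> R[i]) z :
  (forall i, cdiff (F i) z) -> cdiff (fun w => \prod_(i <- r) F i w) z.
Proof.
move=> H; elim: r => [|i r IH].
  have -> : (fun w => \prod_(i <- [::]) F i w) = fun=> 1.
    by apply/funext => w; rewrite big_nil.
  exact: cdiff_cst.
have -> : (fun w => \prod_(i <- i :: r) F i w) =
    fun w => F i w * \prod_(i <- r) F i w.
  by apply/funext => w; rewrite big_cons.
by apply: cdiffM => //; exact: H.
Qed.

End ComplexDerivative.

Section SegmentInduction.
Context {R : realType}.

(** Connectedness of the unit interval in the form used for continuation; [T] is the supremum of the
    initial segments on which [P] holds. *)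
Lemma locally_constant_segment (P : R -> Prop) :
  (forall t, 0 <= t <= 1 -> exists2 dl : R, 0 < dl &
     forall u, 0 <= u <= 1 -> `|u - t| < dl -> (P u <-> P t)) ->
  P 0 -> P 1.
Proof.
move=> H P0.
pose S := [set t : R | 0 <= t <= 1 /\ forall u, 0 <= u <= t -> P u].
have S0 : S 0.
  by split; rewrite ?lexx ?ler01// => u /le_anti <-.
have ubS : has_ubound S by exists 1 => t [/andP[]].
have supS : has_sup S by split=> //; exists 0.
pose T := sup S.
have T0 : 0 <= T by apply: ub_le_sup.
have T1 : T <= 1 by apply: ge_sup; [exists 0|move=> t [/andP[]]].
have [dl dl0 HT] : exists2 dl : R, 0 < dl &
     forall u, 0 <= u <= 1 -> `|u - T| < dl -> (P u <-> P T).
  by apply: H; rewrite T0.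
have [t [t01 Pt] Tt] := sup_adherent dl0 supS.
have tT : t <= T by apply: ub_le_sup.
have PT : P T.
  apply/(HT t) => //; first by rewrite distrC ger0_norm ?subr_ge0//; rewrite -/T in Tt; lra.
  by apply: Pt; lra.
have PTd u : 0 <= u <= 1 -> u < T + dl -> P u.
  move=> u01 uT; have [ut|tu] := leP u t; first by apply: Pt; lra.
  by apply/(HT u) => //; rewrite ltr_norml; rewrite -/T in Tt; lra.
have [T1'|T1'] := ltP T 1; last by apply: PTd; lra.
pose v := Num.min 1 (T + dl / 2).
have Tv : T < v by rewrite lt_min T1'; lra.
have v1 : v <= 1 by rewrite ge_min lexx.
have vT : v <= T + dl / 2 by rewrite ge_min lexx orbT.
suff : v <= T by rewrite leNgt Tv.
apply: ub_le_sup => //; split; first by lra.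
by move=> u uv; apply: PTd; lra.
Qed.

End SegmentInduction.

Section CauchyBound.
Context {R : realType}.
Local Open Scope complex_scope.
Implicit Types (f g : R[i] -> R[i]) (z w : R[i]).

Lemma cexpD z w : cexp (z + w) = cexp z * cexp w.
Proof.
case: z => a b; case: w => c d; rewrite /cexp/= expRD cosD sinD.
by apply/eqP; rewrite eq_complex/=; apply/andP; split; apply/eqP; ring.
Qed.

Lemma cexp0 : cexp (0 : R[i]) = 1.
Proof.
rewrite /cexp/= expR0 cos0 sin0.
by apply/eqP; rewrite eq_complex/=; apply/andP; split; apply/eqP; ring.
Qed.

Lemma nc_cexp z : nc (cexp z) = expR (complex.Re z).
Proof.
rewrite /cexp ComplexField.Normc.normcM nc_real ger0_norm ?expR_ge0//=.
by rewrite cos2Dsin2 sqrtr1 mulr1.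
Qed.

Lemma cexp_neq0 z : cexp z != 0.
Proof.
apply/eqP => h; have := nc_cexp z; rewrite h ComplexField.Normc.normc0 => /esym/eqP.
by rewrite gt_eqF// expR_gt0.
Qed.

Lemma derive_small (f : R -> R) (x D : R) : is_derive x 1 f D ->
  forall e : R, 0 < e -> exists2 dl : R, 0 < dl &
    forall h, `|h| < dl -> `|f (x + h) - f x - D * h| <= e * `|h|.
Proof.
move=> [/derivable1_diffP/derivable1_diffP + +] e e0; rewrite /derivable /derive.
move=> /[swap] fD H.
have : (fun h : R => h^-1 *: ((f \o shift x) (h *: (1:R)) - f x)) @ 0^' --> D.
  by rewrite -fD.
move=> /cvgrPdist_le/(_ e e0) /nbhs_ballP[dl /= dl0 {}H].
exists dl => // h hd; have [->|h0] := eqVneq h 0.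
  by rewrite addr0 mulr0 !subrr normr0 mulr0.
have := H h; rewrite /ball/= sub0r normrN => /(_ hd h0).
rewrite /GRing.scale/= mulr1 (addrC h) distrC => k.
have -> : f (x + h) - f x - D * h = h * (h^-1 * (f (x + h) - f x) - D).
  by rewrite [RHS]mulrBr mulrA mulfV// mul1r [h * D]mulrC.
by rewrite normrM mulrC ler_wpM2r.
Qed.

Lemma cexp_small (e : R) : 0 < e -> exists2 dl : R, 0 < dl &
  forall w, nc w < dl -> nc (cexp w - 1 - w) <= e * nc w.
Proof.
move=> e0.
(* With [N = nc w], each coordinate of the remainder is at most [3 * k * N], hence [e / 8] suffices;
   [k <= 1] keeps the exponential factor below 2. *)
pose k := Num.min (e / 8) 1.
have k0 : 0 < k by rewrite lt_min ltr01 andbT divr_gt0.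
have k1 : k <= 1 by rewrite ge_min lexx orbT.
have ke : k <= e / 8 by rewrite ge_min lexx.
have [d1 d10 H1] := @derive_small expR 0 _ (is_derive_expR 0) k k0.
have [d2 d20 H2] := @derive_small cos 0 _ (is_derive_cos 0) k k0.
have [d3 d30 H3] := @derive_small sin 0 _ (is_derive_sin 0) k k0.
exists (Num.min (Num.min d1 d2) (Num.min d3 (k / 2))).
  by rewrite !lt_min d10 d20 d30 divr_gt0.
move=> w; rewrite !lt_min => /andP[/andP[w1 w2] /andP[w3 w4]].
have ha := Re_le_nc w; have hb := Im_le_nc w; have n0 := nc_ge0 w.
have {}H1 := H1 _ (le_lt_trans ha w1).
have {}H2 := H2 _ (le_lt_trans hb w2).
have {}H3 := H3 _ (le_lt_trans hb w3).
move: H1 H2 H3; rewrite !add0r expR0 cos0 sin0 oppr0 mul0r !mul1r !subr0 addr0.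
move=> H1 H2 H3; apply: le_trans (nc_le_ReIm _) _.
move: ha hb w4 n0; move: (nc w) => N.
case: w {w1 w2 w3} H1 H2 H3 => a b /= H1 H2 H3 ha hb w4 n0.
have E : `|expR a - 1| <= k.
  have -> : expR a - 1 = (expR a - 1 - a) + a by rewrite subrK.
  apply: le_trans (ler_normD _ _) _.
  have : k * `|a| <= `|a| by rewrite ler_piMl.
  by lra.
have E2 : expR a <= 2 by move: E; rewrite ler_norml; lra.
have E0 : 0 <= expR a by exact: expR_ge0.
rewrite !mul0r !subr0 addr0.
have -> : expR a * cos b - 1 - a = (expR a - 1 - a) + expR a * (cos b - 1) by ring.
have -> : expR a * sin b - b = expR a * (sin b - b) + (expR a - 1) * b by ring.
have h1 : `|expR a - 1 - a + expR a * (cos b - 1)| <= k * N + 2 * (k * N).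
  apply: le_trans (ler_normD _ _) _; apply: lerD.
    by apply: le_trans H1 _; rewrite ler_pM2l.
  rewrite normrM ger0_norm//; apply: ler_pM => //.
  by apply: le_trans H2 _; rewrite ler_pM2l.
have h2 : `|expR a * (sin b - b) + (expR a - 1) * b| <= 2 * (k * N) + k * N.
  apply: le_trans (ler_normD _ _) _; apply: lerD.
    rewrite normrM ger0_norm//; apply: ler_pM => //.
    by apply: le_trans H3 _; rewrite ler_pM2l.
  by rewrite normrM; apply: ler_pM.
have h3 : k * N <= e / 8 * N by rewrite ler_wpM2r.
have h4 : 0 <= e * N by rewrite mulr_ge0// ltW.
apply: le_trans (lerD h1 h2) _.
lra.
Qed.

Lemma cdiff_cexp z : cdiff cexp z.
Proof.
exists (cexp z) => e e0.
have k0 : 0 < nc (cexp z) by rewrite nc_cexp expR_gt0.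
have [dl dl0 H] := cexp_small (divr_gt0 e0 k0).
exists dl => // w /H h.
have -> : cexp (z + w) - cexp z - cexp z * w = cexp z * (cexp w - 1 - w).
  by rewrite cexpD; ring.
by rewrite ComplexField.Normc.normcM mulrC -ler_pdivlMr// mulrAC.
Qed.

End CauchyBound.

(** * Circular means and unique continuation *)

Section UniqueContinuation.
Context {R : realType}.
Local Open Scope complex_scope.
Implicit Types (f g : R[i] -> R[i]) (z w : R[i]).

Lemma cexp_polar (x y : R) : cexp (x +i* y) = (expR x)%:C * cexp (0 +i* y).
Proof. by rewrite /cexp/= expR0 mul1r. Qed.

Lemma cexp_periodic z : cexp (z + (0 +i* (2 * pi))) = cexp z.
Proof.
case: z => a b; rewrite /cexp/= addr0 mulr_natl.
by rewrite -[in LHS](addr0 b) -/(GRing.natmul _ _) addr0 sinD2pi cosD2pi.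
Qed.

(* With [g w = f (z0 + exp w)], Goursat's theorem on a rectangle of height
   [2 pi] says that the circular means of [f] around [z0] do not depend on the
   radius. *)
Lemma circle_mean_Im f z0 (x1 x2 : R) : x1 < x2 ->
  (forall w, nc w <= expR x2 -> cdiff f (z0 + w)) ->
  rint (fun y => complex.Im (f (z0 + cexp (x2 +i* y)))) 0 (2 * pi) =
  rint (fun y => complex.Im (f (z0 + cexp (x1 +i* y)))) 0 (2 * pi).
Proof.
move=> x12 H; pose g w := f (z0 + cexp w).
have pi0 : 0 < 2 * pi :> R by rewrite mulr_gt0// pi_gt0.
have gH : hol_rect g x1 x2 0 (2 * pi).
  move=> x y; rewrite !in_itv/= => /andP[_ xx2] _.
  apply: (@cdiff_comp _ f (fun w => z0 + cexp w)).
    by apply: cdiffD; [exact: cdiff_cst|exact: cdiff_cexp].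
  by apply: H; rewrite nc_cexp/= ler_expR.
have := goursat x12 pi0 gH; rewrite /rect_int.
have -> : (fun x => complex.Re (g (x +i* 0)) - complex.Re (g (x +i* (2 * pi)))) =
    fun=> 0.
  apply/funext => x; rewrite /g.
  have -> : x +i* (2 * pi) = x +i* 0 + (0 +i* (2 * pi)) :> R[i].
    by apply/eqP; rewrite eq_complex/= addr0 add0r !eqxx.
  by rewrite cexp_periodic subrr.
rewrite (rint_cst _ (ltW x12)) mul0r sub0r => /eqP; rewrite oppr_eq0 => /eqP.
have [_ H2] := hol_rect_cont gH.
rewrite rintB; [|by apply: H2; rewrite in_itv/= lexx ltW..].
by move/eqP; rewrite subr_eq0 => /eqP.
Qed.

(** The mean of the imaginary part over a circle of tiny radius is close to its value at [z0]. By
    [circle_mean_Im] it equals the mean over the large circle, which is at most [M]. *)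
Lemma circle_bound_Im f z0 (x M : R) :
  (forall w, nc w <= expR x -> cdiff f (z0 + w)) ->
  (forall y, y \in `[0, 2 * pi] ->
     `|complex.Im (f (z0 + cexp (x +i* y)))| <= M) ->
  `|complex.Im (f z0)| <= M.
Proof.
move=> H HM; apply/ler_addgt0Pl => e e0.
have pi0 : 0 < 2 * pi :> R by rewrite mulr_gt0// pi_gt0.
have f0 : cdiff f z0.
  by have := H 0; rewrite addr0; apply; rewrite ComplexField.Normc.normc0 expR_ge0.
have [dl dl0 Hd] := cdiff_cont f0 e0.
pose x1 := Num.min (x - 1) (ln (dl / 2)).
have x1x : x1 < x by rewrite gt_min; apply/orP; left; lra.
have x1d : expR x1 < dl.
  apply: (@le_lt_trans _ _ (dl / 2)); last by lra.
  by rewrite -[leRHS]lnK ?posrE ?divr_gt0// ler_expR ge_min lexx orbT.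
have E := circle_mean_Im x1x H.
have hc (u : R) : u <= x -> {in `[0, 2 * pi],
    continuous (fun y => complex.Im (f (z0 + cexp (u +i* y))))}.
  move=> ux y _.
  apply: (@cdiff_path_cont _ (fun w => f (z0 + cexp w)) (@complex.Im R) (fun y => u +i* y)).
  - by move=> z w; rewrite -raddfB Im_le_nc.
  - move=> t; have -> : u +i* t - (u +i* y) = 0 +i* (t - y).
      by apply/eqP; rewrite eq_complex/= subrr !eqxx.
    by rewrite nc_imag.
  - apply: (@cdiff_comp _ f (fun w => z0 + cexp w)).
      by apply: cdiffD; [exact: cdiff_cst|exact: cdiff_cexp].
    by apply: H; rewrite nc_cexp/= ler_expR.
have h1 := @rint_near _ _ _ _ (complex.Im (f z0)) e (ltW pi0) (hc x1 (ltW x1x)).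
have h2 := @rint_near _ _ _ _ 0 M (ltW pi0) (hc x (lexx x)).
move: h1 h2; rewrite E subr0 mul0r subr0; move: (rint _ _ _) => A h1 h2.
have {}h1 : `|A - complex.Im (f z0) * (2 * pi)| <= e * (2 * pi).
  apply: h1 => y _; rewrite -raddfB; apply: le_trans (Im_le_nc _) _.
  by apply: Hd; rewrite nc_cexp.
have {}h2 : `|A| <= M * (2 * pi).
  by apply: h2 => y yi; rewrite subr0; exact: HM.
rewrite -(ler_pM2r pi0) (mulrDl e M).
have -> : `|complex.Im (f z0)| * (2 * pi) = `|complex.Im (f z0) * (2 * pi)|.
  by rewrite normrM (gtr0_norm pi0).
have -> : complex.Im (f z0) * (2 * pi) = A - (A - complex.Im (f z0) * (2 * pi)).
  by rewrite subKr.
apply: le_trans (ler_normB _ _) _; rewrite addrC; exact: lerD.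
Qed.

Lemma circle_bound f z0 (x M : R) :
  (forall w, nc w <= expR x -> cdiff f (z0 + w)) ->
  (forall y, y \in `[0, 2 * pi] -> nc (f (z0 + cexp (x +i* y))) <= M) ->
  nc (f z0) <= M.
Proof.
move=> H HM.
have [f0|f0] := eqVneq (f z0) 0.
  rewrite f0 ComplexField.Normc.normc0.
  apply: le_trans (nc_ge0 _) (HM 0 _).
  by rewrite in_itv/= lexx mulr_ge0// pi_ge0.
have n0 : 0 < nc (f z0).
  rewrite lt_def nc_ge0 andbT; apply: contra f0 => /eqP.
  by move/ComplexField.Normc.eq0_normc => ->.
(* The unimodular [c] rotates [f z0] onto the positive imaginary axis, so that a bound on imaginary
   parts bounds the modulus. *)
pose c := (0 +i* nc (f z0)) / f z0.
have cf : c * f z0 = 0 +i* nc (f z0) by rewrite /c mulfVK.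
have nc1 : nc c = 1.
  rewrite /c ComplexField.Normc.normcM nc_imag gtr0_norm// ComplexField.Normc.normcV.
  by rewrite divff// lt0r_neq0.
have := @circle_bound_Im (fun w => c * f w) z0 x M.
rewrite cf /= gtr0_norm//; apply.
- by move=> w /H fw; apply: cdiffM => //; exact: cdiff_cst.
- move=> y /HM h; apply: le_trans (Im_le_nc _) _.
  by rewrite ComplexField.Normc.normcM nc1 mul1r.
Qed.

Definition zero_near f z := exists2 r : R, 0 < r &
  forall w, nc (w - z) < r -> f w = 0.

(** As [f] vanishes near [a], it may be divided by any power of [w - a]. The circle of radius
    [r > 3 * nc (z0 - a)] about [z0] stays at distance at least [2 * nc (z0 - a)] from [a], so
    [circle_bound] applied to the quotient gives [nc (f z0) <= M / 2 ^+ n] for every [n]. *)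
Lemma zero_near_third f z0 a (r0 : R) :
  (forall w, nc (w - z0) < r0 -> cdiff f w) -> 3 * nc (z0 - a) < r0 ->
  zero_near f a -> f z0 = 0.
Proof.
move=> H ar0 [rho rho0 fa].
have na := nc_ge0 (z0 - a).
pose r := (3 * nc (z0 - a) + r0) / 2.
have r_gt0 : 0 < r by rewrite /r; lra.
have rr0 : r < r0 by rewrite /r; lra.
have ar : 3 * nc (z0 - a) < r by rewrite /r; lra.
have er : expR (ln r) = r by rewrite lnK.
have pi0 : 0 < 2 * pi :> R by rewrite mulr_gt0// pi_gt0.
have Hr w : nc w <= r -> cdiff f (z0 + w).
  by move=> wr; apply: H; rewrite addrC addKr (le_lt_trans wr).
have [M HM] : exists M, forall y, y \in `[0, 2 * pi] ->
    nc (f (z0 + cexp (ln r +i* y))) <= M.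
  have hc : {within `[0, 2 * pi], continuous (fun y => nc (f (z0 + cexp (ln r +i* y))))}.
    apply: continuous_in_subspaceT => y _.
    apply: (@cdiff_path_cont _ (fun w => f (z0 + cexp w)) (fun z => nc z) (fun y => ln r +i* y)).
    - exact: nc_dist.
    - move=> t; have -> : ln r +i* t - (ln r +i* y) = 0 +i* (t - y).
        by apply/eqP; rewrite eq_complex/= subrr !eqxx.
      by rewrite nc_imag.
    - apply: (@cdiff_comp _ f (fun w => z0 + cexp w)).
        by apply: cdiffD; [exact: cdiff_cst|exact: cdiff_cexp].
      by apply: Hr; rewrite nc_cexp/= er.
  have [y0 _ Hy0] := EVT_max (ltW pi0) hc.
  by exists (nc (f (z0 + cexp (ln r +i* y0)))).
have M0 : 0 <= M.
  by apply: le_trans (nc_ge0 _) (HM 0 _); rewrite in_itv/= lexx ltW.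
have [za|za] := eqVneq z0 a.
  by apply: fa; rewrite za subrr ComplexField.Normc.normc0.
have n0 : 0 < nc (z0 - a).
  rewrite lt_def na andbT; apply: contra za => /eqP/ComplexField.Normc.eq0_normc/eqP.
  by rewrite subr_eq0.
have key n : nc (f z0) <= M / 2 ^+ n.
  (* Whatever default value the inverse takes at [a], [F] vanishes near [a] together with [f]. *)
  pose F w := f w * ((w - a) ^+ n)^-1.
  have : nc (F z0) <= M / (2 * nc (z0 - a)) ^+ n.
    apply: (@circle_bound F z0 (ln r)) => [w|y yi].
      rewrite er => /Hr fw.
      have [ew|nw] := eqVneq (z0 + w) a.
        apply: (@cdiff_near _ (fun=> 0) _ _ rho) => //; last exact: cdiff_cst.
        by move=> v; rewrite ew => /fa; rewrite /F => ->; rewrite mul0r.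
      apply: cdiffM => //; apply: cdiffV.
        by rewrite expf_neq0// subr_eq0.
      by apply: cdiffX; apply: cdiffB; [exact: cdiff_id|exact: cdiff_cst].
    rewrite /F ComplexField.Normc.normcM ComplexField.Normc.normcV.
    set v := z0 + _.
    have hv : 2 * nc (z0 - a) <= nc (v - a).
      have : nc (cexp (ln r +i* y)) <= nc (v - a) + nc (z0 - a).
        rewrite -(normcN (z0 - a)); apply: le_trans (le_normcD _ _).
        by rewrite /v le_eqVlt; apply/orP; left; apply/eqP; congr nc; ring.
      by rewrite nc_cexp/= er; lra.
    have nX : nc ((v - a) ^+ n) = nc (v - a) ^+ n.
      elim: (n) => [|k IH]; first by rewrite !expr0 ComplexField.Normc.normc1.
      by rewrite !exprS ComplexField.Normc.normcM IH.
    rewrite nX; apply: ler_pM; rewrite ?nc_ge0 ?invr_ge0 ?exprn_ge0 ?nc_ge0//.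
      exact: HM.
    rewrite lef_pV2 ?posrE ?exprn_gt0//; [|lra|lra].
    by apply: lerXn2r; rewrite ?nnegrE; lra.
  rewrite /F ComplexField.Normc.normcM ComplexField.Normc.normcV.
  have nX : nc ((z0 - a) ^+ n) = nc (z0 - a) ^+ n.
    elim: (n) => [|k IH]; first by rewrite !expr0 ComplexField.Normc.normc1.
    by rewrite !exprS ComplexField.Normc.normcM IH.
  rewrite nX ler_pdivrMr ?exprn_gt0// exprMn => h; apply: le_trans h _.
  rewrite le_eqVlt; apply/orP; left; apply/eqP; field.
  by rewrite !lt0r_neq0 ?exprn_gt0.
apply: ComplexField.Normc.eq0_normc; apply/eqP; rewrite eq_le nc_ge0 andbT.
rewrite leNgt; apply/negP => f0.
have Mf : M / nc (f z0) < 2 ^+ (Num.bound (M / nc (f z0))).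
  apply: lt_trans (archi_boundP _) _; first by rewrite divr_ge0// ltW.
  by rewrite -natrX ltr_nat ltn_expl.
have := key (Num.bound (M / nc (f z0))).
by rewrite leNgt ltr_pdivrMr ?exprn_gt0// mulrC -ltr_pdivrMr// Mf.
Qed.

Lemma unique_continuation_segment f a b :
  (forall t : R, 0 <= t <= 1 -> exists2 r : R, 0 < r &
     forall w, nc (w - (a + t%:C * (b - a))) < r -> cdiff f w) ->
  zero_near f a -> zero_near f b.
Proof.
move=> H f0.
pose ga (t : R) := a + t%:C * (b - a).
have ga0 : ga 0 = a by rewrite /ga mul0r addr0.
have ga1 : ga 1 = b by rewrite /ga mul1r subrKC.
rewrite -ga1; rewrite -ga0 in f0.
apply: (@locally_constant_segment R (fun t => zero_near f (ga t))) f0 => t t01.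
have gat u : nc (ga u - ga t) = `|u - t| * nc (b - a).
  rewrite -nc_real -ComplexField.Normc.normcM; congr nc.
  by rewrite /ga opprD addrACA subrr add0r -mulrBl -raddfB.
have B0 : 0 < 1 + nc (b - a) by rewrite ltr_pwDl ?nc_ge0.
have gat2 u (e : R) : `|u - t| < e / (1 + nc (b - a)) -> nc (ga u - ga t) < e.
  rewrite gat ltr_pdivlMr// => h; apply: le_lt_trans h.
  by apply: ler_wpM2l => //; rewrite lerDr.
have [zt|nzt] := pselect (zero_near f (ga t)).
  have [r r0 Hr] := zt.
  exists (r / 2 / (1 + nc (b - a))); first by rewrite !divr_gt0.
  move=> u u01 ut; split=> // _.
  exists (r / 2); first by rewrite divr_gt0.
  move=> w wu; apply: Hr; have := gat2 _ _ ut.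
  have := le_normcD (w - ga u) (ga u - ga t).
  by rewrite -/(ga t) addrA subrK; lra.
have [r r0 Hr] := H _ t01.
(* A point [w] within [r / 10] of [ga t] is then within [r / 5] of [ga u]. Three times this is less
   than [9 * r / 10], and the ball of that radius about [w] stays within [r] of [ga t]. *)
exists (r / 10 / (1 + nc (b - a))); first by rewrite !divr_gt0.
move=> u u01 ut; split=> // zu; exfalso; apply: nzt.
exists (r / 10); first by rewrite divr_gt0.
move=> w wt; apply: (@zero_near_third f w (ga u) (9 * r / 10)) => //.
  move=> v vw; apply: Hr; rewrite -/(ga t).
  by have := le_normcD (v - w) (w - ga t); rewrite addrA subrK; lra.
have := gat2 _ _ ut; have := le_normcD (w - ga t) (ga t - ga u).
by rewrite addrA subrK -(normcN (ga t - ga u)) opprB; lra.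
Qed.

End UniqueContinuation.

(** * Functions of several complex variables *)

Section ComplexSpace.
Context {R : realType} {d : nat}.
Local Open Scope complex_scope.
Implicit Types (z a b v : 'rV[R[i]]_d).

(** Its strict balls are the coordinatewise balls generating the topology of row vectors, but with a
    radius in [R] instead of [R[i]]. *)
Definition supnorm z : R := \big[Num.max/0]_(k < d) nc (z 0 k).

Lemma supnorm_ge0 z : 0 <= supnorm z.
Proof. by rewrite /supnorm; elim/big_ind: _ => [//|x y x0 y0|k _]; rewrite ?le_max ?x0 ?nc_ge0. Qed.

Lemma nc_le_supnorm z k : nc (z 0 k) <= supnorm z.
Proof. exact: le_bigmax. Qed.

Lemma supnorm_lt z (r : R) : 0 < r -> (supnorm z < r) <-> (forall k, nc (z 0 k) < r).
Proof.
move=> r0; split=> [zr k|H]; first exact: le_lt_trans (nc_le_supnorm z k) zr.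
by apply: bigmax_lt.
Qed.

Lemma supnorm_le z (r : R) : 0 <= r -> (forall k, nc (z 0 k) <= r) -> supnorm z <= r.
Proof. by move=> r0 H; apply: bigmax_le. Qed.

Lemma supnormD a b : supnorm (a + b) <= supnorm a + supnorm b.
Proof.
apply: supnorm_le => [|k]; first by rewrite addr_ge0 ?supnorm_ge0.
by rewrite mxE; apply: le_trans (le_normcD _ _) _; rewrite lerD ?nc_le_supnorm.
Qed.

Lemma supnormN a : supnorm (- a) = supnorm a.
Proof. by apply: eq_bigr => k _; rewrite mxE normcN. Qed.

Lemma supnormZ (t : R[i]) a : supnorm (t *: a) <= nc t * supnorm a.
Proof.
apply: supnorm_le => [|k]; first by rewrite mulr_ge0 ?nc_ge0 ?supnorm_ge0.
by rewrite mxE ComplexField.Normc.normcM ler_wpM2l ?nc_ge0 ?nc_le_supnorm.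
Qed.

Lemma supnorm0 : supnorm 0 = 0.
Proof.
apply/le_anti; rewrite supnorm_ge0 andbT; apply: supnorm_le => // k.
by rewrite mxE ComplexField.Normc.normc0.
Qed.

Lemma nbhs_supnormP a (U : set 'rV[R[i]]_d) :
  nbhs a U <-> exists2 r : R, 0 < r & forall z, supnorm (z - a) < r -> U z.
Proof.
split.
  move=> /nbhs_ballP[e /= /pos_complex[r r0 ->] h]; exists r => // z /supnorm_lt zr.
  apply: h; split=> [|i k]; first by rewrite ltcR.
  rewrite -ball_normE /ball_/= -normrN opprB normr_nc ltcR (ord1 i).
  by have := zr r0 k; rewrite !mxE.
move=> [r r0 h]; apply/nbhs_ballP; exists r%:C; first by rewrite /= ltcR.
move=> z [_ H]; apply: h; apply/supnorm_lt => // k.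
have := H 0 k; rewrite -ball_normE /ball_/= -normrN opprB normr_nc ltcR.
by rewrite !mxE.
Qed.

(** Differentiability along complex lines is all that unique continuation uses, and for finite sums
    and products of characters it reduces to one-variable rules. *)
Definition line_hol (f : 'rV[R[i]]_d -> R[i]) (U : set 'rV[R[i]]_d) : Prop :=
  forall b v t, U (b + t *: v) -> cdiff (fun t => f (b + t *: v)) t.

Lemma holomorphic_line (f : 'rV[R[i]]_d -> R[i]) (U : set 'rV[R[i]]_d) :
  holomorphic_on U f -> line_hol f U.
Proof.
move=> H b v t /H ft; apply/cdiffP.
apply: (@differentiable_comp _ _ _ _ (fun t : R[i]^o => b + t *: v : 'rV[R[i]]_d)
   (f : 'rV[R[i]]_d -> R[i]^o)) => //.
Qed.

Lemma holomorphic_cont (f : 'rV[R[i]]_d -> R[i]) a : differentiable f a ->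
  forall e : R, 0 < e -> exists2 dl : R, 0 < dl &
    forall z, supnorm (z - a) < dl -> nc (f z - f a) <= e.
Proof.
move=> /differentiable_continuous/cvgrPdist_le H e e0.
have /H/nbhs_supnormP[dl dl0 {}H] : 0 < e%:C by rewrite ltcR.
exists dl => // z /H; by rewrite /= -normrN opprB normr_nc lecR.
Qed.

(** A ball is convex, so one-variable unique continuation applies along the segment from [b] to
    [z]. *)
Lemma line_hol_vanish (f : 'rV[R[i]]_d -> R[i]) a b (r rho : R) :
  line_hol f [set z | supnorm (z - a) < r] -> supnorm (b - a) < r -> 0 < rho ->
  (forall z, supnorm (z - b) < rho -> f z = 0) ->
  forall z, supnorm (z - a) < r -> f z = 0.
Proof.
move=> H br rho0 fb z zr.
pose g (t : R[i]) := f (b + t *: (z - b)).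
pose B := 1 + supnorm (z - b).
have B0 : 0 < B by rewrite ltr_pwDl ?supnorm_ge0.
suff [e e0 /(_ 1)] : zero_near g 1.
  by rewrite subrr ComplexField.Normc.normc0 /g scale1r subrKC; exact.
apply: (@unique_continuation_segment _ _ 0).
  move=> t /andP[t0 t1]; rewrite add0r subr0 mulr1.
  have tz : supnorm (b + t%:C *: (z - b) - a) < r.
    have -> : b + t%:C *: (z - b) - a = (1 - t)%:C *: (b - a) + t%:C *: (z - a).
      by apply/rowP => k; rewrite !mxE raddfB/=; ring.
    apply: le_lt_trans (supnormD _ _) _.
    have h1 := supnormZ (1 - t)%:C (b - a); have h2 := supnormZ t%:C (z - a).
    rewrite !nc_real !ger0_norm// ?subr_ge0// in h1 h2.
    apply: le_lt_trans (lerD h1 h2) _.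
    have m0 : Num.max (supnorm (b - a)) (supnorm (z - a)) < r by rewrite gt_max br.
    apply: le_lt_trans m0.
    set m := Num.max _ _.
    have m1 : supnorm (b - a) <= m by rewrite le_max lexx.
    have m2 : supnorm (z - a) <= m by rewrite le_max lexx orbT.
    have -> : m = (1 - t) * m + t * m by ring.
    by apply: lerD; apply: ler_wpM2l => //; rewrite subr_ge0.
  exists ((r - supnorm (b + t%:C *: (z - b) - a)) / B).
    by rewrite divr_gt0// subr_gt0.
  move=> w; rewrite ltr_pdivlMr// => wt; apply: H => /=.
  have -> : b + w *: (z - b) - a =
      (w - t%:C) *: (z - b) + (b + t%:C *: (z - b) - a).
    by apply/rowP => k; rewrite !mxE; ring.
  apply: le_lt_trans (supnormD _ _) _; rewrite -ltrBrDr.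
  apply: le_lt_trans (supnormZ _ _) _; apply: le_lt_trans wt.
  by rewrite ler_wpM2l ?nc_ge0// /B lerDr.
exists (rho / B); first by rewrite divr_gt0.
move=> w; rewrite subr0 ltr_pdivlMr// => wB; apply: fb.
rewrite addrC addKr; apply: le_lt_trans (supnormZ _ _) _; apply: le_lt_trans wB.
by rewrite ler_wpM2l ?nc_ge0// /B lerDr.
Qed.

End ComplexSpace.

(** * Functions vanishing on the real axis *)

Section Reflection.
Context {R : realType}.
Local Open Scope complex_scope.

(* Cutting [g] off to the upper half-plane leaves it complex differentiable,
   because its derivative vanishes along the real axis. *)
Lemma vanish_upper (g : R[i] -> R[i]) (rho : R) :
  (forall t, nc t < rho -> cdiff g t) ->
  (forall x : R, `|x| < rho -> g x%:C = 0) ->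
  forall t, nc t < rho -> 0 < complex.Im t -> g t = 0.
Proof.
move=> H g0 t tr t0.
have rho0 : 0 < rho := le_lt_trans (nc_ge0 _) tr.
pose h (w : R[i]) := if 0 < complex.Im w then g w else 0.
have hd w : nc w < rho -> cdiff h w.
  move=> wr; case: (ltgtP 0 (complex.Im w)) => w0.
  - apply: (@cdiff_near _ g _ _ (complex.Im w)) => //; last exact: H.
    move=> v vw; have := le_lt_trans (Im_le_nc _) vw.
    rewrite raddfB/= ltr_norml => /andP[h1 h2].
    by rewrite /h ifT//; lra.
  - apply: (@cdiff_near _ (fun=> 0) _ _ (- complex.Im w)); rewrite ?oppr_gt0//.
    2: exact: cdiff_cst.
    move=> v vw; have := le_lt_trans (Im_le_nc _) vw.
    rewrite raddfB/= ltr_norml => /andP[h1 h2].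
    by rewrite /h ifF//; apply/negP => ?; lra.
  - have wE : w = (complex.Re w)%:C.
      by case: (w) w0 => x y /= <-.
    have gw : g w = 0.
      by rewrite wE; apply: g0; apply: le_lt_trans wr; exact: Re_le_nc.
    have [D HD] := H w wr.
    have D0 : D = 0.
      apply: ComplexField.Normc.eq0_normc; apply/eqP; rewrite eq_le nc_ge0 andbT.
      apply/ler_addgt0Pl => e e0; rewrite addr0.
      have [dl dl0 {}HD] := HD _ e0.
      pose x := Num.min (dl / 2) ((rho - nc w) / 2).
      have x0 : 0 < x by rewrite lt_min !divr_gt0// subr_gt0.
      have xd : x < dl by rewrite gt_min; apply/orP; left; lra.
      have xr : x < rho - nc w by rewrite gt_min; apply/orP; right; lra.
      have := HD x%:C; rewrite nc_real gtr0_norm// => /(_ xd).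
      have -> : g (w + x%:C) = 0.
        rewrite wE -raddfD/=; apply: g0; apply: le_lt_trans (ler_normD _ _) _.
        by rewrite (gtr0_norm x0); have := Re_le_nc w; lra.
      rewrite gw subrr sub0r normcN ComplexField.Normc.normcM nc_real gtr0_norm//.
      by rewrite ler_pM2r.
    exists 0 => e e0; have [dl dl0 {}HD] := HD _ e0.
    exists dl => // v vd; rewrite {2}/h -w0 ltxx mul0r !subr0 /h.
    case: ifP => _; last by rewrite ComplexField.Normc.normc0 mulr_ge0 ?nc_ge0 ?ltW.
    by have := HD v vd; rewrite gw D0 mul0r !subr0.
suff [e e0 /(_ t)] : zero_near h t.
  by rewrite subrr ComplexField.Normc.normc0 /h t0; exact.
(* Continuation starts in the lower half-plane, where [h] is 0 by definition, and crosses the axis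
   to [t]. *)
pose p : R[i] := 0 +i* (- (rho / 2)).
have pr : nc p < rho by rewrite nc_imag normrN gtr0_norm ?divr_gt0//; lra.
apply: (@unique_continuation_segment _ _ p).
  move=> u /andP[u0 u1].
  have ur : nc (p + u%:C * (t - p)) < rho.
    have -> : p + u%:C * (t - p) = (1 - u)%:C * p + u%:C * t.
      by rewrite raddfB/=; ring.
    apply: le_lt_trans (le_normcD _ _) _.
    rewrite !ComplexField.Normc.normcM !nc_real !ger0_norm ?subr_ge0//.
    have m0 : Num.max (nc p) (nc t) < rho by rewrite gt_max pr.
    apply: le_lt_trans m0; set m := Num.max _ _.
    have m1 : nc p <= m by rewrite le_max lexx.
    have m2 : nc t <= m by rewrite le_max lexx orbT.
    have -> : m = (1 - u) * m + u * m by ring.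
    by apply: lerD; apply: ler_wpM2l => //; rewrite subr_ge0.
  exists (rho - nc (p + u%:C * (t - p))); first by rewrite subr_gt0.
  move=> w; rewrite ltrBrDr => wr; apply: hd; apply: le_lt_trans wr.
  by apply: le_trans (le_normcD _ _); rewrite subrK.
exists (rho / 2); first by rewrite divr_gt0.
move=> w wp; have := le_lt_trans (Im_le_nc _) wp.
rewrite raddfB/= ltr_norml => /andP[h1 h2].
by rewrite /h ifF//; apply/negP => ?; lra.
Qed.

Lemma vanish_real_axis (g : R[i] -> R[i]) (rho : R) :
  (forall t, nc t < rho -> cdiff g t) ->
  (forall x : R, `|x| < rho -> g x%:C = 0) ->
  forall t, nc t < rho -> g t = 0.
Proof.
move=> H g0 t tr; case: (ltgtP 0 (complex.Im t)) => t0.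
- exact: vanish_upper tr t0.
- rewrite -[t]opprK; apply: (@vanish_upper (fun t => g (- t)) rho).
  + move=> w wr; apply: (@cdiff_comp _ g (fun w => - w)); last by apply: H; rewrite normcN.
    have -> : (fun w => - w) = fun w : R[i] => 0 - w by apply/funext => v; rewrite sub0r.
    by apply: cdiffB; [exact: cdiff_cst|exact: cdiff_id].
  + by move=> x xr; rewrite -raddfN; apply: g0; rewrite normrN.
  + by rewrite normcN.
  + by rewrite raddfN/= oppr_gt0.
- by case: t t0 tr => x y /= <- tr; apply: g0; rewrite -nc_real; exact: tr.
Qed.

End Reflection.

(** * Lebesgue measure on tuples *)

Section SigmaFiniteCopy.
Context d (T : measurableType d) (R : realType).
Variables (M : {measure set T -> \bar R}) (sM : sigma_finite setT M).

(** The dummy [let] makes the constant depend on [sM], so that a canonical sigma-finite structure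
    can be attached to it. *)
Definition sigma_finite_copy : set T -> \bar R := let _ := sM in M.
HB.instance Definition _ := Measure.copy sigma_finite_copy M.
HB.instance Definition _ := Measure_isSigmaFinite.Build _ _ _ sigma_finite_copy sM.

End SigmaFiniteCopy.

Section PushforwardSigmaFinite.
Local Open Scope ereal_scope.

(** The preimages by [g] of the exhausting sets exhaust the target, and keep their measure because
    [g] inverts [f] on the left. *)
Lemma pushforward_sigma_finite d1 d2 (T1 : measurableType d1)
    (T2 : measurableType d2) (R : realType)
    (m : {measure set T1 -> \bar R}) (f : T1 -> T2) (g : T2 -> T1) :
  sigma_finite setT m -> measurable_fun setT f -> measurable_fun setT g -> cancel f g ->
  exists mu : {sigma_finite_measure set T2 -> \bar R},
    (mu : set _ -> \bar R) = pushforward m f.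
Proof.
move=> [F FT mF] mf mg fK.
pose M : {measure set T2 -> \bar R} :=
  measure_function_pushforward__canonical__measure_function_Measure m mf.
have sM : sigma_finite setT M.
  exists (fun i => g @^-1` F i).
    by rewrite -preimage_bigcup -FT preimage_setT.
  move=> i; have [mFi Fi] := mF i; split.
    by rewrite -[X in measurable X]setTI; exact: mg.
  rewrite /M/= /pushforward -comp_preimage.
  rewrite (_ : _ \o _ = id); first by rewrite preimage_id.
  by apply/funext => u /=; rewrite fK.
by exists [the {sigma_finite_measure set T2 -> \bar R} of sigma_finite_copy sM].
Qed.

Lemma product_sigma_finite d1 d2 (T1 : measurableType d1)
    (T2 : measurableType d2) (R : realType)
    (m1 : {sigma_finite_measure set T1 -> \bar R})
    (m2 : {sigma_finite_measure set T2 -> \bar R}) :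
  sigma_finite setT (m1 \x m2).
Proof.
have [F FT mF] := sigma_finiteT m1; have [G GT mG] := sigma_finiteT m2.
exists (fun n => if choice.unpickle n is Some ij then F ij.1 `*` G ij.2 else set0).
  apply/seteqP; split=> // -[x y] _.
  have [i _ Fx] : (\bigcup_i F i) x by rewrite -FT.
  have [j _ Gy] : (\bigcup_i G i) y by rewrite -GT.
  by exists (choice.pickle (i, j)) => //; rewrite choice.pickleK.
move=> n; case: choice.unpickle => [[i j]|]; last by split=> //; rewrite measure0.
have [? ?] := mF i; have [? ?] := mG j; split; first exact: measurableX.
by rewrite product_measure1E// lte_mul_pinfty// ge0_fin_numE.
Qed.

Lemma pushforward_product_sigma_finite d1 d2 d3 (T1 : measurableType d1)
    (T2 : measurableType d2) (T3 : measurableType d3) (R : realType)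
    (m1 : {sigma_finite_measure set T1 -> \bar R})
    (m2 : {sigma_finite_measure set T2 -> \bar R})
    (f : T1 * T2 -> T3) (g : T3 -> T1 * T2) :
  measurable_fun setT f -> measurable_fun setT g -> cancel f g ->
  exists mu : {sigma_finite_measure set T3 -> \bar R},
    (mu : set _ -> \bar R) = pushforward (m1 \x m2) f.
Proof.
move=> mf mg fK.
exact: (@pushforward_sigma_finite _ _ _ _ _ (m1 \x m2) f g
  (product_sigma_finite m1 m2) mf mg fK).
Qed.

Lemma ge0_integral_pushforward_product d1 d2 d3 (T1 : measurableType d1)
    (T2 : measurableType d2) (T3 : measurableType d3) (R : realType)
    (m1 : {sigma_finite_measure set T1 -> \bar R})
    (m2 : {sigma_finite_measure set T2 -> \bar R})
    (f : T1 * T2 -> T3) (h : T3 -> \bar R) :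
  measurable_fun setT f -> measurable_fun setT h -> (forall x, 0 <= h x) ->
  \int[pushforward (m1 \x m2) f]_x h x = \int[m1]_x \int[m2]_y h (f (x, y)).
Proof.
move=> mf mh h0; rewrite ge0_integral_pushforward//= preimage_setT.
by rewrite fubini_tonelli1//; exact: measurableT_comp.
Qed.

End PushforwardSigmaFinite.

Section LebesgueTuple.
Context {R : realType}.
Local Open Scope ereal_scope.
Local Notation RT := (measurableTypeR R).
Local Notation lam := (@lebesgue_measure R).

Definition tcons n (u : RT * n.-tuple RT) : n.+1.-tuple RT := [tuple of u.1 :: u.2].

Lemma measurable_tcons n : measurable_fun setT (@tcons n).
Proof. by apply: measurable_cons. Qed.

Definition tuncons n (t : n.+1.-tuple RT) : RT * n.-tuple RT :=
  (thead t, [tuple of behead t]).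

Lemma measurable_tuncons n : measurable_fun setT (@tuncons n).
Proof.
apply: measurable_fun_pair; first exact: measurable_tnth.
exact: measurable_behead.
Qed.

Lemma tconsK n : cancel (@tcons n) (@tuncons n).
Proof.
move=> [x t]; rewrite /tuncons /tcons; congr pair; apply/val_inj => //=.
Qed.

Lemma lebesgue_tuple_measure n :
  exists mu : {sigma_finite_measure set (n.-tuple RT) -> \bar R},
    (mu : set _ -> \bar R) = @lebesgue_tuple R n.
Proof.
elim: n => [|n [m2 m2E]].
  by exists [the {sigma_finite_measure set (0.-tuple RT) -> \bar R} of dirac [tuple]].
pose m1 : {sigma_finite_measure set RT -> \bar R} := lam.
have [mu muE] := pushforward_product_sigma_finite m1 m2
  (@measurable_tcons n) (@measurable_tuncons n) (@tconsK n).
by exists mu; rewrite muE /= m2E.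
Qed.

(* [lebesgue_tuple] is a bare set function; [lebT] is the same function with its
   structure of sigma-finite measure. *)
Definition lebT n : {sigma_finite_measure set (n.-tuple RT) -> \bar R} :=
  projT1 (cid (lebesgue_tuple_measure n)).

Lemma lebTE n : (lebT n : set _ -> \bar R) = @lebesgue_tuple R n.
Proof. by rewrite /lebT; case: cid. Qed.

Lemma lebT0 (F : 0.-tuple RT -> \bar R) :
  \int[lebT 0]_t F t = F [tuple].
Proof.
rewrite lebTE /= integral_dirac ?diracT ?mul1e//.
move=> _ Y mY; rewrite setTI; case: (pselect (Y (F [tuple]))) => h.
  rewrite (_ : _ @^-1` _ = setT)//; apply/seteqP; split=> // t _ /=.
  by rewrite (tuple0 t).
rewrite (_ : _ @^-1` _ = set0)//; apply/seteqP; split=> // t /=.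
by rewrite (tuple0 t).
Qed.

Lemma lebTS n (F : n.+1.-tuple RT -> \bar R) : measurable_fun setT F ->
  (forall t, 0 <= F t) ->
  \int[lebT n.+1]_t F t = \int[lam]_x \int[lebT n]_t F (tcons (x, t)).
Proof.
move=> mF F0.
have -> : (lebT n.+1 : set _ -> \bar R) = pushforward (lam \x (lebT n)) (@tcons n).
  by rewrite lebTE /= lebTE.
exact: (@ge0_integral_pushforward_product _ _ _ _ _ _ R lam (lebT n) _ _ (@measurable_tcons n) mF F0).
Qed.

End LebesgueTuple.

(** * Affine substitutions *)

Section Affine.
Context {R : realType}.
Local Open Scope ereal_scope.
Local Notation RT := (measurableTypeR R).
Local Notation lam := (@lebesgue_measure R).

Lemma measurable_affine (a b : R) :
  measurable_fun setT (fun x : RT => (a * x + b)%R : RT).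
Proof. by apply: measurable_funD => //; exact: measurable_funM. Qed.

Lemma lam_affine_itv (a b x y : R) : (a != 0)%R ->
  lam ((fun t : R => (a * t + b)%R) @^-1` `]x, y]) = (`|a|^-1)%:E * lam `]x, y].
Proof.
move=> a0.
have eP : (a > 0)%R -> (fun t : R => (a * t + b)%R) @^-1` `]x, y] =
    `]((x - b) / a)%R, ((y - b) / a)%R]%classic.
  move=> ap; apply/seteqP; split=> t /=;
    by rewrite !in_itv/= ltr_pdivrMr// ler_pdivlMr// ltrBlDr lerBrDr mulrC.
have eN : (a < 0)%R -> (fun t : R => (a * t + b)%R) @^-1` `]x, y] =
    `[((y - b) / a)%R, ((x - b) / a)%R[%classic.
  move=> ap; apply/seteqP; split=> t /=;
    by rewrite !in_itv/= ltr_ndivlMr// ler_ndivrMr// ltrBlDr lerBrDr mulrC andbC.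
have [a_lt0|a_gt0|a_eq0] := ltgtP a 0%R; last by rewrite a_eq0 eqxx in a0.
- rewrite eN// !lebesgue_measure_itv/= !lte_fin ltr_nM2r ?invr_lt0// ltrD2r.
  case: ifP => _; last by rewrite mule0.
  rewrite ltr0_norm// -!EFinB -EFinM; congr EFin; field.
  by rewrite ?oppr_eq0 a0.
- rewrite eP// !lebesgue_measure_itv/= !lte_fin ltr_pM2r ?invr_gt0// ltrD2r.
  case: ifP => _; last by rewrite mule0.
  rewrite gtr0_norm// -!EFinB -EFinM; congr EFin; field.
  exact: a0.
Qed.

(** The image of Lebesgue measure under the affine map, multiplied by the absolute value of [a],
    agrees with Lebesgue measure on half-open intervals and hence everywhere. *)
Lemma lam_affine (a b : R) (F : RT -> \bar R) : (a != 0)%R ->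
  measurable_fun setT F -> (forall x, 0 <= F x) ->
  \int[lam]_x F (a * x + b)%R = (`|a|^-1)%:E * \int[lam]_x F x.
Proof.
move=> a0 mF F0; have ma := measurable_affine a b.
pose P : {measure set RT -> \bar R} :=
  measure_function_pushforward__canonical__measure_function_Measure lam ma.
have an : (0 < `|a|)%R by rewrite normr_gt0.
pose k : {nonneg R} := NngNum (ltW an).
have E : \int[lam]_x F x = \int[mscale k P]_x F x.
  apply: eq_measure_integral => A mA _.
  apply: (lebesgue_measure_unique (mu := mscale k P)) => // X /ocitvP[->|[[x y] _ ->]] /=.
    by rewrite !measure0.
  rewrite /mscale/= /pushforward lam_affine_itv// muleA -EFinM divff ?mul1e//.
  exact: lt0r_neq0.
rewrite E ge0_integral_mscale//= muleA -EFinM mulVf ?lt0r_neq0// mul1e.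
by rewrite ge0_integral_pushforward//= preimage_setT.
Qed.

Definition tuple_affine n (a : R) (v t : n.-tuple RT) : n.-tuple RT :=
  [tuple (a * tnth t i + tnth v i)%R | i < n].

Lemma measurable_tuple_affine n (a : R) (v : n.-tuple RT) : measurable_fun setT (tuple_affine a v).
Proof.
apply/measurable_fun_tnthP => i.
rewrite (_ : _ \o _ = (fun x : RT => (a * x + tnth v i)%R : RT) \o (fun t : n.-tuple RT => tnth t i)).
  apply: measurableT_comp; first exact: measurable_affine.
  exact: measurable_tnth.
by apply/funext => t /=; rewrite tnth_mktuple.
Qed.

Lemma measurable_tcons2 n (x : RT) : measurable_fun setT (fun t : n.-tuple RT => tcons (x, t)).
Proof. by apply: (measurableT_comp (@measurable_tcons _ n)); exact: measurable_fun_pair. Qed.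

Lemma measurable_lebT_section n (F : n.+1.-tuple RT -> \bar R) :
  measurable_fun setT F -> (forall t, 0 <= F t) ->
  measurable_fun setT (fun x : RT => \int[lebT n]_t F (tcons (x, t))).
Proof.
move=> mF F0.
apply: (@measurable_fun_fubini_tonelli_F _ _ _ _ _ (lebT n) (fun u => F (tcons u))) => //.
by apply: measurableT_comp => //; exact: measurable_tcons.
Qed.

Lemma tuple_affine_cons n (a : R) (v : n.+1.-tuple RT) x (t : n.-tuple RT) :
  tuple_affine a v (tcons (x, t)) =
  tcons ((a * x + thead v)%R, tuple_affine a [tuple of behead v] t).
Proof.
apply: eq_from_tnth => i; rewrite tnth_mktuple.
case: (unliftP ord0 i) => [j ->|->]; rewrite /tcons.
  rewrite !tnthS tnth_mktuple tnth_behead; congr (_ + tnth v _)%R; apply/val_inj.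
  by rewrite /= inordK /bump ?add1n ?ltnS.
by rewrite !tnth0.
Qed.

(** Both signs of [a] matter: positive ratios rescale the integral of the solid angle, and [a = -1]
    gives its central symmetry. The induction on [n] is Tonelli's theorem. *)
Lemma lebT_affine n (a : R) (v : n.-tuple RT) (F : n.-tuple RT -> \bar R) :
  (a != 0)%R -> measurable_fun setT F -> (forall t, 0 <= F t) ->
  \int[lebT n]_t F (tuple_affine a v t) = (`|a| ^- n)%:E * \int[lebT n]_t F t.
Proof.
move=> a0; elim: n v F => [|n IH] v F mF F0.
  by rewrite !lebT0 expr0 invr1 mul1e; congr F; rewrite tuple0.
rewrite lebTS//; last by apply: measurableT_comp => //; exact: measurable_tuple_affine.
rewrite (lebTS mF F0).
under eq_integral => x _.
  under eq_integral => t _ do rewrite tuple_affine_cons.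
  rewrite (IH [tuple of behead v] (fun t => F (tcons ((a * x + thead v)%R, t))))//; last first.
    exact: (measurableT_comp mF (measurable_tcons2 _)).
  over.
have H0 x : 0 <= \int[lebT n]_t F (tcons (x, t)) by exact: integral_ge0.
have mH := measurable_lebT_section mF F0.
have mHa : measurable_fun setT
    ((fun x : RT => \int[lebT n]_t F (tcons (x, t))) \o
     (fun x : RT => (a * x + thead v)%R : RT)).
  by apply: measurableT_comp => //; exact: measurable_affine.
rewrite ge0_integralZl; [|exact: measurableT|exact: mHa|by move=> x _; exact: H0|by rewrite lee_fin invr_ge0 exprn_ge0].
rewrite (@lam_affine a (thead v) (fun x => \int[lebT n]_t F (tcons (x, t))))//.
by rewrite muleA -EFinM -exprVn -exprSr exprVn.
Qed.

End Affine.

(** * The weight at scale 1 and its total mass *)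

Section Weight.
Context {R : realType}.
Local Open Scope ereal_scope.
Local Notation RT := (measurableTypeR R).
Local Notation lam := (@lebesgue_measure R).
Variables (p c : R).
Hypotheses (p1 : (1 <= p)%R) (c0 : (0 < c)%R).

Definition weight n (t : n.-tuple RT) : R :=
  expR (- c * \sum_(k < n) `|tnth t k| `^ p).

Lemma weight_gt0 n (t : n.-tuple RT) : (0 < weight t)%R.
Proof. exact: expR_gt0. Qed.

Lemma weight_ge0 n (t : n.-tuple RT) : (0 <= weight t)%R.
Proof. exact: expR_ge0. Qed.

Lemma measurable_powabs : measurable_fun setT (fun x : RT => (`|x| `^ p)%R : RT).
Proof. exact: (measurableT_comp (measurable_powR p) (@normr_measurable R setT)). Qed.

Lemma measurable_weight1 :
  measurable_fun setT (fun x : RT => (expR (- c * `|x| `^ p))%:E).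
Proof.
apply/measurable_EFinP/measurableT_comp => //; apply: measurable_funM => //.
exact: measurable_powabs.
Qed.

Lemma measurable_weight n : measurable_fun setT (@weight n).
Proof.
apply: measurableT_comp => //; apply: measurable_funM => //.
apply: measurable_sum => k.
exact: (measurableT_comp measurable_powabs (measurable_tnth k)).
Qed.

Lemma measurable_Eweight n :
  measurable_fun setT (fun t : n.-tuple RT => (weight t)%:E).
Proof. by apply/measurable_EFinP; exact: measurable_weight. Qed.

Lemma weight_cons n x (t : n.-tuple RT) :
  weight (tcons (x, t)) = (expR (- c * `|x| `^ p) * weight t)%R.
Proof.
rewrite /weight big_ord_recl mulrDr expRD; congr (_ * expR (_ * _))%R.
by apply: eq_bigr => k _; rewrite /tcons tnthS.
Qed.

(** Since [p >= 1], the [p]-th power of the modulus of [x] is at least that modulus minus 1. So the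
    integrand is dominated by a multiple of the exponential density plus its mirror image, both of
    integral 1. *)
Lemma integral_weight1_lty :
  \int[lam]_x (expR (- c * `|x| `^ p))%:E < +oo.
Proof.
pose e (x : RT) : R := exponential_pdf c x.
have me : measurable_fun setT e by exact: measurable_exponential_pdf.
have e0 x : (0 <= e x)%R by apply: exponential_pdf_ge0; exact: ltW.
have mEe : measurable_fun setT (EFin \o e) by exact/measurable_EFinP.
have men : measurable_fun setT (EFin \o (fun x : RT => e (-1 * x + 0))%R).
  exact: (measurableT_comp mEe (measurable_affine (-1) 0)).
have I1 : \int[lam]_x (e x)%:E = 1 by exact: integral_exponential_pdf.
have I2 : \int[lam]_x (e (-1 * x + 0)%R)%:E = 1.
  by rewrite (@lam_affine _ (-1) 0 (EFin \o e))// I1 normrN1 invr1 mule1.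
pose k : R := (expR c / c)%R.
have k0 : (0 <= k)%R by rewrite divr_ge0 ?expR_ge0// ltW.
apply: (@le_lt_trans _ _ (\int[lam]_x (k%:E * ((e x)%:E + (e (-1 * x + 0)%R)%:E)))).
  apply: ge0_le_integral => //.
  - exact: measurable_weight1.
  - by apply: emeasurable_funM => //; exact: emeasurable_funD.
  move=> x _; rewrite -EFinD -EFinM lee_fin.
  have h1 : (expR (- c * `|x| `^ p) <= expR c * expR (- c * `|x|))%R.
    rewrite -expRD ler_expR.
    have : (`|x| - 1 <= `|x| `^ p)%R.
      have [x1|x1] := leP 1%R `|x|%R; last by apply: le_trans (powR_ge0 _ _); lra.
      by rewrite -[X in (X - _)%R]powRr1//; have := ler_powR x1 p1; lra.
    by rewrite -(ler_pM2l c0); lra.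
  apply: le_trans h1 _; rewrite /k -mulrA ler_pM2l ?expR_gt0// ler_pdivlMl//.
  have [x0|x0] := leP 0%R x.
    rewrite ger0_norm//; apply: (@le_trans _ _ (e x)); last by rewrite lerDl.
    by rewrite /e exponential_pdfE.
  rewrite ltr0_norm//; apply: (@le_trans _ _ (e (-1 * x + 0)%R)); last by rewrite lerDr.
  by rewrite /e addr0 mulN1r exponential_pdfE// oppr_ge0 ltW.
rewrite ge0_integralZl//; last 2 first.
- exact: emeasurable_funD.
- by move=> x _; rewrite -EFinD lee_fin addr_ge0.
rewrite ge0_integralD//; last 2 first.
- by move=> x _; rewrite lee_fin.
- by move=> x _; rewrite lee_fin.
by rewrite I1 I2 -EFinD -EFinM ltry.
Qed.

Let weight1_ge0 : 0 <= \int[lam]_x (expR (- c * `|x| `^ p))%:E.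
Proof. by apply: integral_ge0 => x _; rewrite lee_fin expR_ge0. Qed.

Lemma integral_weight1_gt0 :
  0 < \int[lam]_x (expR (- c * `|x| `^ p))%:E.
Proof.
apply: (@lt_le_trans _ _ (\int[lam]_(x in `[0%R, 1%R]) (expR (- c))%:E)).
  rewrite integral_cst//= lebesgue_measure_itv/= lte_fin ltr01 -EFinB subr0 mule1.
  by rewrite lte_fin expR_gt0.
apply: (@le_trans _ _ (\int[lam]_(x in `[0%R, 1%R]) (expR (- c * `|x| `^ p))%:E)).
  apply: ge0_le_integral => //.
  - exact: (measurable_funTS measurable_weight1).
  - move=> x /=; rewrite in_itv/= => /andP[x0 x1]; rewrite lee_fin ler_expR.
    rewrite ger0_norm// mulNr lerN2; apply: ler_piMr; first exact: ltW.
    apply: (@le_trans _ _ (1 `^ p)%R); last by rewrite powR1.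
    by apply: ge0_ler_powR; rewrite ?nnegrE//; exact: le_trans ler01 p1.
by apply: ge0_subset_integral => //; exact: measurable_weight1.
Qed.

Lemma integral_weightS n : \int[lebT n.+1]_t (@weight n.+1 t)%:E =
  (\int[lam]_x (expR (- c * `|x| `^ p))%:E) * \int[lebT n]_t (@weight n t)%:E.
Proof.
rewrite lebTS; [|exact: measurable_Eweight|by move=> t; rewrite lee_fin weight_ge0].
under eq_integral => x _.
  under eq_integral => t _ do rewrite weight_cons EFinM.
  rewrite ge0_integralZl//; last 2 first.
  - exact: measurable_Eweight.
  - by move=> t _; rewrite lee_fin weight_ge0.
  over.
have m1 := measurable_weight1.
by rewrite ge0_integralZr//; apply: integral_ge0 => t _; rewrite lee_fin weight_ge0.
Qed.

Lemma integral_weight_lty n : \int[lebT n]_t (@weight n t)%:E < +oo.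
Proof.
elim: n => [|n IH]; first by rewrite lebT0 ltry.
rewrite integral_weightS; apply: lte_mul_pinfty => //.
by rewrite ge0_fin_numE// integral_weight1_lty.
Qed.

Lemma integral_weight_gt0 n : 0 < \int[lebT n]_t (@weight n t)%:E.
Proof.
elim: n => [|n IH]; first by rewrite lebT0 lte_fin weight_gt0.
by rewrite integral_weightS mule_gt0// integral_weight1_gt0.
Qed.

End Weight.

Section NullHyperplanes.
Context {R : realType}.
Local Open Scope ereal_scope.
Local Notation RT := (measurableTypeR R).
Local Notation lam := (@lebesgue_measure R).

Definition lform n (a : 'I_n -> R) (t : n.-tuple RT) : R :=
  (\sum_(k < n) tnth t k * a k)%R.

Lemma measurable_lform n (a : 'I_n -> R) : measurable_fun setT (lform a).
Proof.
apply: measurable_sum => k; apply: measurable_funM => //.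
exact: measurable_tnth.
Qed.

Lemma measurable_hyperplane n (a : 'I_n -> R) (b : R) :
  measurable [set t : n.-tuple RT | lform a t = b].
Proof.
rewrite -[X in measurable X]setTI.
exact: (measurable_lform a measurableT (measurable_set1 b)).
Qed.

Lemma lform_cons n (a : 'I_n.+1 -> R) x (t : n.-tuple RT) :
  lform a (tcons (x, t)) = (x * a ord0 + lform (fun k => a (lift ord0 k)) t)%R.
Proof.
by rewrite /lform big_ord_recl; congr (_ + _)%R; apply: eq_bigr => k _; rewrite /tcons tnthS.
Qed.

(** Integrate the first coordinate last. If another coefficient is nonzero, every section is a null
    hyperplane by induction; otherwise all sections but the one over [b / a ord0] are empty. *)
Lemma null_hyperplane n (a : 'I_n -> R) (b : R) : (exists k, a k != 0%R) ->
  lebT n [set t | lform a t = b] = 0.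
Proof.
move=> [k ak].
rewrite -(setIT [set t | _ ]) -integral_indic//; last exact: measurable_hyperplane.
elim: n a b k ak => [|n IH] a b k ak; first by case: k ak.
rewrite lebTS//; last first.
  by apply/measurable_EFinP; apply: measurable_indic; exact: measurable_hyperplane.
pose a' j := a (lift ord0 j).
have E x t : \1_[set t | lform a t = b] (tcons (x, t)) =
    \1_[set t : n.-tuple RT | lform a' t = (b - x * a ord0)%R] t :> R.
  have h : (tcons (x, t) \in [set t | lform a t = b]) =
      (t \in [set t : n.-tuple RT | lform a' t = (b - x * a ord0)%R]).
    apply/idP/idP; rewrite !in_setE/= lform_cons.
      by move=> <-; rewrite addrAC subrr add0r.
    by rewrite /a' => ->; rewrite subrKC.
  by rewrite !indicE h.
under eq_integral => x _ do under eq_integral => t _ do rewrite E.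
have [[j a'j]|na'] := pselect (exists j, a' j != 0%R).
  under eq_integral => x _ do rewrite (IH a' _ j a'j).
  by rewrite integral0.
have a00 : a ord0 != 0%R.
  case: (unliftP ord0 k) ak => [j ->|-> //] aj.
  by case: na'; exists j.
have a'0 t : lform a' t = 0%R.
  rewrite /lform big1// => j _; apply/eqP; rewrite mulf_eq0; apply/orP; right.
  by apply/negPn/negP => h; apply: na'; exists j.
have mH : measurable_fun setT (fun x : RT => \int[lebT n]_t
    (\1_[set t : n.-tuple RT | lform a' t = (b - x * a ord0)%R] t)%:E).
  have := @measurable_lebT_section R n (EFin \o \1_[set t | lform a t = b]).
  under [X in _ -> _ -> measurable_fun _ X]eq_fun => x do under eq_integral => t _ do rewrite /= E.
  apply; last by move=> t; rewrite lee_fin.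
  by apply/measurable_EFinP; apply: measurable_indic; exact: measurable_hyperplane.
rewrite -(@integral0 _ _ R lam setT); apply: ae_eq_integral => //.
exists [set (b / a ord0)%R]; split => //; first exact: lebesgue_measure_set1.
move=> x /= h; apply: contrapT => xb; apply: h => _.
rewrite (_ : [set t | _] = set0); last first.
  apply/seteqP; split=> // t /=; rewrite a'0 => h; apply: xb.
  rewrite /=; have -> : b = (x * a ord0)%R by apply/eqP; rewrite -subr_eq0 -h.
  by rewrite mulfK.
by under eq_integral do rewrite indic0; rewrite integral0.
Qed.

End NullHyperplanes.

(** * Solid angles as Gaussian integrals *)

Section WeightedMean.
Context {R : realType}.
Local Notation RT := (measurableTypeR R).
Variables (p c : R).
Hypotheses (p1 : 1 <= p) (c0 : 0 < c).
Local Notation weight := (weight p c).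

Definition tuple_opp n (t : n.-tuple RT) : n.-tuple RT :=
  tuple_affine (-1) [tuple (0 : R) | i < n] t.

Definition bmfun n (h : n.-tuple RT -> R) : Prop :=
  measurable_fun setT h /\ exists M, forall t, `|h t| <= M.

Lemma bmfun_cst n (k : R) : bmfun (fun _ : n.-tuple RT => k).
Proof. by split; [exact: measurable_cst|exists `|k|]. Qed.

Lemma bmfunD n (h1 h2 : n.-tuple RT -> R) : bmfun h1 -> bmfun h2 -> bmfun (fun t => h1 t + h2 t).
Proof.
move=> [m1 [M1 b1]] [m2 [M2 b2]]; split; first exact: measurable_funD.
by exists (M1 + M2) => t; apply: le_trans (ler_normD _ _) _; exact: lerD.
Qed.

Lemma bmfunM n (h1 h2 : n.-tuple RT -> R) : bmfun h1 -> bmfun h2 -> bmfun (fun t => h1 t * h2 t).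
Proof.
move=> [m1 [M1 b1]] [m2 [M2 b2]]; split; first exact: measurable_funM.
by exists (M1 * M2) => t; rewrite normrM; exact: ler_pM.
Qed.

Lemma bmfun_prod n (I : Type) (r : seq I) (P : pred I) (h : I -> n.-tuple RT -> R) :
  (forall i, bmfun (h i)) -> bmfun (fun t => \prod_(i <- r | P i) h i t).
Proof.
move=> H; elim: r => [|i r IH].
  rewrite (_ : (fun _ => _) = fun=> 1); first exact: bmfun_cst.
  by apply/funext => t; rewrite big_nil.
have [Pi|nPi] := boolP (P i).
  rewrite (_ : (fun _ => _) = fun t => h i t * \prod_(i <- r | P i) h i t).
    exact: bmfunM.
  by apply/funext => t; rewrite big_cons Pi.
rewrite (_ : (fun _ => _) = fun t => \prod_(i <- r | P i) h i t) //.
by apply/funext => t; rewrite big_cons (negbTE nPi).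
Qed.

Lemma bmfun_tuple_affine n (h : n.-tuple RT -> R) a v : bmfun h -> bmfun (fun t => h (tuple_affine a v t)).
Proof.
move=> [m [M b]]; split; last by exists M.
exact: (measurableT_comp m (measurable_tuple_affine a v)).
Qed.

Lemma integrable_weight n : (lebT n).-integrable setT (EFin \o @weight n).
Proof.
apply/integrableP; split; first exact: measurable_Eweight.
rewrite (_ : (\int[_]_(_ in _) _)%E = (\int[lebT n]_t (@weight n t)%:E)%E).
  exact: integral_weight_lty.
by apply: eq_integral => t _ /=; rewrite ger0_norm// weight_ge0.
Qed.

Lemma bmfun_integrable n (h : n.-tuple RT -> R) : bmfun h ->
  (lebT n).-integrable setT (EFin \o (fun t => h t * weight t)).
Proof.
move=> [m [M b]].
apply: (@le_integrable _ _ _ _ _ _ _ (fun t => (M%:E * (EFin \o @weight n) t)%E)) => //.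
- apply/measurable_EFinP; apply: measurable_funM => //; exact: measurable_weight.
- move=> t _ /=; rewrite lee_fin normrM [leRHS]normrM.
  apply: ler_pM => //; apply: le_trans (b t) _; exact: ler_norm.
- by apply: integrableZl => //; exact: integrable_weight.
Qed.

Definition gint n (h : n.-tuple RT -> R) : R := \int[lebT n]_t (h t * weight t).

Lemma gintD n (h1 h2 : n.-tuple RT -> R) : bmfun h1 -> bmfun h2 ->
  gint (fun t => h1 t + h2 t) = gint h1 + gint h2.
Proof.
move=> b1 b2; rewrite /gint -RintegralD//; try exact: bmfun_integrable.
by apply: eq_Rintegral => t _; rewrite mulrDl.
Qed.

Lemma gintZ n (h : n.-tuple RT -> R) k : bmfun h -> gint (fun t => k * h t) = k * gint h.
Proof.
move=> b; rewrite /gint -RintegralZl//; last exact: bmfun_integrable.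
by apply: eq_Rintegral => t _; rewrite mulrA.
Qed.

Lemma gint_sum n (I : Type) (r : seq I) (k : I -> R) (h : I -> n.-tuple RT -> R) :
  (forall i, bmfun (h i)) ->
  gint (fun t => \sum_(i <- r) k i * h i t) = \sum_(i <- r) k i * gint (h i).
Proof.
move=> H.
suff [] : bmfun (fun t => \sum_(i <- r) k i * h i t) /\
  gint (fun t => \sum_(i <- r) k i * h i t) = \sum_(i <- r) k i * gint (h i) by [].
elim: r => [|i r [bs IH]].
  rewrite big_nil (_ : (fun _ => _) = fun=> 0); last by apply/funext => t; rewrite big_nil.
  split; first exact: bmfun_cst.
  rewrite /gint; under eq_Rintegral do rewrite mul0r.
  by rewrite Rintegral_cst// mul0r.
have bi : bmfun (fun t => k i * h i t) by apply: bmfunM => //; exact: bmfun_cst.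
rewrite big_cons (_ : (fun _ => _) =
    fun t => k i * h i t + \sum_(i <- r) k i * h i t); last first.
  by apply/funext => t; rewrite big_cons.
by split; [exact: bmfunD|rewrite gintD// gintZ// IH].
Qed.

Lemma gint_ge0 n (h : n.-tuple RT -> R) : (forall t, 0 <= h t) -> 0 <= gint h.
Proof. by move=> h0; apply: Rintegral_ge0 => t _; rewrite mulr_ge0// weight_ge0. Qed.

Lemma gint_le n (h1 h2 : n.-tuple RT -> R) : bmfun h1 -> bmfun h2 ->
  (forall t, h1 t <= h2 t) -> gint h1 <= gint h2.
Proof.
move=> b1 b2 h; apply: le_Rintegral => //; try exact: bmfun_integrable.
by move=> t _; rewrite ler_wpM2r// weight_ge0.
Qed.

Lemma gint_nonneg n (h : n.-tuple RT -> R) : gint h = fine (\int[lebT n]_t (h t * weight t)%:E).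
Proof. by []. Qed.

Lemma gint_ae n m (a : 'I_m -> 'I_n -> R) (h1 h2 : n.-tuple RT -> R) :
  bmfun h1 -> bmfun h2 -> (forall j, exists k, a j k != 0) ->
  (forall t, (forall j, lform (a j) t != 0) -> h1 t = h2 t) -> gint h1 = gint h2.
Proof.
move=> b1 b2 a0 H; rewrite !gint_nonneg; congr fine; apply: ae_eq_integral => //.
- by have /integrableP[] := bmfun_integrable b1.
- by have /integrableP[] := bmfun_integrable b2.
have hU : (lebT n).-negligible (\big[setU/set0]_(j < m) [set t | lform (a j) t = 0]).
  apply: (big_ind (fun A => (lebT n).-negligible A)).
  - exact: negligible_set0.
  - by move=> A B; exact: negligibleU.
  - move=> j _; exists [set t | lform (a j) t = 0]; split=> //.
    + exact: measurable_hyperplane.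
    + exact: null_hyperplane.
apply: negligibleS hU => t /= ht; rewrite -bigcup_seq.
apply: contrapT => h; apply: ht => _ /=; rewrite H// => j; apply/eqP => jt; apply: h.
by exists j => //=; rewrite mem_index_enum.
Qed.

Lemma weight_opp n (t : n.-tuple RT) :
  weight (tuple_opp t) = weight t.
Proof.
rewrite /weight; congr (expR (_ * _)); apply: eq_bigr => k _.
by rewrite !tnth_mktuple addr0 mulN1r normrN.
Qed.

Lemma gint_opp n (h : n.-tuple RT -> R) : bmfun h ->
  gint (fun t => h (tuple_opp t)) = gint h.
Proof.
move=> bh; have [_ [M b]] := bh.
have key (g : n.-tuple RT -> R) : bmfun g -> (forall t, 0 <= g t) ->
    gint (fun t => g (tuple_opp t)) = gint g.
  move=> bg g0; rewrite !gint_nonneg; congr fine.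
  transitivity (\int[lebT n]_t ((fun t => (g t * weight t)%:E) (tuple_opp t)))%E.
    by apply: eq_integral => t _ /=; rewrite weight_opp.
  have n1 : -1 != 0 :> R by rewrite oppr_eq0 oner_eq0.
  have mgw : measurable_fun setT (fun t => (g t * weight t)%:E).
    by have /integrableP[] := bmfun_integrable bg.
  have gw0 t : (0 <= (g t * weight t)%:E)%E.
    by rewrite lee_fin mulr_ge0// weight_ge0.
  have := lebT_affine [tuple 0 | _ < n] n1 mgw gw0.
  by rewrite normrN1 expr1n invr1 mul1e.
(* Adding the bound [M] makes the integrand nonnegative, as the change of variables requires; the
   integral of the constant is then cancelled. *)
have hM : bmfun (fun t => h t + M) by apply: bmfunD => //; exact: bmfun_cst.
have := key _ hM; rewrite !gintD//; try exact: bmfun_cst; last exact: bmfun_tuple_affine.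
move/(_ _)/addIr; apply => t; have := b t; rewrite ler_norml => /andP[b1 _].
by rewrite -lerBlDr sub0r.
Qed.

Lemma gint1_gt0 n : 0 < @gint n (fun=> 1).
Proof.
rewrite lt_def gint_ge0// andbT; apply/eqP => E0.
have I0 : (\int[lebT n]_t (@weight n t)%:E = 0)%E.
  have := E0; rewrite gint_nonneg.
  under eq_integral do rewrite mul1r.
  move/eqP; rewrite fine_eq0; first by move/eqP.
  rewrite ge0_fin_numE; first exact: integral_weight_lty.
  by apply: integral_ge0 => t _; rewrite lee_fin weight_ge0.
by have := integral_weight_gt0 p1 c0 n; rewrite I0 ltxx.
Qed.

End WeightedMean.

Section GammaPos.
Context {R : realType}.
Local Notation RT := (measurableTypeR R).
Local Notation lam := (@lebesgue_measure R).

Lemma Gamma_gt0 (q : R) : 0 <= q <= 1 -> 0 < Gamma (q + 1).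
Proof.
move=> /andP[q0 q1]; rewrite /Gamma addrK /Rintegral.
set f := fun t : RT => t `^ q * expR (- t).
have f0 t : 0 <= f t by rewrite mulr_ge0 ?powR_ge0 ?expR_ge0.
have mf : measurable_fun setT f.
  apply: measurable_funM; first exact: measurable_powR.
  by apply: measurableT_comp => //; exact: measurableT_comp.
have mEf : measurable_fun setT (EFin \o f) by exact/measurable_EFinP.
(* [fine] sends [+oo] to 0, so finiteness is part of the claim: the integrand is at most 4 times the
   exponential density of rate 1/2. *)
apply: fine_gt0; apply/andP; split.
  apply: (@lt_le_trans _ _ (\int[lam]_(t in `[1%R, 2%R]) (expR (- 2))%:E)%E).
    rewrite integral_cst//= lebesgue_measure_itv/= lte_fin ltr1n -EFinB -EFinM lte_fin.
    by rewrite mulr_gt0 ?expR_gt0//; lra.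
  apply: (@le_trans _ _ (\int[lam]_(t in `[1%R, 2%R]) (f t)%:E)%E).
    apply: ge0_le_integral => //.
    - exact: (measurable_funTS mEf).
    - move=> t /=; rewrite in_itv/= => /andP[t1 t2]; rewrite lee_fin /f.
      apply: (@le_trans _ _ (1 * expR (- t))); first by rewrite mul1r ler_expR lerN2.
      rewrite ler_wpM2r ?expR_ge0//.
      have -> : 1 = t `^ 0 by rewrite powRr0.
      exact: ler_powR.
  apply: ge0_subset_integral => //; first exact: (measurable_funTS mEf).
    by move=> t _; rewrite lee_fin.
  by move=> t /=; rewrite !in_itv/= => /andP[t1 _]; rewrite (lt_le_trans ltr01).
have h2 : 0 < 2^-1 :> R by rewrite invr_gt0.
pose e (x : RT) : R := exponential_pdf 2^-1 x.
have me : measurable_fun setT (EFin \o e).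
  by apply/measurable_EFinP; exact: measurable_exponential_pdf.
have e0 x : 0 <= e x by apply: exponential_pdf_ge0; exact: ltW.
apply: (@le_lt_trans _ _ (\int[lam]_t (4%:E * (e t)%:E))%E).
  apply: (@le_trans _ _ (\int[lam]_(t in `]0%R, +oo[) (4%:E * (e t)%:E))%E).
    apply: ge0_le_integral => //.
    - by move=> t _; rewrite lee_fin f0.
    - exact: (measurable_funTS mEf).
    - by apply: measurable_funTS; exact: emeasurable_funM.
    - move=> t /=; rewrite in_itv/= ?andbT => t0; rewrite -EFinM lee_fin /f /e.
      rewrite (exponential_pdfE _ (ltW t0)).
      have h1 : t `^ q <= 1 + t.
        have [t1|t1] := leP 1 t.
          by apply: le_trans (ler_powR t1 q1) _; rewrite (powRr1 (ltW t0)) lerDr.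
        apply: (@le_trans _ _ (1 `^ q)).
          by apply: ge0_ler_powR; rewrite ?nnegrE// ltW.
        by rewrite powR1 lerDl ltW.
      have h3 : 1 + t <= 2 * expR (t / 2).
        apply: (@le_trans _ _ (2 * (1 + t / 2))).
          by rewrite mulrDr mulrCA divff// !mulr1 lerD2r ler1n.
        by rewrite ler_pM2l// expR_ge1Dx.
      have -> : - t = - (t / 2) + (- (t / 2)) by rewrite -opprD -splitr.
      rewrite expRD mulrA mulrA; have -> : 4 * 2^-1 = 2 :> R by lra.
      rewrite mulNr [2^-1 * t]mulrC ler_wpM2r ?expR_ge0//.
      rewrite expRN -ler_pdivlMr ?invr_gt0 ?expR_gt0// invrK.
      exact: le_trans h1 h3.
  apply: ge0_subset_integral => //; first exact: emeasurable_funM.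
  by move=> t _; rewrite -EFinM lee_fin mulr_ge0.
rewrite ge0_integralZl//; last by move=> t _; rewrite lee_fin.
by rewrite (integral_exponential_pdf h2) mule1 ltry.
Qed.

Lemma gauss_const_gt0 (p : R) : 1 <= p -> 0 < gauss_const p.
Proof.
move=> p1; have p0 : 0 < p by exact: lt_le_trans p1.
rewrite /gauss_const powR_gt0// mulr_gt0// Gamma_gt0// invr_ge0 ltW//=.
by rewrite invf_le1.
Qed.

End GammaPos.

Section Coordinates.
Context {R : realType} {d : nat}.
Implicit Types (w : 'M[R]_d) (x : 'rV[R]_d).

Definition crd w x j : R := (x *m invmx w) 0 j.

Lemma crdE w x j : crd w x j = \sum_k x 0 k * invmx w k j.
Proof. by rewrite /crd mxE. Qed.

Lemma crdD w x y j : crd w (x + y) j = crd w x j + crd w y j.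
Proof. by rewrite /crd mulmxDl mxE. Qed.

Lemma crdN w x j : crd w (- x) j = - crd w x j.
Proof. by rewrite /crd mulNmx mxE. Qed.

Lemma crdZ w a x j : crd w (a *: x) j = a * crd w x j.
Proof. by rewrite /crd -scalemxAl mxE. Qed.

Lemma crd_sum w (lam : 'I_d -> R) j : row_free w ->
  crd w (\sum_j lam j *: row j w) j = lam j.
Proof.
rewrite row_free_unit => wu.
have -> : \sum_j lam j *: row j w = (\row_j lam j) *m w.
  by rewrite mulmx_sum_row; apply: eq_bigr => k _; rewrite mxE.
by rewrite /crd mulmxK// mxE.
Qed.

Lemma crd_row w i j : row_free w -> crd w (row i w) j = (i == j)%:R.
Proof.
rewrite row_free_unit => wu.
by rewrite /crd -row_mul mulmxV// !mxE.
Qed.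

Lemma rowE_crd w x : row_free w -> x = \sum_j crd w x j *: row j w.
Proof.
rewrite row_free_unit => wu.
rewrite -[LHS](mulmxKV wu) mulmx_sum_row.
by apply: eq_bigr => k _.
Qed.

Lemma cone_ofP w x : row_free w -> cone_of w x <-> forall j, 0 <= crd w x j.
Proof.
move=> wf; split=> [[lam l0 ->] j|H]; first by rewrite crd_sum.
by exists (crd w x) => //; exact: rowE_crd.
Qed.

Lemma lform_crd w (t : d.-tuple (measurableTypeR R)) j :
  lform (fun k => invmx w k j) t = crd w (row_of_tuple t) j.
Proof. by rewrite crdE; apply: eq_bigr => k _; rewrite mxE. Qed.

Lemma crd_neq0 w j : row_free w -> exists k, invmx w k j != 0.
Proof.
move=> wf; apply: contrapT => h.
have := crd_row j j wf; rewrite eqxx crdE big1.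
  by move/esym/eqP; rewrite oner_eq0.
move=> k _; apply/eqP; rewrite mulf_eq0; apply/orP; right.
by apply/negPn/negP => hk; apply: h; exists k.
Qed.

End Coordinates.

Section SolidAngleFormula.
Context {R : realType} {d : nat}.
Local Notation RT := (measurableTypeR R).
Variables (p : R) (w : 'M[R]_d).
Hypotheses (p1 : 1 <= p) (wf : row_free w).
Local Notation c := (gauss_const p).
Local Notation cw j := (fun k => invmx w k j).

Let p0 : 0 < p. Proof. exact: lt_le_trans p1. Qed.
Let c0 : 0 < c. Proof. exact: gauss_const_gt0. Qed.

Definition heaviside (t : R) : R := (0 <= t)%R%:R.

Lemma heaviside_ge0 t : 0 <= heaviside t <= 1.
Proof. by rewrite /heaviside; case: (0 <= t)%R; rewrite ?mulr1n ?mulr0n ?lexx ?ler01. Qed.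

(* The limit of [heaviside (t + e * v)] as [e] tends to [0] from above. *)
Definition tangent (t v : R) : R := if t == 0 then heaviside v else heaviside t.

Definition tuple_of_row (x : 'rV[R]_d) : d.-tuple RT := [tuple x 0 k | k < d].

Lemma lpnormX (x : 'rV[R]_d) : lpnorm p x `^ p = \sum_(k < d) `|x 0 k| `^ p.
Proof.
rewrite /lpnorm -powRrM mulVf ?lt0r_neq0// powRr1//.
by apply: sumr_ge0 => k _; exact: powR_ge0.
Qed.

Lemma crd_tuple_affine (a : R) (x : 'rV[R]_d) (z : d.-tuple RT) j :
  crd w (row_of_tuple (tuple_affine a (tuple_of_row x) z)) j =
  crd w x j + a * lform (cw j) z.
Proof.
rewrite lform_crd -crdZ -crdD; congr (crd w _ j).
by apply/rowP => k; rewrite !mxE !tnth_mktuple addrC.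
Qed.

Lemma bmfun_heaviside (k b : R) (a : 'I_d -> R) :
  bmfun (fun z : d.-tuple RT => heaviside (b + k * lform a z)).
Proof.
split; last by exists 1 => z; have /andP[h0 h1] := heaviside_ge0 (b + k * lform a z); rewrite ger0_norm.
pose A := [set z : d.-tuple RT | 0 <= b + k * lform a z].
rewrite (_ : (fun _ => _) = \1_A).
  apply: measurable_indic; rewrite /A -[X in measurable X]setTI.
  have mf : measurable_fun setT (fun z : d.-tuple RT => b + k * lform a z).
    apply: measurable_funD => //; apply: measurable_funM => //.
    exact: measurable_lform.
  have := mf measurableT `[0, +oo[%classic (measurable_itv _).
  rewrite (_ : (fun z : d.-tuple RT => b + k * lform a z : R) @^-1` _ = A)//.
  by apply/seteqP; split=> z /=; rewrite in_itv/= andbT.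
apply/funext => z; rewrite indicE /heaviside; congr (_%:R); congr nat_of_bool.
by apply/idP/idP; rewrite in_setE.
Qed.

Lemma bmfun_tangent (t : R) (a : 'I_d -> R) :
  bmfun (fun z : d.-tuple RT => tangent t (lform a z)).
Proof.
rewrite /tangent; case: eqP => t0; last exact: bmfun_cst.
rewrite (_ : (fun _ => _) = fun z : d.-tuple RT => heaviside (0 + 1 * lform a z)).
  exact: bmfun_heaviside.
by apply/funext => z; rewrite add0r mul1r.
Qed.

(** If the integral is infinite, both sides are 0 by the convention for [fine]. *)
Lemma lebT_affine_fine (a : R) (v : d.-tuple RT) (F : d.-tuple RT -> R) : 0 < a ->
  measurable_fun setT (EFin \o F) -> (forall t, 0 <= F t) ->
  (a ^+ d)^-1 * fine (\int[lebT d]_t (F t)%:E)%E =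
  fine (\int[lebT d]_z (F (tuple_affine a v z))%:E)%E.
Proof.
move=> a0 mF F0; have F0' t : (0 <= (EFin \o F) t)%E by rewrite lee_fin F0.
have := lebT_affine v (lt0r_neq0 a0) mF F0'; rewrite (gtr0_norm a0) /= => ->.
have : (0 <= \int[lebT d]_t (F t)%:E)%E.
  by apply: integral_ge0 => t _; rewrite lee_fin F0.
case: (\int[lebT d]_t (F t)%:E)%E => [r| |] // _ /=.
by rewrite mulr0 gt0_muley// lte_fin invr_gt0 exprn_gt0.
Qed.

(** The integrand of the solid angle, with the indicator of the cone split into one factor per
    facet; [0 + 1 * _] gives the factors the form of [bmfun_heaviside]. *)
Definition cone_gauss (x : 'rV[R]_d) (eps : R) (t : d.-tuple RT) : R :=
  (\prod_j heaviside (0 + 1 * lform (cw j) t)) *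
  expR (- (c / eps) * \sum_(k < d) `|tnth t k - x 0 k| `^ p).

Lemma cone_gauss_ge0 x eps t : 0 <= cone_gauss x eps t.
Proof.
rewrite mulr_ge0 ?expR_ge0//; apply: prodr_ge0 => j _.
by case/andP: (heaviside_ge0 (0 + 1 * lform (cw j) t)).
Qed.

Lemma measurable_cone_gauss x eps : measurable_fun setT (EFin \o cone_gauss x eps).
Proof.
apply/measurable_EFinP; apply: measurable_funM.
  by have [] := @bmfun_prod R d _ (index_enum 'I_d) xpredT _ (fun j => bmfun_heaviside 1 0 (cw j)).
apply: measurableT_comp => //; apply: measurable_funM => //.
apply: measurable_sum => k.
apply: (measurableT_comp (@measurable_powabs R p) _).
by apply: measurable_funB => //; exact: measurable_tnth.
Qed.

Lemma integral_cone_gauss x eps :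
  (\int[@lebesgue_tuple R d]_(t in @row_of_tuple R d @^-1` cone_of w)
    (expR (- (c / eps) * lpnorm p (row_of_tuple t - x) `^ p))%:E =
    \int[lebT d]_t (cone_gauss x eps t)%:E)%E.
Proof.
rewrite -lebTE integral_mkcond; apply: eq_integral => t _.
rewrite patchE /cone_gauss lpnormX; case: ifPn => [|ht].
  rewrite in_setE => /(cone_ofP _ wf) H.
  have -> : \prod_j heaviside (0 + 1 * lform (cw j) t) = 1.
    by rewrite big1// => j _; rewrite add0r mul1r lform_crd /heaviside H.
  rewrite mul1r.
  by congr (expR (_ * _))%:E; apply: eq_bigr => k _; rewrite !mxE.
have [j hj] : exists j, ~~ (0 <= crd w (row_of_tuple t) j).
  apply: contrapT => h; move/negP: ht; apply; rewrite in_setE/=.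
  by apply/(cone_ofP _ wf) => j; apply/negPn/negP => hj; apply: h; exists j.
by rewrite (bigD1 j)//= add0r mul1r lform_crd /heaviside (negbTE hj) !mul0r.
Qed.

Lemma cone_gauss_tuple_affine x (eps a : R) z : 0 < a -> a `^ p = eps -> eps != 0 ->
  cone_gauss x eps (tuple_affine a (tuple_of_row x) z) =
  (\prod_j heaviside (crd w x j + a * lform (cw j) z)) * weight p c z.
Proof.
move=> a0 aX e0; rewrite /cone_gauss; congr (_ * _).
  apply: eq_bigr => j _.
  by rewrite add0r mul1r (lform_crd w (tuple_affine _ _ _)) crd_tuple_affine.
rewrite /weight; apply: congr1; rewrite !mulNr; apply: congr1.
rewrite -mulrA; apply: congr1.
rewrite mulr_sumr; apply: eq_bigr => k _.
rewrite !tnth_mktuple addrK normrM (gtr0_norm a0) (powRM _ (ltW a0))//.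
by rewrite aX mulKf.
Qed.

(** Substitute t = x + eps^(1/p) z: the Jacobian eps^(d/p) cancels the normalising factor, and [eps]
    survives only in the indicator of the cone. *)
Lemma solid_angle_scaled (x : 'rV[R]_d) (eps : R) : 0 < eps ->
  (eps `^ (d%:R / p))^-1 *
  fine (\int[@lebesgue_tuple R d]_(t in @row_of_tuple R d @^-1` cone_of w)
    (expR (- (c / eps) * lpnorm p (row_of_tuple t - x) `^ p))%:E) =
  gint p c (fun z : d.-tuple RT =>
    \prod_j heaviside (crd w x j + eps `^ p^-1 * lform (cw j) z)).
Proof.
move=> e0.
have a0 : 0 < eps `^ p^-1 by exact: powR_gt0.
have aX : (eps `^ p^-1) `^ p = eps.
  by rewrite -powRrM mulVf ?lt0r_neq0// powRr1// ltW.
have ad : eps `^ (d%:R / p) = (eps `^ p^-1) ^+ d.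
  by rewrite -powR_mulrn ?powR_ge0// -powRrM mulrC.
rewrite integral_cone_gauss ad; move: (eps `^ p^-1) a0 aX => a a0 aX.
rewrite (lebT_affine_fine (tuple_of_row x) a0 (measurable_cone_gauss x eps)
  (cone_gauss_ge0 x eps)).
apply: (congr1 fine); apply: eq_integral => z _; apply: (congr1 EFin).
exact: cone_gauss_tuple_affine a0 aX (lt0r_neq0 e0).
Qed.

Lemma cvg_gint (h_ : nat -> d.-tuple RT -> R) (h : d.-tuple RT -> R) :
  (forall n, bmfun (h_ n)) -> bmfun h -> (forall n z, `|h_ n z| <= 1) ->
  (forall z, h_ n z @[n --> \oo] --> h z) ->
  gint p c (h_ n) @[n --> \oo] --> gint p c h.
Proof.
move=> bh_ bh h1 hc.
have [] := @dominated_convergence _ _ _ (lebT d) setT measurableT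
  (fun (n : nat) (z : d.-tuple RT) => (h_ n z * weight p c z)%:E)
  (fun z : d.-tuple RT => (h z * weight p c z)%:E)
  (EFin \o @weight R p c d).
- by move=> n; have /integrableP[] := bmfun_integrable p1 c0 (bh_ n).
- by have /integrableP[] := bmfun_integrable p1 c0 bh.
- by apply: aeW => z _; apply: cvg_EFin; [exact: nearW|]; apply: cvgMl.
- exact: integrable_weight.
- apply: aeW => z n _; rewrite lee_fin normrM (ger0_norm (weight_ge0 _ _ _)).
  by rewrite ler_piMl// weight_ge0.
move=> _ _ H; rewrite gint_nonneg; apply: fine_cvg.
rewrite fineK//; have /integrableP[mi] := bmfun_integrable p1 c0 bh.
by move=> hi; apply: integrable_fin_num => //; apply/integrableP.
Qed.

Lemma bmfun_prod_heaviside (x : 'rV[R]_d) (a : R) : bmfun (fun z : d.-tuple RT =>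
    \prod_j heaviside (crd w x j + a * lform (cw j) z)).
Proof. by apply: bmfun_prod => j; exact: bmfun_heaviside. Qed.

Lemma bmfun_prod_tangent (b : 'I_d -> R) : bmfun (fun z : d.-tuple RT =>
    \prod_j tangent (b j) (lform (cw j) z)).
Proof. by apply: bmfun_prod => j; exact: bmfun_tangent. Qed.

(** The sequence is eventually constant: for [b = 0] its value depends only on the sign of [v], and
    otherwise the perturbation becomes smaller than the modulus of [b]. *)
Lemma cvg_heaviside (u : nat -> R) (b v : R) : (forall n, 0 < u n) -> u @ \oo --> 0 ->
  heaviside (b + u n `^ p^-1 * v) @[n --> \oo] --> tangent b v.
Proof.
move=> u0 uc.
have small (dl : R) : 0 < dl -> \forall n \near \oo, u n `^ p^-1 * `|v| < dl.
  move=> dl0; pose r := dl / (`|v| + 1).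
  have r0 : 0 < r by rewrite divr_gt0// ltr_wpDl.
  have rp : 0 < r `^ p by exact: powR_gt0.
  move/cvgrPdist_lt: uc => /(_ _ rp); apply: filterS => n.
  rewrite sub0r normrN gtr0_norm// => un.
  have : u n `^ p^-1 <= r.
    have -> : r = (r `^ p) `^ p^-1 by rewrite -powRrM divff ?lt0r_neq0// powRr1// ltW.
    by apply: ge0_ler_powR; rewrite ?nnegrE ?invr_ge0 ?ltW.
  move=> h; apply: (@le_lt_trans _ _ (r * `|v|)); first by rewrite ler_wpM2r.
  by rewrite /r mulrAC ltr_pdivrMr ?ltr_wpDl// mulrDr mulr1 ltrDl.
apply: cvg_near_cst; rewrite /tangent.
case: eqP => [->|/eqP b0].
  apply: nearW => n; rewrite add0r /heaviside; congr (_%:R); congr nat_of_bool.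
  by rewrite pmulr_rge0// powR_gt0.
have b0' : 0 < `|b| by rewrite normr_gt0.
have := small _ b0'; apply: filterS => n h; rewrite /heaviside.
congr (_%:R); congr nat_of_bool.
have := ler_norm (u n `^ p^-1 * v); have := ler_norm (- (u n `^ p^-1 * v)).
rewrite normrN normrM (ger0_norm (powR_ge0 _ _)) => h1 h2.
have [b1|b1] := leP 0 b.
  by rewrite (ger0_norm b1) in h; apply/idP; lra.
by rewrite (ltr0_norm b1) in h; apply/negbTE; rewrite -ltNge; lra.
Qed.

Lemma solid_angleE (x : 'rV[R]_d) : solid_angle p (cone_of w) x =
  gint p c (fun z : d.-tuple RT => \prod_j tangent (crd w x j) (lform (cw j) z)).
Proof.
apply/cvg_lim => //; apply/cvg_at_rightP => u [u0 uc].
under eq_fun => n do rewrite (solid_angle_scaled _ (u0 n)).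
apply: cvg_gint.
- by move=> n; exact: bmfun_prod_heaviside.
- exact: bmfun_prod_tangent.
- move=> n z; rewrite normr_prod; apply: prodr_ile1 => j _.
  have /andP[h0 h1] := heaviside_ge0 (crd w x j + u n `^ p^-1 * lform (cw j) z).
  by rewrite ger0_norm// h0.
move=> z; elim: (index_enum _) => [|j r IH].
  under eq_fun do rewrite big_nil.
  by rewrite big_nil; exact: cvg_cst.
under eq_fun do rewrite big_cons.
by rewrite big_cons; apply: cvgM => //; exact: cvg_heaviside.
Qed.

End SolidAngleFormula.

Section SolidAngleRelations.
Context {R : realType} {d : nat}.
Local Notation RT := (measurableTypeR R).
Variables (p : R) (w : 'M[R]_d).
Hypotheses (p1 : 1 <= p) (wf : row_free w).
Local Notation c := (gauss_const p).
Local Notation cw j := (fun k => invmx w k j).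
Local Notation omega := (solid_angle p (cone_of w)).

Let c0 : 0 < c. Proof. exact: gauss_const_gt0. Qed.

Definition kappa : R := gint p c (fun _ : d.-tuple RT => 1).

Lemma kappa_gt0 : 0 < kappa.
Proof. exact: gint1_gt0. Qed.

Lemma tangent_ge0 (t v : R) : 0 <= tangent t v <= 1.
Proof. by rewrite /tangent; case: ifP => _; exact: heaviside_ge0. Qed.

Lemma omega_ge0 x : 0 <= omega x.
Proof.
rewrite solid_angleE//; apply: gint_ge0 => z; apply: prodr_ge0 => j _.
by case/andP: (tangent_ge0 (crd w x j) (lform (cw j) z)).
Qed.

Lemma omega_le x : omega x <= kappa.
Proof.
rewrite solid_angleE//; apply: gint_le => //.
- exact: bmfun_prod_tangent.
- exact: bmfun_cst.
by move=> z; apply: prodr_ile1 => j _; exact: tangent_ge0.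
Qed.

Lemma omega_interior x : (forall j, 0 < crd w x j) -> omega x = kappa.
Proof.
move=> H; rewrite solid_angleE// /kappa; congr (gint p c); apply/funext => z.
by rewrite big1// => j _; rewrite /tangent gt_eqF// /heaviside ltW.
Qed.

Lemma tangentN (t v : R) : v != 0 -> tangent (- t) (- v) = 1 - tangent t v.
Proof.
have H (u : R) : u != 0 -> heaviside (- u) = 1 - heaviside u.
  by rewrite /heaviside oppr_ge0; case: ltgtP => // _ _; rewrite ?subrr ?subr0.
move=> v0; rewrite /tangent oppr_eq0.
by have [_|t0] := eqVneq t 0; exact: H.
Qed.

Variable a : 'I_d -> R.
Hypothesis a0 : forall j, 0 < a j.

Definition ysum (I : {set 'I_d}) : 'rV[R]_d := \sum_(i in I) a i *: row i w.

Lemma crd_ysum I j : crd w (ysum I) j = if j \in I then a j else 0.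
Proof.
rewrite -(crd_sum (fun j => if j \in I then a j else 0) j wf); congr (crd w _ j).
rewrite /ysum big_mkcond; apply: eq_bigr => i _.
by case: ifP => // _; rewrite scale0r.
Qed.

(** By inclusion-exclusion over translated cones, this is the solid angle at [x] of the
    parallelepiped spanned by the vectors [a j *: row j w]. *)
Definition box_angle x : R :=
  \sum_(I : {set 'I_d}) (-1) ^+ #|I| * omega (x - ysum I).

Lemma box_angleE x : box_angle x = gint p c (fun z : d.-tuple RT =>
  \prod_j (tangent (crd w x j) (lform (cw j) z) -
           tangent (crd w x j - a j) (lform (cw j) z))).
Proof.
rewrite /box_angle; under eq_bigr => I _ do rewrite solid_angleE//.
rewrite -gint_sum//; last by move=> I; exact: bmfun_prod_tangent.
congr (gint p c); apply/funext => z.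
under [RHS]eq_bigr => j _ do rewrite addrC.
rewrite bigA_distr; apply: eq_bigr => I _.
rewrite (bigID (mem I))/= [RHS](bigID (mem I))/= mulrA; congr (_ * _); last first.
  by apply: eq_bigr => j jI; rewrite crdD crdN crd_ysum (negbTE jI) subr0.
rewrite -[X in _ = X](_ : \prod_(i in I) (-1 * tangent (crd w x i - a i) (lform (cw i) z)) = _); last first.
  by apply: eq_bigr => i iI; rewrite iI mulN1r.
rewrite big_split/= prodr_const; congr (_ * _).
by apply: eq_bigr => j jI; rewrite crdD crdN crd_ysum jI.
Qed.

Lemma box_angle_out x j : ~~ (0 <= crd w x j <= a j) -> box_angle x = 0.
Proof.
move=> H; rewrite box_angleE (_ : (fun _ => _) = fun=> 0).
  by rewrite /gint; under eq_Rintegral do rewrite mul0r; rewrite Rintegral_cst// mul0r.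
apply/funext => z; rewrite (bigD1 j)//=.
suff -> : tangent (crd w x j) (lform (cw j) z) = tangent (crd w x j - a j) (lform (cw j) z).
  by rewrite subrr mul0r.
have aj := a0 j; rewrite /tangent /heaviside.
have [h|h] := ltP (crd w x j) 0.
  have h2 : crd w x j - a j < 0 by lra.
  by rewrite (lt_eqF h) (lt_eqF h2) (lt_geF h2).
have h1 : a j < crd w x j by move: H; rewrite h/= -ltNge.
have h2 : 0 < crd w x j - a j by lra.
have h3 : 0 < crd w x j by lra.
by rewrite (gt_eqF h3) (gt_eqF h2) (ltW h2).
Qed.

Lemma lform_opp (z : d.-tuple RT) j : lform (cw j) (tuple_opp z) = - lform (cw j) z.
Proof.
rewrite /lform -sumrN; apply: eq_bigr => k _.
by rewrite !tnth_mktuple addr0 mulN1r mulNr.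
Qed.

(* Central symmetry of the weight, applied to the parallelepiped spanned by
   the vectors [a j *: row j w]; the reflection only fails on the null set where
   some coordinate vanishes. *)
Lemma box_angle_sym x : box_angle (ysum [set: 'I_d] - x) = box_angle x.
Proof.
have bmx (b1 b2 : 'I_d -> R) : bmfun (fun z : d.-tuple RT =>
    \prod_j (tangent (b1 j) (lform (cw j) z) - tangent (b2 j) (lform (cw j) z))).
  apply: bmfun_prod => j.
  rewrite (_ : (fun _ => _) = fun z : d.-tuple RT =>
     tangent (b1 j) (lform (cw j) z) + (-1) * tangent (b2 j) (lform (cw j) z)).
    apply: bmfunD; first exact: bmfun_tangent.
    by apply: bmfunM; [exact: bmfun_cst|exact: bmfun_tangent].
  by apply/funext => z; rewrite mulN1r.
rewrite !box_angleE -gint_opp//; apply: (@gint_ae R p c p1 c0 d d (fun j k => invmx w k j)) => //.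
- exact: (bmfun_tuple_affine _ _ (bmx (fun j => crd w (ysum [set: 'I_d] - x) j)
    (fun j => crd w (ysum [set: 'I_d] - x) j - a j))).
- by move=> j; exact: crd_neq0.
move=> z Hz; apply: eq_bigr => j _.
rewrite lform_opp crdD crdN crd_ysum inE.
have -> : a j - crd w x j = - (crd w x j - a j) by rewrite opprB.
have -> : - (crd w x j - a j) - a j = - crd w x j by ring.
rewrite !tangentN//; ring.
Qed.

End SolidAngleRelations.

(** * The generating series *)

Section UnconditionalSums.
Context {R : realType} {I : choiceType}.
Local Open Scope complex_scope.
Implicit Types (A B : {fset I}).

(** [summability.sum] is a [lim], which has a value even for a divergent family; [has_usum] asserts
    convergence as well. *)
Definition has_usum (a : I -> R[i]) (l : R[i]) : Prop :=
  forall e : R, 0 < e -> exists A0, forall A, (A0 `<=` A)%fset ->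
    nc (\sum_(i <- A) a i - l) <= e.

Lemma has_usum_sum (a : I -> R[i]) l : has_usum a l -> summability.sum a = l.
Proof.
have FT : ProperFilter (@summability.totally I) := summability.totally_filter.
move=> H; apply/cvg_lim => //; apply/cvgrPdist_le => /= e /pos_complex[r r0 ->].
have [A0 HA] := H r r0; exists A0 => //= A /HA.
have -> : summability.partial_sum a A = \sum_(i <- A) a i by rewrite big_seq_fsetE.
by rewrite -normrN opprB normr_nc lecR.
Qed.

Lemma has_usum_unique (a : I -> R[i]) l1 l2 : has_usum a l1 -> has_usum a l2 -> l1 = l2.
Proof. by move=> /has_usum_sum <- /has_usum_sum <-. Qed.

Lemma has_usumD (a b : I -> R[i]) l1 l2 : has_usum a l1 -> has_usum b l2 ->
  has_usum (fun i => a i + b i) (l1 + l2).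
Proof.
move=> H1 H2 e e0; have e2 : 0 < e / 2 by rewrite divr_gt0.
have [A1 {}H1] := H1 _ e2; have [A2 {}H2] := H2 _ e2.
exists (A1 `|` A2)%fset => A; rewrite fsubUset => /andP[/H1 h1 /H2 h2].
rewrite big_split/= opprD addrACA; apply: le_trans (le_normcD _ _) _; lra.
Qed.

Lemma has_usumZ (a : I -> R[i]) l k : has_usum a l ->
  has_usum (fun i => k * a i) (k * l).
Proof.
move=> H e e0; have k0 : 0 < nc k + 1 by rewrite ltr_wpDl ?nc_ge0.
have [A0 {}H] := H _ (divr_gt0 e0 k0).
exists A0 => A /H h; rewrite -mulr_sumr -mulrBr ComplexField.Normc.normcM.
apply: le_trans (ler_wpM2l (nc_ge0 _) h) _.
by rewrite mulrA ler_pdivrMr// mulrC ler_pM2l// lerDl.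
Qed.

Lemma has_usum0 : has_usum (fun=> 0) 0.
Proof.
move=> e e0; exists fset0 => A _.
by rewrite big1// subrr ComplexField.Normc.normc0 ltW.
Qed.

Lemma has_usum_big (J : Type) (r : seq J) (a : J -> I -> R[i]) (l : J -> R[i]) :
  (forall j, has_usum (a j) (l j)) ->
  has_usum (fun i => \sum_(j <- r) a j i) (\sum_(j <- r) l j).
Proof.
move=> H; elim: r => [|j r IH].
  rewrite big_nil (_ : (fun _ => _) = fun=> 0); first exact: has_usum0.
  by apply/funext => i; rewrite big_nil.
rewrite big_cons (_ : (fun _ => _) = fun i => a j i + \sum_(j <- r) a j i).
  exact: has_usumD.
by apply/funext => i; rewrite big_cons.
Qed.

Lemma has_usum_finite (a : I -> R[i]) B : (forall i, i \notin B -> a i = 0) ->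
  has_usum a (\sum_(i <- B) a i).
Proof.
move=> H e e0; exists B => A BA.
rewrite (big_fset_incl _ BA) ?subrr ?ComplexField.Normc.normc0 ?ltW// => i _.
exact: H.
Qed.

Lemma has_usum_reindex (a : I -> R[i]) l (g h : I -> I) :
  cancel g h -> cancel h g -> has_usum a l -> has_usum (fun i => a (g i)) l.
Proof.
move=> gh hg H e e0; have [A0 {}H] := H e e0.
exists [fset h i | i in A0]%fset => A sA.
have -> : \sum_(i <- A) a (g i) = \sum_(i <- [fset g i | i in A]%fset) a i.
  by rewrite big_imfset//= => x y _ _; exact: (can_inj gh).
apply: H; apply/fsubsetP => i iA.
apply/imfsetP; exists (h i); last by rewrite hg.
by apply: (fsubsetP sA); apply/imfsetP; exists i.
Qed.

Lemma sum_fsetU (V : nmodType) (b : I -> V) A B : [disjoint A & B]%fset ->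
  \sum_(i <- (A `|` B)%fset) b i = \sum_(i <- A) b i + \sum_(i <- B) b i.
Proof.
move=> /fdisjointP dj; rewrite (big_fsetID _ (mem A))/=; congr (_ + _);
  apply: eq_fbigl => i; rewrite !inE/=.
  by case: (boolP (i \in A)) => //; rewrite andbF.
by case: (boolP (i \in A)) => [/dj/negbTE ->|]; rewrite ?andbF ?andbT.
Qed.

Lemma sum_fsubset_le (b : I -> R) A0 A : (forall i, 0 <= b i) -> (A0 `<=` A)%fset ->
  \sum_(i <- A0) b i <= \sum_(i <- A) b i.
Proof.
move=> b0 A0A.
have -> : A = (A0 `|` (A `\` A0))%fset.
  by apply/fsetP => i; rewrite !inE; case: (boolP (i \in A0)) => // /(fsubsetP A0A) ->.
rewrite sum_fsetU ?lerDl ?sumr_ge0//.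
by apply/fdisjointP => i iA; rewrite inE iA.
Qed.

Lemma has_usum_ge0 (b : I -> R) (M : R) : (forall i, 0 <= b i) ->
  (forall A, \sum_(i <- A) b i <= M) ->
  exists2 l : R, has_usum (fun i => (b i)%:C) l%:C & forall A, \sum_(i <- A) b i <= l.
Proof.
move=> b0 bM; pose S := [set \sum_(i <- A) b i | A in [set: {fset I}]].
have hS : has_sup S.
  split; first by exists (\sum_(i <- fset0) b i), fset0.
  by exists M => _ [A _ <-].
have Sl A : \sum_(i <- A) b i <= sup S.
  by apply: ub_le_sup; [case: hS|exists A].
exists (sup S) => //.
move=> e e0; have [_ [A0 _ <-] hA0] := sup_adherent e0 hS.
exists A0 => A A0A; rewrite -raddf_sum -raddfB nc_real.
rewrite distrC ger0_norm ?subr_ge0//.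
have := sum_fsubset_le b0 A0A; have := Sl A; lra.
Qed.

(** Adding the modulus makes the real and imaginary parts nonnegative, so [has_usum_ge0] sums them;
    the sum of the moduli is then subtracted. *)
Lemma abs_usum (a : I -> R[i]) (M : R) :
  (forall A, \sum_(i <- A) nc (a i) <= M) -> exists l, has_usum a l.
Proof.
move=> aM.
pose re i := complex.Re (a i); pose im i := complex.Im (a i).
have M2 A (b : I -> R) : (forall i, `|b i| <= nc (a i)) ->
    \sum_(i <- A) (b i + nc (a i)) <= M + M.
  move=> h; rewrite big_split/=; apply: lerD => //; apply: le_trans (aM A).
  by apply: ler_sum => i _; apply: le_trans (h i); exact: ler_norm.
have pos (b : I -> R) : (forall i, `|b i| <= nc (a i)) ->
    forall i, 0 <= b i + nc (a i).
  by move=> h i; have := h i; rewrite ler_norml => /andP[]; lra.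
have hre i : `|re i| <= nc (a i) by exact: Re_le_nc.
have him i : `|im i| <= nc (a i) by exact: Im_le_nc.
have [l0 H0 _] := has_usum_ge0 (fun i => nc_ge0 (a i)) aM.
have [l1 H1 _] := has_usum_ge0 (pos _ hre) (fun A => M2 A _ hre).
have [l2 H2 _] := has_usum_ge0 (pos _ him) (fun A => M2 A _ him).
exists ((l1%:C + (-1) * l0%:C) + 'i * (l2%:C + (-1) * l0%:C)).
rewrite (_ : a = fun i => ((re i + nc (a i))%:C + (-1) * (nc (a i))%:C) +
   'i * ((im i + nc (a i))%:C + (-1) * (nc (a i))%:C)).
  by apply: has_usumD; [|apply: has_usumZ]; apply: has_usumD => //; apply: has_usumZ.
apply/funext => i; rewrite !raddfD/= !mulN1r !addrK.
by rewrite [LHS]complexE.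
Qed.

Lemma usum_tail (a : I -> R[i]) l A0 (e : R) : has_usum a l ->
  (forall B, [disjoint B & A0]%fset -> \sum_(i <- B) nc (a i) <= e) ->
  nc (\sum_(i <- A0) a i - l) <= e.
Proof.
move=> H tl; apply/ler_addgt0Pl => r r0.
have [A1 {}H] := H r r0.
have := H (A0 `|` A1)%fset (fsubsetUr _ _).
have dj : [disjoint (A1 `\` A0)%fset & A0]%fset.
  by apply/fdisjointP => i; rewrite inE => /andP[].
have -> : (A0 `|` A1 = A0 `|` (A1 `\` A0))%fset
  by apply/fsetP => i; rewrite !inE; case: (i \in A0).
rewrite sum_fsetU; last by rewrite fdisjoint_sym.
move=> h; have := tl _ dj => h2.
set X := \sum_(i <- A0) a i in h *; set Y := \sum_(i <- (A1 `\` A0)%fset) a i in h.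
have hY : nc Y <= e.
  apply: le_trans h2; rewrite /Y; elim/big_rec2: _ => [|i y1 y2 _ h3].
    by rewrite ComplexField.Normc.normc0.
  by apply: le_trans (le_normcD _ _) _; rewrite lerD2l.
have -> : X - l = (X + Y - l) - Y by ring.
by apply: le_trans (le_normcD _ _) _; rewrite normcN; exact: lerD.
Qed.

Lemma bounded_tail (b : I -> R) (M e : R) : (forall i, 0 <= b i) ->
  (forall A, \sum_(i <- A) b i <= M) -> 0 < e ->
  exists A0, forall A, (A0 `<=` A)%fset ->
    forall B, [disjoint B & A]%fset -> \sum_(i <- B) b i <= e.
Proof.
move=> b0 bM e0; have [l H lub] := has_usum_ge0 b0 bM.
have [A0 HA] := H e e0; exists A0 => A A0A B dj.
have := HA _ A0A; rewrite -raddf_sum -raddfB nc_real ler_norml => /andP[h1 _].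
have := lub (B `|` A)%fset; rewrite sum_fsetU//; lra.
Qed.

End UnconditionalSums.

(** * Counting lattice points in the cone *)

Section LatticeBound.
Context {R : realType} {d : nat}.
Variable w : 'M[R]_d.
Hypothesis wf : row_free w.

Definition lat (m : 'rV[int]_d) : 'rV[R]_d := map_mx intr m.

Lemma latD m n : lat (m + n) = lat m + lat n.
Proof. by rewrite /lat map_mxD. Qed.

Lemma latN m : lat (- m) = - lat m.
Proof. by rewrite /lat map_mxN. Qed.

Definition basis_size : R := \sum_j \sum_k `|w j k|.

Lemma coord_le (x : 'rV[R]_d) (M : R) k : (forall j, `|crd w x j| <= M) ->
  `|x 0 k| <= M * basis_size.
Proof.
move=> H.
have M0 : 0 <= M \/ basis_size = 0.
  case: (posnP d) => [d0|d0]; first right.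
    rewrite /basis_size big1// => j _; exfalso.
    by have := leq_ltn_trans (leq0n j) (ltn_ord j); rewrite d0.
  by left; apply: le_trans (H (Ordinal d0)).
rewrite {1}(rowE_crd x wf) summxE; apply: le_trans (ler_norm_sum _ _ _) _.
have h1 : \sum_j `|(crd w x j *: row j w) 0 k| <= \sum_j M * `|w j k|.
  by apply: ler_sum => j _; rewrite !mxE normrM ler_wpM2r.
apply: le_trans h1 _; rewrite -mulr_sumr.
case: M0 => [M0|w0].
  apply: ler_wpM2l => //; apply: ler_sum => j _.
  by rewrite (bigD1 k)//= lerDl sumr_ge0.
rewrite w0 mulr0 big1 ?mulr0// => j _.
apply/eqP; rewrite eq_le normr_ge0 andbT -w0 /basis_size (bigD1 j)//= (bigD1 k)//=.
by rewrite -addrA lerDl addr_ge0 ?sumr_ge0// => i _; rewrite sumr_ge0.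
Qed.

Definition cell_width : nat := (Num.truncn basis_size).+1.

Lemma basis_size_lt : basis_size < cell_width%:R.
Proof. exact: truncnS_gt. Qed.

(** Two lattice points in one unit cell of the basis [w] differ by at most [basis_size] in each
    standard coordinate, so their differences from a fixed one inject into a finite type that does
    not depend on the cell. *)
Lemma lattice_cell_count (s : seq 'rV[int]_d) (n : 'I_d -> nat) : uniq s ->
  (forall m, m \in s -> forall j, (n j)%:R <= crd w (lat m) j < (n j).+1%:R) ->
  (size s <= #|{ffun 'I_d -> 'I_(2 * cell_width).+1}|)%N.
Proof.
case: s => [//|m0 s0] us H; set s := m0 :: s0 in us H *.
pose h (m : 'rV[int]_d) : {ffun 'I_d -> 'I_(2 * cell_width).+1} :=
  [ffun k => inord `|m 0 k - m0 0 k + cell_width%:Z|].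
have hb m k : m \in s -> `|m 0 k - m0 0 k| <= cell_width%:Z.
  move=> ms; rewrite -(ler_int R) intr_norm.
  have := @coord_le (lat m - lat m0) 1 k; rewrite !mxE mul1r rmorphB/= => h1.
  apply: le_trans (h1 _) _; last exact: ltW basis_size_lt.
  move=> j; rewrite crdD crdN.
  have := H m ms j; have := H m0 (mem_head _ _) j.
  rewrite -!natr1 ler_norml => /andP[a1 a2] /andP[b1 b2]; apply/andP; split; lra.
have hinj : {in s &, injective h}.
  move=> m m' ms ms' /ffunP E; apply/rowP => k; have := E k; rewrite !ffunE.
  have := hb m k ms; have := hb m' k ms'; rewrite !ler_norml.
  move: (m 0 k : int) (m' 0 k : int) (m0 0 k) (cell_width) => x x' x0 B b1 b2.
  have e1 : (absz (x - x0 + B%:Z)%R < (2 * B).+1)%N by lia.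
  have e2 : (absz (x' - x0 + B%:Z)%R < (2 * B).+1)%N by lia.
  move=> /(congr1 val) /=; rewrite !inordK// => e3; lia.
rewrite -(size_map h) -(card_uniqP _) ?max_card//.
by rewrite map_inj_in_uniq.
Qed.

Lemma geometric_le (q : R) n : 0 <= q < 1 -> \sum_(i < n) q ^+ i <= (1 - q)^-1.
Proof.
move=> /andP[q0 q1]; have h : 0 < 1 - q by rewrite subr_gt0.
have -> : \sum_(i < n) q ^+ i = (1 - q ^+ n) / (1 - q).
  elim: n => [|n IH]; first by rewrite big_ord0 expr0 subrr mul0r.
  by rewrite big_ord_recr/= IH exprS; field; rewrite lt0r_neq0.
by rewrite ler_pdivrMr// mulVf ?lt0r_neq0// gerBl exprn_ge0.
Qed.

Definition cell_bound : R := #|{ffun 'I_d -> 'I_(2 * cell_width).+1}|%:R.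

(** Group the points by the integer parts of their coordinates along [w]. Each cell holds at most
    [cell_bound] of them, and the sum over the cells is a product of geometric series. *)
Lemma lattice_bound (b : 'I_d -> R) (A : {fset 'rV[int]_d}) :
  (forall j, 0 < b j) -> (forall m, m \in A -> forall j, 0 <= crd w (lat m) j) ->
  \sum_(m <- A) \prod_j expR (- (b j * crd w (lat m) j)) <=
  cell_bound * \prod_j (1 - expR (- b j))^-1.
Proof.
move=> b0 HA.
pose N := (\max_(m <- A) \max_j Num.truncn (crd w (lat m) j))%N.
have trN m j : m \in A -> (Num.truncn (crd w (lat m) j) <= N)%N.
  move=> mA; pose F m j := Num.truncn (crd w (lat m) j).
  apply: (@leq_trans (\max_j F m j)); first exact: (leq_bigmax (F := F m) j).
  exact: (@leq_bigmax_seq _ _ xpredT (fun m => \max_j F m j)%N).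
pose fl (m : 'rV[int]_d) : {ffun 'I_d -> 'I_N.+1} :=
  [ffun j => inord (Num.truncn (crd w (lat m) j))].
pose G (k : {ffun 'I_d -> 'I_N.+1}) : R := \prod_j expR (- b j) ^+ k j.
have G0 k : 0 <= G k by apply: prodr_ge0 => j _; rewrite exprn_ge0 ?expR_ge0.
have h1 : \sum_(m <- A) \prod_j expR (- (b j * crd w (lat m) j)) <=
    \sum_(m <- A) G (fl m).
  rewrite big_seq [leRHS]big_seq; apply: ler_sum => m mA.
  apply: ler_prod => j _; rewrite expR_ge0/= ffunE inordK ?ltnS ?trN//.
  rewrite -expRM_natl ler_expR mulrN lerN2 [leLHS]mulrC ler_pM2l//.
  by rewrite truncn_le HA.
apply: le_trans h1 _.
rewrite (partition_big fl xpredT)//=.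
have h2 k : \sum_(m <- A | fl m == k) G (fl m) <= cell_bound * G k.
  rewrite (eq_bigr (fun=> G k)); last by move=> m /eqP ->.
  rewrite -big_filter big_const_seq count_predT iter_addr_0 -mulr_natl; apply: ler_wpM2r => //.
  rewrite ler_nat; apply: (@lattice_cell_count _ (fun j => k j)).
    by rewrite filter_uniq// fset_uniq.
  move=> m; rewrite mem_filter => /andP[/eqP <- mA] j.
  by rewrite ffunE inordK ?ltnS ?trN//; apply: truncn_itv; exact: HA.
apply: le_trans (ler_sum _ (fun k _ => h2 k)) _.
rewrite -mulr_sumr; apply: ler_wpM2l; first exact: ler0n.
rewrite /G -(bigA_distr_bigA (fun j (i : 'I_N.+1) => expR (- b j) ^+ i)).
apply: ler_prod => j _; rewrite sumr_ge0/= => [|i _]; last by rewrite exprn_ge0 ?expR_ge0.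
apply: geometric_le; rewrite expR_ge0/=.
by rewrite -expR0 ltr_expR oppr_lt0.
Qed.

(** The form shared by the convergence of the series in the tube and by the moment estimate at a
    facet. *)
Lemma cone_sum_le (g : 'rV[int]_d -> R) (k : R) (b : 'I_d -> R) (A : {fset 'rV[int]_d}) :
  0 <= k -> (forall j, 0 < b j) ->
  (forall m, ~ (forall j, 0 <= crd w (lat m) j) -> g m = 0) ->
  (forall m, (forall j, 0 <= crd w (lat m) j) ->
     g m <= k * \prod_j expR (- (b j * crd w (lat m) j))) ->
  \sum_(m <- A) g m <= k * (cell_bound * \prod_j (1 - expR (- b j))^-1).
Proof.
move=> k0 b0 gout gin; pose K := [fset m in A | [forall j, 0 <= crd w (lat m) j]]%fset.
have -> : \sum_(m <- A) g m = \sum_(m <- K) g m.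
  apply/esym/big_fset_incl.
    by apply/fsubsetP => m; rewrite !inE/= => /andP[].
  move=> m mA mK; apply: gout => h; move/negP: mK; apply.
  by rewrite !inE/= mA; apply/forallP.
have HK m : m \in K -> forall j, 0 <= crd w (lat m) j.
  by rewrite !inE/= => /andP[_ /forallP].
apply: le_trans (ler_wpM2l k0 (lattice_bound b0 HK)).
by rewrite mulr_sumr big_seq [leRHS]big_seq; apply: ler_sum => m /HK; exact: gin.
Qed.

End LatticeBound.

Section Characters.
Context {R : realType} {d : nat}.
Local Open Scope complex_scope.
Implicit Types (s : 'rV[R[i]]_d) (m : 'rV[int]_d).

Definition char s m : R[i] := cexp ((0 +i* (2 * pi)) * dotp s (map_mx intr m)).

Definition rpart s : 'rV[R]_d := map_mx (@complex.Re R) s.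
Definition ipart s : 'rV[R]_d := map_mx (@complex.Im R) s.

Lemma dotpDr (A : comNzRingType) (x y z : 'rV[A]_d) : dotp x (y + z) = dotp x y + dotp x z.
Proof. by rewrite /dotp -big_split; apply: eq_bigr => k _; rewrite mxE mulrDr. Qed.

Lemma dotpDl (A : comNzRingType) (x y z : 'rV[A]_d) : dotp (x + y) z = dotp x z + dotp y z.
Proof. by rewrite /dotp -big_split; apply: eq_bigr => k _; rewrite mxE mulrDl. Qed.

Lemma dotpNl (A : comNzRingType) (x y : 'rV[A]_d) : dotp (- x) y = - dotp x y.
Proof. by rewrite /dotp -sumrN; apply: eq_bigr => k _; rewrite mxE mulNr. Qed.

Lemma dotpNr (A : comNzRingType) (x y : 'rV[A]_d) : dotp x (- y) = - dotp x y.
Proof. by rewrite /dotp -sumrN; apply: eq_bigr => k _; rewrite mxE mulrN. Qed.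

Lemma dotpZl (A : comNzRingType) a (x y : 'rV[A]_d) : dotp (a *: x) y = a * dotp x y.
Proof. by rewrite /dotp mulr_sumr; apply: eq_bigr => k _; rewrite mxE mulrA. Qed.

Lemma dotpZr (A : comNzRingType) a (x y : 'rV[A]_d) : dotp x (a *: y) = a * dotp x y.
Proof. by rewrite /dotp mulr_sumr; apply: eq_bigr => k _; rewrite mxE mulrCA. Qed.

Lemma dotp_sumr (A : comNzRingType) (I : Type) (r : seq I) (x : 'rV[A]_d) (y : I -> 'rV[A]_d) :
  dotp x (\sum_(i <- r) y i) = \sum_(i <- r) dotp x (y i).
Proof.
elim: r => [|i r IH]; last by rewrite !big_cons dotpDr IH.
by rewrite !big_nil /dotp big1// => k _; rewrite mxE mulr0.
Qed.

Lemma dotp_crd (w : 'M[R]_d) (v x : 'rV[R]_d) : row_free w ->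
  dotp v x = \sum_j crd w x j * dotp v (row j w).
Proof.
move=> wf; rewrite {1}(rowE_crd x wf) dotp_sumr.
by apply: eq_bigr => j _; rewrite dotpZr.
Qed.

Lemma dotp_lat s m :
  dotp s (map_mx intr m) = dotp (rpart s) (lat m) +i* dotp (ipart s) (lat m).
Proof.
rewrite /dotp [RHS]complexE/= !raddf_sum/= mulr_sumr -big_split/=.
apply: eq_bigr => k _; rewrite !mxE.
have -> : (m 0 k)%:~R = ((m 0 k)%:~R : R)%:C by rewrite rmorph_int.
by rewrite [in LHS](complexE (s 0 k)) !rmorphM; ring.
Qed.

Lemma nc_char s m : nc (char s m) = expR (- (2 * pi * dotp (ipart s) (lat m))).
Proof. by rewrite /char nc_cexp dotp_lat/= mul0r sub0r. Qed.

Lemma charD s m n : char s (m + n) = char s m * char s n.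
Proof. by rewrite /char -cexpD -mulrDr -dotpDr map_mxD. Qed.

Lemma char0 s : char s 0 = 1.
Proof.
rewrite /char map_mx0 (_ : dotp s 0 = 0) ?mulr0 ?cexp0//.
by rewrite /dotp big1// => k _; rewrite mxE mulr0.
Qed.

Lemma charN s m : char (- s) m = char s (- m).
Proof. by rewrite /char map_mxN dotpNl dotpNr. Qed.

Lemma char_sum s (I : Type) (r : seq I) (P : pred I) (y : I -> 'rV[int]_d) :
  char s (\sum_(i <- r | P i) y i) = \prod_(i <- r | P i) char s (y i).
Proof.
by apply: (big_morph (char s)) => [m n|]; [exact: charD|exact: char0].
Qed.

Lemma char_line b v m t : cdiff (fun t => char (b + t *: v) m) t.
Proof.
apply: (@cdiff_comp _ cexp
  (fun t => (0 +i* (2 * pi)) * dotp (b + t *: v) (map_mx intr m))).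
  rewrite (_ : (fun t => _) = fun t => (0 +i* (2 * pi)) *
     (dotp b (map_mx intr m) + t * dotp v (map_mx intr m))).
    apply: cdiffM; first exact: cdiff_cst.
    apply: cdiffD; first exact: cdiff_cst.
    by apply: cdiffM; [exact: cdiff_id|exact: cdiff_cst].
  by apply/funext => u; rewrite dotpDl dotpZl.
exact: cdiff_cexp.
Qed.

Lemma ipartD s t : ipart (s + t) = ipart s + ipart t.
Proof. by apply/rowP => k; rewrite !mxE raddfD. Qed.

Definition ri (x y : 'rV[R]_d) : 'rV[R[i]]_d := \row_k (x 0 k +i* y 0 k).

Lemma rpart_ri x y : rpart (ri x y) = x.
Proof. by apply/rowP => k; rewrite !mxE. Qed.

Lemma ipart_ri x y : ipart (ri x y) = y.
Proof. by apply/rowP => k; rewrite !mxE. Qed.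

Lemma ri_parts s : s = ri (rpart s) (ipart s).
Proof. by apply/rowP => k; rewrite !mxE; case: (s 0 k). Qed.

End Characters.

Section Tube.
Context {R : realType} {d : nat}.
Local Open Scope complex_scope.
Variables (p : R) (w : 'M[R]_d).
Hypotheses (p1 : 1 <= p) (wf : row_free w).
Local Notation omega := (solid_angle p (cone_of w)).
Local Notation kappa := (@kappa R d p).
Implicit Types (s : 'rV[R[i]]_d) (m : 'rV[int]_d).

Definition beta s j : R := dotp (ipart s) (row j w).

Definition tube : set 'rV[R[i]]_d := [set s | forall j, 0 < beta s j].

Lemma dotp_beta s x : dotp (ipart s) x = \sum_j crd w x j * beta s j.
Proof. exact: dotp_crd. Qed.

(** A linear form is positive on the nonzero points of the cone as soon as it is positive on the
    generators. *)
Lemma series_domainE : series_domain (cone_of w) = tube.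
Proof.
apply/seteqP; split=> s /= H.
  move=> j; rewrite /beta.
  have nz : row j w != 0.
    apply/eqP => r0; have := crd_row j j wf; rewrite eqxx r0 /crd mul0mx mxE.
    by move/esym/eqP; rewrite oner_eq0.
  have := H (row j w); rewrite dotpNl oppr_lt0; apply=> //.
  by apply/(cone_ofP _ wf) => k; rewrite crd_row.
move=> x /(cone_ofP _ wf) x0 xn0; rewrite dotpNl oppr_lt0 dotp_beta.
have [j xj] : exists j, crd w x j != 0.
  apply: contrapT => h; move/eqP: xn0; apply.
  rewrite (rowE_crd x wf) big1// => j _.
  suff -> : crd w x j = 0 by rewrite scale0r.
  by apply/eqP/negPn/negP => hj; apply: h; exists j.
rewrite (bigD1 j)//= ltr_pwDl//.
  by rewrite mulr_gt0// lt_def xj x0.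
by apply: sumr_ge0 => k _; rewrite mulr_ge0// ltW.
Qed.

(** It lets the series run over all lattice points, so that multiplying it by a character is a plain
    reindexing. *)
Lemma omega_out x : ~ (forall j, 0 <= crd w x j) -> omega x = 0.
Proof.
move=> H; have [j hj] : exists j, crd w x j < 0.
  apply: contrapT => h; apply: H => j; rewrite leNgt; apply/negP => hj.
  by apply: h; exists j.
rewrite solid_angleE// (_ : (fun _ => _) = fun=> 0).
  by rewrite /gint; under eq_Rintegral do rewrite mul0r; rewrite Rintegral_cst// mul0r.
apply/funext => z; rewrite (bigD1 j)//= /tangent lt_eqF// /heaviside leNgt hj.
by rewrite mul0r.
Qed.

Definition term s m : R[i] := (omega (lat m))%:C * char s m.

Lemma solid_angle_seriesE s :
  solid_angle_series p (cone_of w) s = summability.sum (term s).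
Proof.
rewrite /solid_angle_series; congr summability.sum; apply/funext => m.
rewrite patchE; case: ifPn => //; rewrite notin_setE => /= h.
by rewrite /term omega_out ?mul0r// => h'; apply: h; exact/cone_ofP.
Qed.

Lemma nc_term s m : nc (term s m) = omega (lat m) * expR (- (2 * pi * dotp (ipart s) (lat m))).
Proof.
by rewrite /term ComplexField.Normc.normcM nc_char nc_real ger0_norm ?omega_ge0.
Qed.

Lemma sum_nc_term s (A : {fset 'rV[int]_d}) : tube s ->
  \sum_(m <- A) nc (term s m) <=
  kappa * (cell_bound w * \prod_j (1 - expR (- (2 * pi * beta s j)))^-1).
Proof.
move=> hs; have b0 j : 0 < 2 * pi * beta s j by rewrite !mulr_gt0// ?pi_gt0// hs.
apply: (cone_sum_le wf) => // [|m h|m h]; first by rewrite ltW// kappa_gt0.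
  by rewrite nc_term omega_out ?mul0r.
rewrite nc_term; apply: ler_pM; rewrite ?omega_ge0 ?expR_ge0 ?omega_le//.
rewrite -expR_sum ler_expR sumrN lerN2 dotp_beta mulr_sumr.
by rewrite le_eqVlt; apply/orP; left; apply/eqP; apply: eq_bigr => j _; ring.
Qed.

Lemma series_usum s : tube s ->
  has_usum (term s) (solid_angle_series p (cone_of w) s).
Proof.
move=> hs; have [l hl] := abs_usum (fun A => sum_nc_term A hs).
by rewrite solid_angle_seriesE (has_usum_sum hl).
Qed.

End Tube.

(** * Cones with rational generators *)

Section FiniteBox.
Context {R : realType} {d : nat}.
Variable w : 'M[R]_d.
Hypothesis wf : row_free w.

Lemma lattice_box (M : R) : exists B : {fset 'rV[int]_d},
  forall m, (forall j, `|crd w (lat m) j| <= M) -> m \in B.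
Proof.
pose N := (Num.truncn (`|M| * basis_size w)).+1.
pose r (e : {ffun 'I_d -> 'I_(2 * N).+1}) : 'rV[int]_d :=
  \row_k ((e k : nat)%:Z - N%:Z).
exists [fset r e | e in {: {ffun 'I_d -> 'I_(2 * N).+1}}]%fset.
move=> m H; apply/imfsetP.
have hb k : `|m 0 k| <= N%:Z.
  rewrite -(ler_int R) intr_norm; have := coord_le wf k H; rewrite mxE => h.
  apply: le_trans h _; apply: (@le_trans _ _ (`|M| * basis_size w)).
    apply: ler_wpM2r; last exact: ler_norm.
    by rewrite /basis_size; apply: sumr_ge0 => i _; exact: sumr_ge0.
  by apply: ltW; exact: truncnS_gt.
exists [ffun k => inord (absz (m 0 k + N%:Z)%R)] => //.
apply/rowP => k; rewrite !mxE !ffunE; have := hb k; rewrite ler_norml.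
move: (m 0 k : int) => x b1.
have e1 : (absz (x + N%:Z)%R < (2 * N).+1)%N by clear r hb; lia.
rewrite inordK//; lia.
Qed.

End FiniteBox.

Section RationalCone.
Context {R : realType} {d : nat}.
Local Open Scope complex_scope.
Variables (p : R) (w : 'M[R]_d).
Hypotheses (p1 : 1 <= p) (wf : row_free w).
Variables (a : 'I_d -> R) (y : 'I_d -> 'rV[int]_d).
Hypotheses (a0 : forall j, 0 < a j) (ya : forall j, lat (y j) = a j *: row j w).
Implicit Types (s : 'rV[R[i]]_d) (m : 'rV[int]_d).

Definition yint (I : {set 'I_d}) : 'rV[int]_d := \sum_(j in I) y j.

Lemma lat_yint I : lat (yint I) = ysum w a I.
Proof.
rewrite /yint /ysum /lat.
have -> : map_mx intr (\sum_(j in I) y j) = \sum_(j in I) (map_mx intr (y j) : 'rV[R]_d).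
  apply: (big_morph (map_mx intr)) => [m n|]; last by rewrite map_mx0.
  by rewrite map_mxD.
by apply: eq_bigr => j _; exact: ya.
Qed.

Definition Qden s : R[i] := \prod_j (1 - char s (y j)).

Local Notation box m := (box_angle p w a (lat m)).

Lemma box_finite : exists B : {fset 'rV[int]_d}, forall m, m \notin B -> box m = 0.
Proof.
have [B HB] := lattice_box wf (\sum_j a j).
exists B => m mB; apply: contrapT => bm; move/negP: mB; apply; apply: HB => j.
have : 0 <= crd w (lat m) j <= a j.
  by apply: contrapT => /negP h; apply: bm; exact: (box_angle_out p1 wf a0 h).
move=> /andP[h1 h2]; rewrite ger0_norm//; apply: le_trans h2 _.
by rewrite (bigD1 j)//= lerDl sumr_ge0// => i _; rewrite ltW.
Qed.

(** Filtering down to the exact support makes the set invariant under the reflection in [Pnum_opp];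
    the set chosen by [cid] is an arbitrary superset. *)
Definition boxset : {fset 'rV[int]_d} :=
  [fset m in projT1 (cid box_finite) | box m != 0]%fset.

Lemma boxsetP m : (m \in boxset) = (box m != 0).
Proof.
rewrite !inE/=; case: eqP => [_|/eqP bm]; first by rewrite andbF.
rewrite andbT; case: cid => B /= HB; apply: contraR bm => /HB ->.
by rewrite eqxx.
Qed.

Definition Pnum s : R[i] := \sum_(m <- boxset) (box m)%:C * char s m.

Lemma Qden_expand s : Qden s = \sum_(I : {set 'I_d}) (-1) ^+ #|I| * char s (yint I).
Proof.
rewrite /Qden; under eq_bigr do rewrite addrC.
rewrite bigA_distr; apply: eq_bigr => I _.
rewrite (bigID (mem I))/= [X in _ * X]big1 ?mulr1; last by move=> j /negbTE ->.
rewrite (eq_bigr (fun j => -1 * char s (y j))); last by move=> j ->; rewrite mulN1r.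
by rewrite big_split/= prodr_const /yint char_sum.
Qed.

Lemma QP_tube s : tube w s ->
  Qden s * solid_angle_series p (cone_of w) s = Pnum s.
Proof.
move=> /(series_usum p1 wf) hs; set al := solid_angle_series _ _ _ in hs *.
(* [g I] is the series multiplied by one term of the expanded [Qden] and translated by [yint I]; at
   a fixed [m] the sum over [I] is the box angle times a character. *)
pose g (I : {set 'I_d}) m : R[i] :=
  ((-1) ^+ #|I| * char s (yint I)) * term p w s (m - yint I).
have hg I : has_usum (g I) (((-1) ^+ #|I| * char s (yint I)) * al).
  apply: has_usumZ.
  apply: (@has_usum_reindex _ _ (term p w s) al (fun m => m - yint I) (fun m => m + yint I)) => //.
    exact: subrK.
  exact: addrK.
have := has_usum_big (index_enum _) hg; rewrite -mulr_suml -Qden_expand.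
move=> h1; apply: (has_usum_unique h1).
rewrite (_ : (fun _ => _) = fun m => (box m)%:C * char s m).
  apply: has_usum_finite => m; rewrite boxsetP negbK => /eqP ->.
  by rewrite mul0r.
apply/funext => m; rewrite /box_angle raddf_sum/= mulr_suml; apply: eq_bigr => I _.
have e1 : char s m = char s (yint I) * char s (m - yint I).
  by rewrite -charD [yint I + _]addrC subrK.
rewrite e1 /g /term rmorphM rmorphXn rmorphN rmorph1 latD latN lat_yint.
by ring.
Qed.

Lemma Pnum_opp s : Pnum (- s) * char s (yint [set: 'I_d]) = Pnum s.
Proof.
rewrite /Pnum mulr_suml; pose h m := yint [set: 'I_d] - m.
have hK m : h (h m) = m by rewrite /h subKr.
have bh m : box (h m) = box m.
  by rewrite /h latD latN lat_yint; exact: box_angle_sym.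
have E : boxset = [fset h m | m in boxset]%fset.
  apply/fsetP => m; apply/idP/imfsetP => /= [mB|[n nB ->]].
    by exists (h m); rewrite ?hK// boxsetP bh -boxsetP.
  by rewrite boxsetP bh -boxsetP.
rewrite [in RHS]E [RHS]big_imfset; last by move=> m n _ _ mn; rewrite -[m]hK mn hK.
apply: eq_bigr => m _; rewrite bh -mulrA charN; congr (_ * _).
by rewrite -charD /h addrC.
Qed.

Lemma Qden_opp s : Qden (- s) * char s (yint [set: 'I_d]) = (-1) ^+ d * Qden s.
Proof.
rewrite /Qden /yint char_sum.
rewrite [X in _ * X](eq_bigl xpredT) => [|j]; last by rewrite inE.
have -> : (-1) ^+ d = \prod_(j < d) (-1 : R[i]) by rewrite prodr_const card_ord.
rewrite -!big_split/=.
apply: eq_bigr => j _; rewrite charN mulrBl mul1r -charD addNr char0.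
by rewrite mulN1r opprB.
Qed.

Lemma line_hol_QP b v t :
  cdiff (fun t => Qden (b + t *: v)) t /\ cdiff (fun t => Pnum (b + t *: v)) t.
Proof.
split.
  apply: cdiff_prod => j; apply: cdiffB; first exact: cdiff_cst.
  exact: char_line.
apply: cdiff_sum => m _; apply: cdiffM; first exact: cdiff_cst.
exact: char_line.
Qed.

End RationalCone.

(** * Identities between meromorphic functions *)

Section Identity.
Context {R : realType} {d : nat}.
Local Open Scope complex_scope.
Implicit Types (a b c z v : 'rV[R[i]]_d).

Lemma line_holB (f g : 'rV[R[i]]_d -> R[i]) U : line_hol f U -> line_hol g U ->
  line_hol (fun z => f z - g z) U.
Proof. by move=> hf hg b v t Ut; apply: cdiffB; [exact: hf|exact: hg]. Qed.

Lemma line_holM (f g : 'rV[R[i]]_d -> R[i]) U : line_hol f U -> line_hol g U ->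
  line_hol (fun z => f z * g z) U.
Proof. by move=> hf hg b v t Ut; apply: cdiffM; [exact: hf|exact: hg]. Qed.

Lemma line_holS (f : 'rV[R[i]]_d -> R[i]) U V : V `<=` U -> line_hol f U ->
  line_hol f V.
Proof. by move=> VU hf b v t /VU; exact: hf. Qed.

Lemma supnorm_tri a b c : supnorm (a - c) <= supnorm (a - b) + supnorm (b - c).
Proof. by apply: le_trans (supnormD _ _); rewrite addrA subrK. Qed.

Lemma meromorphic_ball (F : 'rV[R[i]]_d -> R[i]) a : meromorphic F ->
  exists r : R, exists g h : 'rV[R[i]]_d -> R[i],
  [/\ 0 < r, holomorphic_on [set z | supnorm (z - a) < r] g,
      holomorphic_on [set z | supnorm (z - a) < r] h,
      forall b (e : R), supnorm (b - a) < r -> 0 < e -> exists2 c, supnorm (c - b) < e & h c != 0 &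
      forall z, supnorm (z - a) < r -> h z != 0 -> F z = g z / h z].
Proof.
move=> /(_ a)[U [g [h [[Uo Ua] hg hh Uc Fgh]]]].
have /nbhs_supnormP[r r0 Hr] := open_nbhs_nbhs (conj Uo Ua).
exists r, g, h; split => //.
- by move=> z /Hr; exact: hg.
- by move=> z /Hr; exact: hh.
- move=> b e /Hr /Uc hb e0.
  have [c [hc bc]] : [set z | h z != 0] `&` [set c | supnorm (c - b) < e] !=set0.
    by apply: hb; apply/nbhs_supnormP; exists e.
  by exists c.
- by move=> z /Hr; exact: Fgh.
Qed.

Lemma neq0_near (h : 'rV[R[i]]_d -> R[i]) c : differentiable h c -> h c != 0 ->
  exists2 e : R, 0 < e & forall z, supnorm (z - c) < e -> h z != 0.
Proof.
move=> /holomorphic_cont H hc.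
have n0 : 0 < nc (h c).
  by rewrite lt_neqAle nc_ge0 eq_sym andbT; apply: contra hc => /eqP /ComplexField.Normc.eq0_normc ->.
have [e e0 He] := H (nc (h c) / 2) ltac:(lra).
exists e => // z /He; apply: contraTneq => ->.
by rewrite sub0r -ltNge; have := ncB 0 (h c); rewrite sub0r subr0 => ->; lra.
Qed.

Section Chain.
Variables (F P Q : 'rV[R[i]]_d -> R[i]).
Hypotheses (Fm : meromorphic F) (Ph : line_hol P setT) (Qh : line_hol Q setT).

(** At [a] itself the identity may fail, because [F] is arbitrary where its denominator vanishes.
    Asking for it on some ball in every neighbourhood of [a] is stable along segments. *)
Definition eq_near a := forall r : R, 0 < r -> exists c, exists2 rho : R,
  supnorm (c - a) < r /\ 0 < rho & forall z, supnorm (z - c) < rho -> Q z * F z = P z.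

(** Where [F = g / h], the identity on a small ball with [h] nonzero reads [g * Q = h * P]. Both
    sides are holomorphic, so this holds on the whole ball; near [b'] one divides by [h] on a ball
    where it does not vanish. *)
Lemma eq_near_ball a : exists2 r : R, 0 < r &
  forall b b', supnorm (b - a) < r -> supnorm (b' - a) < r -> eq_near b -> eq_near b'.
Proof.
have [r [g [h [r0 hg hh hd Fgh]]]] := meromorphic_ball a Fm.
exists r => // b b' br b'r Nb.
have [c [rho [cb rho0] Hc]] := Nb (r - supnorm (b - a)) ltac:(by rewrite subr_gt0).
have ca : supnorm (c - a) < r by have := supnorm_tri c b a; lra.
pose e := Num.min rho (r - supnorm (c - a)).
have e0 : 0 < e by rewrite lt_min rho0 subr_gt0.
have [c2 c2c hc2] := hd c e ca e0.
have c2a : supnorm (c2 - a) < r.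
  by have := supnorm_tri c2 c a; move: c2c; rewrite lt_min => /andP[]; lra.
have [e2 e20 He2] := neq0_near (hh _ c2a) hc2.
pose e3 := Num.min e2 (Num.min (rho - supnorm (c2 - c)) (r - supnorm (c2 - a))).
have e30 : 0 < e3.
  rewrite !lt_min e20 !subr_gt0 c2a andbT /=.
  by move: c2c; rewrite lt_min => /andP[].
have H0 z : supnorm (z - a) < r -> g z * Q z - h z * P z = 0.
  apply: (@line_hol_vanish _ _ (fun z => g z * Q z - h z * P z) a c2 r e3) => //.
    have [gl hl] := (holomorphic_line hg, holomorphic_line hh).
    apply: line_holB; apply: line_holM => //.
      exact: line_holS Qh.
    exact: line_holS Ph.
  move=> {}z; rewrite !lt_min => /andP[z1 /andP[z2 z3]].
  have za : supnorm (z - a) < r by have := supnorm_tri z c2 a; lra.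
  have zc : supnorm (z - c) < rho by have := supnorm_tri z c2 c; lra.
  have hz := He2 _ z1.
  by rewrite -Hc// (Fgh _ za hz); field.
move=> s s0; pose e4 := Num.min s (r - supnorm (b' - a)).
have e40 : 0 < e4 by rewrite lt_min s0 subr_gt0.
have [c' c'b hc'] := hd b' e4 b'r e40.
have [c's c'r] : supnorm (c' - b') < s /\ supnorm (c' - b') < r - supnorm (b' - a).
  by move: c'b; rewrite lt_min => /andP[].
have c'a : supnorm (c' - a) < r by have := supnorm_tri c' b' a; lra.
have [e5 e50 He5] := neq0_near (hh _ c'a) hc'.
exists c', (Num.min e5 (r - supnorm (c' - a))).
  by split => //; rewrite lt_min e50 subr_gt0.
move=> z; rewrite lt_min => /andP[z1 z2].
have za : supnorm (z - a) < r by have := supnorm_tri z c' a; lra.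
have hz := He5 _ z1; rewrite (Fgh _ za hz).
have /eqP := H0 z za; rewrite subr_eq0 => /eqP e1.
apply: (mulfI hz); rewrite -e1; by field.
Qed.

Lemma eq_near_all a z : eq_near a -> eq_near z.
Proof.
move=> Na; pose ga (t : R) := a + t%:C *: (z - a).
suff : eq_near (ga 1) by rewrite /ga scale1r addrC subrK.
apply: (locally_constant_segment (P := fun t => eq_near (ga t))); last first.
  by rewrite /ga scale0r addr0.
move=> t _; have [r r0 Hr] := eq_near_ball (ga t).
pose k := supnorm (z - a) + 1; have k0 : 0 < k by have := supnorm_ge0 (z - a); rewrite /k; lra.
exists (r / k); first by rewrite divr_gt0.
move=> u _ ut.
have h1 : supnorm (ga u - ga t) < r.
  have -> : ga u - ga t = (u - t)%:C *: (z - a).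
    by rewrite /ga opprD addrACA subrr add0r -scalerBl -raddfB.
  apply: le_lt_trans (supnormZ _ _) _; rewrite nc_real.
  apply: (@le_lt_trans _ _ (`|u - t| * k)).
    by apply: ler_wpM2l => //; rewrite /k; lra.
  by rewrite -ltr_pdivlMr.
have h2 : supnorm (ga t - ga t) < r by rewrite subrr supnorm0.
by split; exact: Hr.
Qed.

(** Near a regular point [Q * F - P] is holomorphic, so vanishing on the small ball given by
    [eq_near] forces it to vanish around [z]. *)
Lemma mero_identity a (r : R) z : 0 < r ->
  (forall y, supnorm (y - a) < r -> Q y * F y = P y) -> regular_at F z ->
  exists2 rho : R, 0 < rho & forall y, supnorm (y - z) < rho -> Q y * F y = P y.
Proof.
move=> r0 Ha [U Uo UF].
have Na : eq_near a by move=> s s0; exists a, r => //; rewrite subrr supnorm0.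
have /nbhs_supnormP[rho rho0 Hrho] := open_nbhs_nbhs Uo.
exists rho => // y yz; apply/eqP; rewrite -subr_eq0; apply/eqP.
have [c [e [cz e0] Hc]] := @eq_near_all a z Na rho rho0.
apply: (@line_hol_vanish _ _ (fun z => Q z * F z - P z) z c rho e) => //; last first.
  by move=> t /Hc ->; rewrite subrr.
have FU : line_hol F U by exact: holomorphic_line.
apply: line_holB; last exact: line_holS Ph.
by apply: line_holM; [exact: line_holS Qh|exact: line_holS FU].
Qed.

End Chain.

End Identity.

Section Dual.
Context {R : realType} {d : nat}.
Local Open Scope complex_scope.
Variable w : 'M[R]_d.
Hypothesis wf : row_free w.

Lemma dual_vector (c : 'I_d -> R) : exists u, forall j, dotp u (row j w) = c j.
Proof.
exists (invmx w *m \col_j c j)^T => j.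
have : (w *m (invmx w *m \col_j c j)) j 0 = c j.
  by rewrite mulmxA mulmxV ?mul1mx ?mxE// -row_free_unit.
by rewrite mxE => <-; apply: eq_bigr => k _; rewrite !mxE mulrC.
Qed.

Lemma betaD (s t : 'rV[R[i]]_d) j : beta w (s + t) j = beta w s j + beta w t j.
Proof. by rewrite /beta ipartD dotpDl. Qed.

Lemma beta_ri x y j : beta w (ri x y) j = dotp y (row j w).
Proof. by rewrite /beta ipart_ri. Qed.

Lemma beta_le (s : 'rV[R[i]]_d) j : `|beta w s j| <= supnorm s * basis_size w.
Proof.
apply: le_trans (ler_norm_sum _ _ _) _.
apply: (@le_trans _ _ (\sum_k supnorm s * `|w j k|)).
  apply: ler_sum => k _; rewrite normrM !mxE; apply: ler_wpM2r => //.
  by apply: le_trans (Im_le_nc _) (nc_le_supnorm _ _).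
rewrite -mulr_sumr; apply: ler_wpM2l; first exact: supnorm_ge0.
by rewrite /basis_size [leRHS](bigD1 j)//= lerDl sumr_ge0// => i _; exact: sumr_ge0.
Qed.

Lemma basis_size_ge0 : 0 <= basis_size w.
Proof. by rewrite /basis_size; apply: sumr_ge0 => i _; exact: sumr_ge0. Qed.

Lemma tube_ball : exists a, exists2 r : R, 0 < r & forall z, supnorm (z - a) < r -> tube w z.
Proof.
have [u Hu] := dual_vector (fun=> 1).
have k0 := basis_size_ge0.
exists (ri 0 u), (basis_size w + 1)^-1; first by rewrite invr_gt0; lra.
move=> z Hz j; rewrite -[z](subrK (ri 0 u)) betaD beta_ri Hu.
have : supnorm (z - ri 0 u) * (basis_size w + 1) < 1 by rewrite -ltr_pdivlMr ?mul1r//; lra.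
have := beta_le (z - ri 0 u) j; have := supnorm_ge0 (z - ri 0 u).
rewrite ler_norml => ? /andP[? _] ?; nra.
Qed.

End Dual.

Lemma avoid_finite (R : realType) (s : seq R) (dl : R) : 0 < dl ->
  exists2 t : R, 0 < t < dl & t \notin s.
Proof.
move=> dl0; suff [e /andP[e0 ed] He] : exists2 e : R, 0 < e <= dl &
    forall t, 0 < t < e -> t \notin s.
  exists (e / 2); first by apply/andP; split; lra.
  by apply: He; apply/andP; split; lra.
elim: s => [|x s [e /andP[e0 ed] He]]; first by exists dl; rewrite ?lexx ?dl0.
have [x0|x0] := ltP 0 x; last first.
  exists e; first by rewrite e0.
  move=> t te; rewrite inE negb_or He// andbT.
  by move: te => /andP[t0 _]; rewrite gt_eqF//; lra.
exists (Num.min e x); first by rewrite lt_min e0 x0 ge_min ed.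
move=> t /andP[t0]; rewrite lt_min => /andP[te tx].
by rewrite inE negb_or lt_eqF//= He// t0.
Qed.

(** * The functional equation for rational cones *)

Section RationalConclusion.
Context {R : realType} {d : nat}.
Local Open Scope complex_scope.
Variables (p : R) (w : 'M[R]_d).
Hypotheses (p1 : 1 <= p) (wf : row_free w).
Variables (a : 'I_d -> R) (y : 'I_d -> 'rV[int]_d).
Hypotheses (a0 : forall j, 0 < a j) (ya : forall j, lat (y j) = a j *: row j w).

(** A factor vanishes only if its character has modulus 1. Along the imaginary direction [u] the
    exponent of that modulus is affine in [t] with slope proportional to [a j], hence zero for a
    single [t]. *)
Lemma Qden_direction (u : 'rV[R]_d) (z : 'rV[R[i]]_d) (t : R) :
  (forall j, dotp u (row j w) = 1) ->
  t \notin [seq - dotp (ipart z) (lat (y j)) / a j | j <- enum 'I_d] ->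
  Qden y (z + t%:C *: ri 0 u) != 0.
Proof.
move=> hu ht; apply/prodf_neq0 => j _; rewrite subr_eq0.
apply: contra ht => /eqP/(congr1 (fun z => nc z)).
have -> : nc (1 : R[i]) = expR 0 by rewrite (nc_real 1) normr1 expR0.
rewrite nc_char => /expR_inj/eqP.
have -> : ipart (z + t%:C *: ri 0 u) = ipart z + t *: u.
  apply/rowP => k; rewrite !mxE; case: (z 0 k) => ? ? /=.
  by rewrite mul0r addr0.
rewrite dotpDl dotpZl ya !dotpZr hu mulr1 => h1.
apply/mapP; exists j; first by rewrite mem_enum.
have aj := a0 j; have pi0 := pi_gt0 R.
have h : a j * dotp (ipart z) (row j w) + t * a j = 0.
  by move: h1; rewrite eq_sym oppr_eq0 mulf_eq0 => /orP[|/eqP//]; rewrite gt_eqF//; lra.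
rewrite ya dotpZr; apply: (mulIf (lt0r_neq0 aj)); rewrite divfK ?gt_eqF//; lra.
Qed.

Lemma regular_reflect (F : 'rV[R[i]]_d -> R[i]) z :
  regular_at (fun s => F (- s)) z -> regular_at F (- z).
Proof.
move=> [U [Uo Uz] UF]; exists [set s | U (- s)].
  split; last by rewrite /= opprK.
  by apply: open_comp Uo => x _; exact: opp_continuous.
move=> s /= Us; have -> : F = (fun s => F (- s)) \o -%R by apply/funext => x /=; rewrite opprK.
apply: differentiable_comp; last exact: UF.
exact: linear_differentiable opp_continuous.
Qed.

Lemma regular_signr (F : 'rV[R[i]]_d -> R[i]) n z :
  regular_at (fun s => (-1) ^+ n * F s) z -> regular_at F z.
Proof.
move=> [U Uo UF]; exists U => // s Us.
have -> : F = (fun s => (-1) ^+ n *: ((-1) ^+ n * F s : R[i]^o)).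
  by apply/funext => x; rewrite /GRing.scale/= mulrA -signr_odd -expr2 sqrr_sign mul1r.
by apply: differentiableZ; exact: UF.
Qed.

Lemma rational_case (F : 'rV[R[i]]_d -> R[i]) : is_solid_angle_gf p (cone_of w) F ->
  mero_eq (fun s => F (- s)) (fun s => (-1) ^+ d * F s).
Proof.
move=> [Fm Fs] z rF1 rF2; have [b [r r0 Hb]] := tube_ball wf.
pose P := Pnum p1 wf a0; pose Q : 'rV[R[i]]_d -> R[i] := Qden y.
have P0 : line_hol P setT.
  by move=> b' v t _; have [] := line_hol_QP p1 wf y a0 b' v t.
have Q0 : line_hol Q setT.
  by move=> b' v t _; have [] := line_hol_QP p1 wf y a0 b' v t.
have FQP x : supnorm (x - b) < r -> Q x * F x = P x.
  by move=> /Hb tx; rewrite Fs ?series_domainE//; exact: QP_tube.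
have [rho1 rho10 H1] := mero_identity Fm P0 Q0 r0 FQP (regular_signr rF2).
have [rho2 rho20 H2] := mero_identity Fm P0 Q0 r0 FQP (regular_reflect rF1).
have [[U1 /open_nbhs_nbhs/nbhs_supnormP[e1 e10 He1] UF1] [U2 /open_nbhs_nbhs/nbhs_supnormP[e2 e20 He2] UF2]] := (rF1, rF2).
pose rho := Num.min (Num.min rho1 rho2) (Num.min e1 e2).
have rho0 : 0 < rho by rewrite !lt_min rho10 rho20 e10.
have rhoP x : supnorm (x - z) < rho ->
  [/\ Q x * F x = P x, Q (- x) * F (- x) = P (- x), U1 x & U2 x].
  rewrite !lt_min => /andP[/andP[h1 h2] /andP[h3 h4]]; split.
  - exact: H1.
  - by apply: H2; rewrite -opprD supnormN.
  - exact: He1.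
  - exact: He2.
pose G x := F (- x) - (-1) ^+ d * F x.
have Gl : line_hol G [set x | supnorm (x - z) < rho].
  apply: line_holB.
    by apply: holomorphic_line => x /rhoP[_ _ ? _]; exact: UF1.
  by apply: holomorphic_line => x /rhoP[_ _ _ ?]; exact: UF2.
have G0 x : supnorm (x - z) < rho -> Q x != 0 -> G x = 0.
  move=> /rhoP[h1 h2 _ _] qx; have c0 := cexp_neq0 ((0 +i* (2 * pi)) * dotp x (map_mx intr (yint y [set: 'I_d]))).
  have e3 := Qden_opp y x; have e4 := Pnum_opp p1 wf a0 ya x.
  rewrite -/(Q _) -/(Q _) -/(P _) -/(P _) in e3 e4.
  have e5 : (-1) ^+ d * Q x * F (- x) = Q x * F x.
    by rewrite -e3 h1 -e4 -h2; ring.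
  have e6 : ((-1) ^+ d * (-1) ^+ d : R[i]) = 1 by rewrite -signr_odd -expr2 sqrr_sign.
  apply: (mulfI qx); rewrite mulr0 /G mulrBr.
  apply/eqP; rewrite subr_eq0; apply/eqP.
  by rewrite mulrCA -e5 !mulrA e6 mul1r.
(* [Q] may vanish at [z]. On the complex line through [z] in direction [v] it is nonzero at some
   small real [t], so [G] vanishes near that parameter and, by continuation along the line, at
   [z]. *)
have [u hu] := dual_vector wf (fun=> 1); pose v := ri 0 u : 'rV[R[i]]_d.
pose k := supnorm v + 1; have k0 : 0 < k by have := supnorm_ge0 v; rewrite /k; lra.
have zt t : nc t < rho / k -> supnorm (z + t *: v - z) < rho.
  rewrite ltr_pdivlMr// => h; rewrite addrC addKr.
  apply: le_lt_trans (supnormZ _ _) _; apply: le_lt_trans h.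
  by apply: ler_wpM2l; [exact: nc_ge0|rewrite /k; lra].
have [t /andP[t0 tr] ht] := avoid_finite
  [seq - dotp (ipart z) (lat (y j)) / a j | j <- enum 'I_d] (divr_gt0 rho0 k0).
have Qt : Q (z + t%:C *: v) != 0 by exact: Qden_direction.
have /(cdiff_cont)  Qc : cdiff (fun t => Q (z + t *: v)) t%:C by exact: Q0.
have n0 : 0 < nc (Q (z + t%:C *: v)).
  rewrite lt_neqAle nc_ge0 eq_sym andbT.
  by apply: contra Qt => /eqP /ComplexField.Normc.eq0_normc ->.
have [dl dl0 Hdl] := Qc (nc (Q (z + t%:C *: v)) / 2) ltac:(lra).
have [||s s0 Hs] := @unique_continuation_segment R (fun t => G (z + t *: v)) t%:C 0.
- move=> s /andP[s0 s1]; exists (rho / k - t); first by rewrite subr_gt0.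
  move=> x Hx; apply: Gl; apply: zt.
  rewrite -[x](subrK (t%:C + s%:C * (0 - t%:C))).
  apply: le_lt_trans (le_normcD _ _) _.
  have -> : t%:C + s%:C * (0 - t%:C) = ((1 - s) * t)%:C.
    by rewrite rmorphM rmorphB rmorph1; ring.
  move: Hx; rewrite nc_real ger0_norm; last by rewrite mulr_ge0// ?subr_ge0// ltW.
  have : (1 - s) * t <= t by nra.
  have -> : t%:C + s%:C * (0 - t%:C) = ((1 - s) * t)%:C.
    by rewrite rmorphM rmorphB rmorph1; ring.
  lra.
- exists (Num.min dl (rho / k - t)); first by rewrite lt_min dl0 subr_gt0.
  move=> x; rewrite lt_min => /andP[x1 x2]; apply: G0.
    apply: zt; rewrite -[x](subrK t%:C); apply: le_lt_trans (le_normcD _ _) _.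
    by rewrite nc_real ger0_norm ?ltW//; lra.
  have := Hdl _ x1; rewrite subrKC.
  apply: contraTneq => ->; rewrite -ltNge ncB subr0; lra.
have := Hs 0; rewrite subrr ComplexField.Normc.normc0 => /(_ s0).
by rewrite scale0r addr0 => /eqP; rewrite subr_eq0 => /eqP.
Qed.

End RationalConclusion.

(** * Limits of exponential sums *)

Section ExponentialSums.
Context {R : realType}.
Local Open Scope complex_scope.

Definition cis (y : R) : R[i] := cexp (0 +i* y).

Lemma cisD x y : cis (x + y) = cis x * cis y.
Proof. by rewrite /cis -cexpD; congr cexp; apply/eqP; rewrite eq_complex /= addr0 !eqxx. Qed.

Lemma cis0 : cis 0 = 1.
Proof. by rewrite /cis -[RHS]cexp0. Qed.

Lemma nc_cis y : nc (cis y) = 1.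
Proof. by rewrite nc_cexp expR0. Qed.

Lemma cisX y n : cis y ^+ n = cis (n%:R * y).
Proof.
elim: n => [|n IH]; first by rewrite mul0r cis0.
by rewrite exprS IH -cisD -natr1 mulrDl mul1r addrC.
Qed.

Lemma imag_mulr (a x : R) : (0 +i* a) * x%:C = 0 +i* (a * x).
Proof. by apply/eqP; rewrite eq_complex /= mul0r mulr0 subr0 mul0r add0r !eqxx. Qed.

(** Near 0 the linear term comes from differentiability with error [e]; beyond [dl] the crude bound
    by 2 plus the modulus of [y] is absorbed in the quadratic term. *)
Lemma cis_taylor (e : R) : 0 < e -> exists2 C : R, 0 <= C &
  forall y, nc (cis y - 1 - (0 +i* y)) <= e * `|y| + C * y ^+ 2.
Proof.
move=> e0; have [dl dl0 H] := cexp_small e0.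
exists (2 / dl ^+ 2 + dl^-1).
  by rewrite addr_ge0 ?divr_ge0 ?invr_ge0 ?exprn_ge0// ltW.
move=> y; have [] := ltP `|y| dl => ydl.
  apply: (@le_trans _ _ (e * `|y|)); last first.
    by rewrite lerDl mulr_ge0 ?sqr_ge0// addr_ge0 ?divr_ge0 ?invr_ge0 ?exprn_ge0// ltW.
  by have := H (0 +i* y); rewrite nc_imag; apply.
apply: (@le_trans _ _ (2 + `|y|)).
  apply: le_trans (le_normcD _ _) _; rewrite normcN nc_imag lerD2r.
  apply: le_trans (le_normcD _ _) _; rewrite normcN nc_cis (nc_real 1) normr1.
  by rewrite -[2]/(1 + 1).
have -> : y ^+ 2 = `|y| ^+ 2 by rewrite real_normK// num_real.
set z := `|y| in ydl *; have z0 : 0 < z by exact: lt_le_trans ydl.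
apply: (@le_trans _ _ ((2 / dl ^+ 2 + dl^-1) * z ^+ 2)); last first.
  by rewrite lerDr mulr_ge0// ltW.
rewrite mulrDl lerD//.
  rewrite -mulrA ler_peMr// mulrC ler_pdivlMr ?exprn_gt0// mul1r.
  by rewrite lerXn2r// nnegrE ltW.
by rewrite expr2 mulrA ler_peMl ?(ltW z0)// mulrC ler_pdivlMr// mul1r.
Qed.

(** Factor the difference of the [n.+1]-st powers of [cis z] and [1 + i z], where [z = y / n.+1].
    The [n.+1] terms of the cofactor are at most [expR] of the modulus of [y], and the remaining
    factor is estimated by [cis_taylor]. *)
Lemma cis_power_bound (e : R) : 0 < e -> exists2 C : R, 0 <= C &
  forall n y, nc (cis y - (1 + (0 +i* (y / n.+1%:R))) ^+ n.+1) <=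
    expR `|y| * (e * `|y| + C * y ^+ 2 / n.+1%:R).
Proof.
move=> e0; have [C C0 HC] := cis_taylor e0; exists C => // n y.
have n0 : (0 : R) < n.+1%:R by rewrite ltr0n.
set z := y / n.+1%:R; have yE : y = n.+1%:R * z by rewrite /z mulrC divfK// gt_eqF.
have yN : `|y| = n.+1%:R * `|z| by rewrite [in LHS]yE normrM gtr0_norm.
rewrite [in cis y]yE -cisX subrXX ComplexField.Normc.normcM mulrC.
have b1 : nc (1 + (0 +i* z)) <= expR `|z|.
  apply: le_trans (le_normcD _ _) _; rewrite (nc_real 1) normr1 nc_imag.
  exact: expR_ge1Dx.
have h1 : nc (\sum_(i < n.+1) cis z ^+ (n.+1.-1 - i) * (1 + (0 +i* z)) ^+ i) <=
    n.+1%:R * expR `|y|.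
  rewrite -lecR -normr_nc; apply: le_trans (ler_norm_sum _ _ _) _.
  have -> : n.+1%:R * expR `|y| = \sum_(i < n.+1) expR `|y|.
    by rewrite sumr_const card_ord mulr_natl.
  rewrite raddf_sum; apply: ler_sum => i _.
  rewrite normrM !normrX !normr_nc nc_cis expr1n mul1r -rmorphXn lecR.
  apply: le_trans (lerXn2r _ _ _ b1) _; rewrite ?nnegrE ?nc_ge0 ?expR_ge0//.
  rewrite -expRM_natl ler_expR yN.
  by rewrite ler_wpM2r// ler_nat ltnW.
apply: le_trans (ler_pM (nc_ge0 _) (nc_ge0 _) h1 _) _.
  by rewrite opprD addrA; exact: HC.
rewrite le_eqVlt; apply/orP; left; apply/eqP; rewrite yN yE.
by field; rewrite gt_eqF.
Qed.

Lemma expR_ge_abs (s x : R) : 0 < s -> `|x| <= s^-1 * expR (s * `|x|).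
Proof.
move=> s0; rewrite ler_pdivlMl//.
by apply: le_trans (expR_ge1Dx _); rewrite lerDr.
Qed.

Lemma poly_growth (q : {poly R[i]}) (s : R) : 0 < s ->
  exists2 C : R, 0 <= C & forall x, nc q.[x%:C] <= C * expR (s * `|x|).
Proof.
elim/poly_ind: q s => [|q c IH] s s0.
  by exists 0 => // x; rewrite horner0 ComplexField.Normc.normc0 mul0r.
have s2 : 0 < s / 2 by lra.
have [C C0 HC] := IH _ s2; exists (C * (s / 2)^-1 + nc c).
  by rewrite addr_ge0 ?nc_ge0// mulr_ge0// invr_ge0 ltW.
move=> x; rewrite hornerMXaddC; apply: le_trans (le_normcD _ _) _.
rewrite mulrDl lerD//; last first.
  by rewrite ler_peMr ?nc_ge0// -expR0 ler_expR mulr_ge0// ltW.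
rewrite ComplexField.Normc.normcM nc_real.
have -> : expR (s * `|x|) = expR (s / 2 * `|x|) * expR (s / 2 * `|x|).
  by rewrite -expRD; congr expR; field.
rewrite mulrACA; apply: ler_pM => //; [exact: nc_ge0|exact: expR_ge_abs].
Qed.

Section Functional.
Variables (I : choiceType) (S : nat -> {fset I}) (A : nat -> I -> R) (X : I -> R).
Variables (r C : R).
Hypotheses (r0 : 0 < r) (A0 : forall n i, 0 <= A n i).
Hypothesis moment : forall n, \sum_(i <- S n) A n i * expR (r * `|X i|) <= C.
Implicit Types f g : R -> R[i].

Definition wsum n f : R[i] := \sum_(i <- S n) (A n i)%:C * f (X i).

(** These functions form a vector space. It is closed in the norm weighted by [e^(r |x|)], since
    [moment] bounds every [wsum n] by [C] times that norm, uniformly in [n]. *)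
Definition negligible_sum f : Prop := forall e : R, 0 < e -> exists N, forall n,
  (N <= n)%N -> nc (wsum n f) <= e.
Local Notation V := negligible_sum.

Lemma wsumD n f g : wsum n (fun x => f x + g x) = wsum n f + wsum n g.
Proof. by rewrite /wsum -big_split/=; apply: eq_bigr => i _; rewrite mulrDr. Qed.

Lemma wsumZ n k f : wsum n (fun x => k * f x) = k * wsum n f.
Proof. by rewrite /wsum mulr_sumr; apply: eq_bigr => i _; rewrite mulrCA. Qed.

Lemma wsum_le n f (K : R) : 0 <= K -> (forall x, nc (f x) <= K * expR (r * `|x|)) ->
  nc (wsum n f) <= K * C.
Proof.
move=> K0 H; rewrite -lecR -normr_nc; apply: le_trans (ler_norm_sum _ _ _) _.
rewrite (eq_bigr (fun i => (A n i * nc (f (X i)))%:C)); last first.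
  by move=> i _; rewrite normrM !normr_nc nc_real ger0_norm// rmorphM.
rewrite -raddf_sum lecR; apply: le_trans (ler_wpM2l K0 (moment n)).
by rewrite mulr_sumr; apply: ler_sum => i _; rewrite mulrCA ler_wpM2l.
Qed.

Lemma negligible_ext f g : f =1 g -> V f -> V g.
Proof. by move=> /funext ->. Qed.

Lemma negligible0 : V (fun=> 0).
Proof.
move=> e e0; exists 0 => n _; rewrite /wsum big1 => [|i _]; last by rewrite mulr0.
by rewrite ComplexField.Normc.normc0 ltW.
Qed.

Lemma negligibleD f g : V f -> V g -> V (fun x => f x + g x).
Proof.
move=> Vf Vg e e0; have e2 : 0 < e / 2 by lra.
have [n1 H1] := Vf _ e2; have [n2 H2] := Vg _ e2.
exists (maxn n1 n2) => n; rewrite geq_max => /andP[/H1 h1 /H2 h2].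
by rewrite wsumD; apply: le_trans (le_normcD _ _) _; lra.
Qed.

Lemma negligibleZ k f : V f -> V (fun x => k * f x).
Proof.
move=> Vf e e0; have k1 : 0 < nc k + 1 by have := nc_ge0 k; lra.
have [N HN] := Vf (e / (nc k + 1)) (divr_gt0 e0 k1); exists N => n /HN h.
rewrite wsumZ ComplexField.Normc.normcM.
apply: (@le_trans _ _ ((nc k + 1) * nc (wsum n f))).
  by apply: ler_wpM2r; [exact: nc_ge0|lra].
by rewrite mulrC -ler_pdivlMr.
Qed.

Lemma negligible_closed f :
  (forall e : R, 0 < e -> exists2 g, V g &
     forall x, nc (f x - g x) <= e * expR (r * `|x|)) -> V f.
Proof.
move=> H e e0; have C1 : 0 < `|C| + 1 by have := normr_ge0 C; lra.
pose e1 := e / 2 / (`|C| + 1); have e10 : 0 < e1 by rewrite !divr_gt0.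
have [g Vg Hg] := H _ e10; have e2 : 0 < e / 2 by lra.
have [N HN] := Vg _ e2; exists N => n /HN h.
rewrite (_ : f = fun x => (f x - g x) + g x); last by apply/funext => x; rewrite subrK.
rewrite wsumD; apply: le_trans (le_normcD _ _) _.
have := wsum_le n (ltW e10) Hg.
have : e1 * C <= e / 2.
  apply: (@le_trans _ _ (e1 * (`|C| + 1))); last by rewrite /e1 divfK ?gt_eqF.
  by apply: ler_wpM2l; [exact: ltW|have := ler_norm C; lra].
lra.
Qed.

(* A difference quotient in [t] multiplies the summand by [i x], up to an error
   that is small in the norm weighted by [e^(r |x|)]. *)
Lemma negligible_poly_near (dl : R) :
  (forall t, `|t - 1| < dl -> V (fun x => cis (t * x))) ->
  forall (q : {poly R[i]}) t, `|t - 1| < dl -> V (fun x => q.[x%:C] * cis (t * x)).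
Proof.
move=> H; elim/poly_ind => [|q c IH] t tdl.
  by apply: negligible_ext negligible0 => x; rewrite horner0 mul0r.
apply: (@negligible_ext (fun x => q.[x%:C] * x%:C * cis (t * x) + c * cis (t * x))).
  by move=> x; rewrite hornerMXaddC mulrDl.
apply: negligibleD; last exact: negligibleZ (H t tdl).
apply: negligible_closed => e e0.
(* Half of the exponential rate pays for [q], the other half for the factor [x] or [x^2] of the
   Taylor error. *)
have r2 : 0 < r / 2 by rewrite divr_gt0.
have [K K0 HK] := poly_growth q r2.
have [K2 K20 HK2] := poly_growth ('X : {poly R[i]}) r2.
have [K3 K30 HK3] := poly_growth ('X^2 : {poly R[i]}) r2.
pose e1 := e / 2 / (K * K2 + 1).
have e10 : 0 < e1 by rewrite !divr_gt0// ltr_wpDl// mulr_ge0.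
have [C1 C10 HC1] := cis_taylor e10.
(* The first bound keeps [t + hh] in the range of the hypothesis. The second makes the quadratic
   part of the error at most [e / 2]; the linear part is handled by [e1]. *)
pose hh := Num.min ((dl - `|t - 1|) / 2) (e / 2 / (K * K3 * C1 + 1)).
have h0 : 0 < hh.
  rewrite lt_min !divr_gt0 ?subr_gt0//=.
  by rewrite ltr_wpDl// !mulr_ge0.
have tdl' : `|t + hh - 1| < dl.
  have : hh <= (dl - `|t - 1|) / 2 by rewrite ge_min lexx.
  by rewrite addrAC => ?; apply: le_lt_trans (ler_normD _ _) _; rewrite (gtr0_norm h0); lra.
exists (fun x => (0 +i* hh)^-1 * (q.[x%:C] * cis ((t + hh) * x)) +
                 - (0 +i* hh)^-1 * (q.[x%:C] * cis (t * x))).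
  by apply: negligibleD; apply: negligibleZ; exact: IH.
move=> x; set i := (0 +i* hh).
have i0 : i != 0 by rewrite eq_complex /= eqxx/= gt_eqF.
have -> : q.[x%:C] * x%:C * cis (t * x) - (i^-1 * (q.[x%:C] * cis ((t + hh) * x)) +
    - i^-1 * (q.[x%:C] * cis (t * x))) =
   - (i^-1 * (q.[x%:C] * cis (t * x)) * (cis (hh * x) - 1 - i * x%:C)).
  by rewrite mulrDl cisD; field.
rewrite imag_mulr.
have n1 : nc (- (i^-1 * (q.[x%:C] * cis (t * x)) * (cis (hh * x) - 1 - (0 +i* (hh * x))))) =
   hh^-1 * nc q.[x%:C] * nc (cis (hh * x) - 1 - (0 +i* (hh * x))).
  move: (nc_cis (t * x)); move: (cis (t * x)) (cis (hh * x)) => c1 c2 hc.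
  rewrite normcN !ComplexField.Normc.normcM hc mulr1 ComplexField.Normc.normcV.
  by rewrite nc_imag gtr0_norm.
rewrite n1.
have b1 := HK x; have b2 := HK2 x; have b3 := HK3 x.
rewrite hornerX nc_real in b2; rewrite hornerXn -rmorphXn nc_real in b3.
have b4 := HC1 (hh * x).
set E := expR (r / 2 * `|x|) in b1 b2 b3.
have EE : expR (r * `|x|) = E * E by rewrite /E -expRD; congr expR; field.
have E0 : 0 < E by exact: expR_gt0.
have e1E : e1 * (K * K2 + 1) = e / 2.
  by rewrite /e1 divfK// gt_eqF// ltr_wpDl// mulr_ge0.
have hE : hh * (K * K3 * C1 + 1) <= e / 2.
  by rewrite -ler_pdivlMr ?ltr_wpDl ?mulr_ge0// ge_min lexx orbT.
clearbody e1 E; clear tdl'; rewrite {}/i in i0 n1 *; clearbody hh.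
have [e1' h0'] := (ltW e10, ltW h0).
have q0 := nc_ge0 q.[x%:C].
rewrite EE; apply: (@le_trans _ _ (hh^-1 * nc q.[x%:C] * (e1 * `|hh * x| + C1 * (hh * x) ^+ 2))).
  by apply: ler_wpM2l => //; rewrite mulr_ge0// invr_ge0 ltW.
have -> : hh^-1 * nc q.[x%:C] * (e1 * `|hh * x| + C1 * (hh * x) ^+ 2) =
   nc q.[x%:C] * (e1 * `|x| + C1 * hh * `|x ^+ 2|).
  rewrite normrM (gtr0_norm h0) (ger0_norm (sqr_ge0 x)); field.
  by rewrite gt_eqF.
apply: (@le_trans _ _ ((K * E) * (e1 * (K2 * E) + C1 * hh * (K3 * E)))).
  apply: ler_pM => //.
    by apply: addr_ge0; rewrite !mulr_ge0.
  apply: lerD; first exact: ler_wpM2l.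
  by rewrite ler_wpM2l ?mulr_ge0.
have -> : K * E * (e1 * (K2 * E) + C1 * hh * (K3 * E)) =
   (e1 * (K * K2) + hh * (K * K3 * C1)) * (E * E) by ring.
apply: ler_wpM2r; first by rewrite mulr_ge0// ltW.
have := mulr_ge0 K0 K20; have := mulr_ge0 (mulr_ge0 K0 K30) C10.
nra.
Qed.

(* In the norm weighted by [e^(r |x|)], [cis (u * x)] is the limit of the
   polynomials [(1 + i u x / n)^n]. *)
Lemma negligible_poly_shift (t u : R) : `|u| <= r / 4 ->
  (forall q : {poly R[i]}, V (fun x => q.[x%:C] * cis (t * x))) ->
  forall q : {poly R[i]}, V (fun x => q.[x%:C] * cis ((t + u) * x)).
Proof.
move=> ur H q; apply: negligible_closed => e e0.
(* The rate [r] is split into quarters: one for [q], one for the factor [expR] of [|u x|], one for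
   [x] or [x^2], and one to spare. *)
have r4 : 0 < r / 4 by rewrite divr_gt0.
have [K K0 HK] := poly_growth q r4.
have [K2 K20 HK2] := poly_growth ('X : {poly R[i]}) r4.
have [K3 K30 HK3] := poly_growth ('X^2 : {poly R[i]}) r4.
pose k1 := K * `|u| * K2 + 1; have k10 : 0 < k1 by rewrite ltr_wpDl// !mulr_ge0.
have e10 : 0 < e / 2 / k1 by rewrite !divr_gt0.
have [C1 C10 HC1] := cis_power_bound e10.
set e1 := e / 2 / k1 in e10 HC1.
have e1E : e1 * k1 = e / 2 by rewrite /e1 divfK// gt_eqF.
clearbody e1; have e1' := ltW e10.
pose k2 := K * C1 * u ^+ 2 * K3.
have u2 := sqr_ge0 u.
have k20 : 0 <= k2 by do !apply: mulr_ge0 => //.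
pose n := Num.truncn (k2 / (e / 2)).
have nE : k2 / n.+1%:R <= e / 2.
  have := truncnS_gt (k2 / (e / 2)); rewrite -/n ltr_pdivrMr ?divr_gt0// => h.
  by rewrite ler_pdivrMr ?ltr0n// mulrC ltW.
exists (fun x => (q * (1 + (0 +i* (u / n.+1%:R)) *: 'X) ^+ n.+1).[x%:C] * cis (t * x)).
  exact: H.
move=> x; rewrite hornerM horner_exp hornerD hornerZ hornerX hornerC imag_mulr.
rewrite [(t + u) * x]mulrDl cisD [u / _ * x]mulrAC.
move: (HC1 n (u * x)) (nc_cis (t * x)).
move: (cis (t * x)) (cis (u * x)) => c1 c2; set b := (X in nc (_ - X)) => h hc.
have -> : q.[x%:C] * (c1 * c2) - q.[x%:C] * b * c1 = q.[x%:C] * c1 * (c2 - b) by ring.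
rewrite !ComplexField.Normc.normcM hc mulr1.
have b1 := HK x; have b2 := HK2 x; have b3 := HK3 x.
rewrite hornerX nc_real in b2; rewrite hornerXn -rmorphXn nc_real in b3.
set E := expR (r / 4 * `|x|) in b1 b2 b3.
have E1 : 1 <= E by rewrite /E -[leLHS]expR0 ler_expR mulr_ge0// ltW.
have EE : expR (r * `|x|) = E * E * E * E by rewrite /E -!expRD; congr expR; field.
have Eu : expR `|u * x| <= E by rewrite ler_expR normrM ler_wpM2r.
have [x2 ux2] := (sqr_ge0 x, sqr_ge0 (u * x)); have n0 : (0 : R) <= n.+1%:R^-1 by rewrite invr_ge0.
have h2 : nc (c2 - b) <= E * ((e1 * `|u| * K2 + C1 * u ^+ 2 * K3 / n.+1%:R) * E).
  apply: le_trans h _; apply: ler_pM => //.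
    by apply: addr_ge0; do !apply: mulr_ge0 => //.
  have -> : (e1 * `|u| * K2 + C1 * u ^+ 2 * K3 / n.+1%:R) * E =
    e1 * `|u| * (K2 * E) + C1 * u ^+ 2 / n.+1%:R * (K3 * E) by ring.
  have -> : e1 * `|u * x| + C1 * (u * x) ^+ 2 / n.+1%:R =
    e1 * `|u| * `|x| + C1 * u ^+ 2 / n.+1%:R * `|x ^+ 2|.
    by rewrite normrM (ger0_norm x2); ring.
  apply: lerD; apply: ler_wpM2l => //; do !apply: mulr_ge0 => //.
apply: le_trans (ler_pM (nc_ge0 _) (nc_ge0 _) b1 h2) _.
rewrite EE.
have -> : K * E * (E * ((e1 * `|u| * K2 + C1 * u ^+ 2 * K3 / n.+1%:R) * E)) =
  (e1 * (K * `|u| * K2) + k2 / n.+1%:R) * (E * E * E).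
  by rewrite /k2; ring.
have E3 : 0 <= E * E * E by rewrite !mulr_ge0 ?expR_ge0.
apply: (@le_trans _ _ (e * (E * E * E))).
  apply: ler_wpM2r => //.
  have e5 : e1 * (K * `|u| * K2) + e1 = e / 2 by rewrite -e1E mulrDr mulr1.
  move: nE; set a := k2 / _; move: e5; set b5 := e1 * _; lra.
rewrite [leRHS]mulrC -[leLHS]mul1r [leRHS](_ : _ = E * (e * (E * E * E))); last by ring.
by apply: ler_wpM2r => //; rewrite mulr_ge0// ltW.
Qed.

(** The shift step needs all polynomial multiples at a single [t] and returns them at [t + u]; so
    from [t = 1] it can be iterated [N] times with [u = - N^-1] to reach [t = 0]. *)
Lemma negligible_mass (dl : R) : 0 < dl ->
  (forall t, `|t - 1| < dl -> V (fun x => cis (t * x))) -> V (fun=> 1).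
Proof.
move=> dl0 H.
have P1 : forall q : {poly R[i]}, V (fun x => q.[x%:C] * cis (1 * x)).
  by move=> q; apply: (negligible_poly_near H); rewrite subrr normr0.
pose N := (Num.truncn (4 / r)).+1; have N0 : (0 : R) < N%:R by rewrite ltr0n.
have st : `|- N%:R^-1| <= r / 4.
  rewrite normrN gtr0_norm ?invr_gt0// -div1r ler_pdivrMr//.
  have : 4 / r < N%:R by exact: truncnS_gt.
  by rewrite ltr_pdivrMr// mulrC; lra.
have Pk k : forall q : {poly R[i]}, V (fun x => q.[x%:C] * cis ((1 - k%:R / N%:R) * x)).
  elim: k => [|k IH] q; first by rewrite mul0r subr0.
  have := negligible_poly_shift st IH q; apply: negligible_ext => x.
  have -> : (k.+1%:R : R) / N%:R = k%:R / N%:R + N%:R^-1 by rewrite -natr1 mulrDl mul1r.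
  by rewrite opprD addrA.
have := Pk N 1; apply: negligible_ext => x.
by rewrite divff ?gt_eqF// subrr mul0r cis0 hornerC mulr1.
Qed.

End Functional.
End ExponentialSums.

(** * Cones with an irrational generator *)

Section FacetPoint.
Context {R : realType} {d : nat}.
Local Open Scope complex_scope.
Variables (p : R) (w : 'M[R]_d) (i : 'I_d).
Hypotheses (p1 : 1 <= p) (wf : row_free w).
Implicit Types (m n : 'rV[int]_d).
Local Notation L m j := (crd w (lat m) j).
Local Notation kappa := (@kappa R d p).

(** Points spaced evenly along a parallel of the ray inside the cone are rounded down to lattice
    points, which stay at bounded distance from the ray. *)
Lemma ray_points : exists (pt : nat -> 'rV[int]_d) (D : R),
  [/\ injective pt, 0 <= D, forall q j, 0 < L (pt q) j,
      forall q j, j != i -> L (pt q) j <= D & forall q, L (pt q) i <= D * q.+1%:R].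
Proof.
(* Rounding changes a coordinate along [w] by at most [E]. The offset [E + 1] keeps the rounded
   points in the interior, and the spacing [T] keeps them distinct. *)
pose E := \sum_j \sum_k `|invmx w k j|.
have E0 : 0 <= E by apply: sumr_ge0 => j _; exact: sumr_ge0.
pose T := 2 * E + 1.
pose x (q : nat) := \sum_j (E + 1 + (j == i)%:R * (q%:R * T)) *: row j w : 'rV[R]_d.
have xE q j : crd w (x q) j = E + 1 + (j == i)%:R * (q%:R * T) by exact: crd_sum.
pose pt q : 'rV[int]_d := \row_k Num.floor (x q 0 k).
have err q j : `|L (pt q) j - crd w (x q) j| <= E.
  rewrite -crdN -crdD crdE; apply: le_trans (ler_norm_sum _ _ _) _.
  rewrite /E [leRHS](bigD1 j)//= -[leLHS]addr0; apply: lerD; last first.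
    by apply: sumr_ge0 => j' _; exact: sumr_ge0.
  apply: ler_sum => k _; rewrite normrM !mxE ler_piMl//.
  have := floor_le_tmp (x q 0 k); have := floorD1_gt (x q 0 k).
  by rewrite intrD ler_norml => *; apply/andP; split; lra.
have bnd q j : 1 + (j == i)%:R * (q%:R * T) <= L (pt q) j <= T + (j == i)%:R * (q%:R * T).
  have := err q j; rewrite xE ler_norml /T; set b := (_%:R * _) => /andP[? ?].
  by apply/andP; split; lra.
have T0 : 0 <= T by rewrite /T; lra.
exists pt, T; split => //.
- suff H q1 q2 : (q1 < q2)%N -> pt q1 != pt q2.
    by move=> q1 q2 e; apply/eqP; case: (ltngtP q1 q2) => // /H; rewrite e eqxx.
  move=> q12; apply/eqP => e; have /andP[_ h1] := bnd q1 i; have /andP[h2 _] := bnd q2 i.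
  move: h1 h2; rewrite e eqxx !mul1r => h1 h2.
  have : q1.+1%:R * T <= q2%:R * T by rewrite ler_wpM2r// ler_nat.
  by rewrite -natr1; lra.
- move=> q j; have /andP[h _] := bnd q j; apply: lt_le_trans h.
  by rewrite ltr_pwDl// !mulr_ge0.
- by move=> q j ji; have /andP[_] := bnd q j; rewrite (negbTE ji) mul0r addr0.
- move=> q; have /andP[_] := bnd q i; rewrite eqxx mul1r.
  by have -> : T * q.+1%:R = T + q%:R * T by rewrite -natr1; ring.
Qed.

Lemma cis_2pi (z : int) : cis (2 * pi * z%:~R) = 1 :> R[i].
Proof.
have c1 : cis (2 * pi) = 1 :> R[i].
  have := cexp_periodic (0 : R[i]); rewrite add0r cexp0.
  by move=> <-; rewrite /cis.
have cn (n : nat) : cis (2 * pi * n%:R) = 1 :> R[i] by rewrite mulrC -cisX c1 expr1n.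
case: z => n; first exact: cn.
rewrite NegzE intrN mulrN; have := cisD (- (2 * pi * n.+1%:R : R)) (2 * pi * n.+1%:R).
by rewrite addNr cis0 [X in _ = _ * X]cn mulr1 => <-.
Qed.

Lemma dotp_lat_int n m : exists z : int, dotp (lat n) (lat m) = z%:~R :> R.
Proof.
exists (\sum_k n 0 k * m 0 k); rewrite /dotp rmorph_sum; apply: eq_bigr => k _.
by rewrite !mxE rmorphM.
Qed.

(** The right-hand side does not involve [n]: the series is periodic under real lattice
    translations, so a bound near one translate of a point serves for all of them. *)
Lemma char_shift (x y : 'rV[R]_d) n m :
  char (ri (x + lat n) y) m =
  (expR (- (2 * pi * dotp y (lat m))))%:C * cis (2 * pi * dotp x (lat m)).
Proof.
have [z hz] := dotp_lat_int n m.
rewrite /char dotp_lat rpart_ri ipart_ri dotpDl hz.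
set a := dotp x _; set b := dotp y _.
have -> : (0 +i* (2 * pi)) * ((a + z%:~R) +i* b) =
  (- (2 * pi * b) +i* 0) + ((0 +i* (2 * pi * a)) + (0 +i* (2 * pi * z%:~R))).
  by apply/eqP; rewrite eq_complex /=; apply/andP; split; apply/eqP; ring.
rewrite !cexpD -/(cis _) -/(cis _) cis_2pi mulr1; congr (_ * _).
by rewrite -/(cis 0) cexp_polar -/(cis 0) cis0 mulr1.
Qed.

Section Weights.
Variables (eta xi u : 'rV[R]_d).
Hypotheses (etai : dotp eta (row i w) = 0).
Hypotheses (etak : forall k, k != i -> 0 < dotp eta (row k w)).
Hypotheses (xii : dotp xi (row i w) = 0) (hu : forall k, dotp u (row k w) = 1).

(** Imaginary parts inside the tube that tend to its boundary point [eta]. *)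
Definition approach (N : nat) : 'rV[R]_d := eta + N.+1%:R^-1 *: u.

Lemma eta_ge0 k : 0 <= dotp eta (row k w).
Proof. by have [->|/etak/ltW//] := eqVneq k i; rewrite etai. Qed.

Lemma dotp_approach N k : dotp (approach N) (row k w) = dotp eta (row k w) + N.+1%:R^-1.
Proof. by rewrite dotpDl dotpZl hu mulr1. Qed.

Lemma tube_approach N x : tube w (ri x (approach N)).
Proof.
by move=> k; rewrite /beta ipart_ri dotp_approach ltr_wpDl ?eta_ge0// invr_gt0.
Qed.

Definition facet_weight N m : R :=
  solid_angle p (cone_of w) (lat m) * expR (- (2 * pi * dotp (approach N) (lat m))).

Lemma facet_weight_ge0 N m : 0 <= facet_weight N m.
Proof. by rewrite mulr_ge0 ?expR_ge0// omega_ge0. Qed.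

(* As [xi] is orthogonal to [row i w], the frequency [<xi, m>] is bounded by the
   coordinates of [m] other than the [i]-th, in which the weight decays uniformly
   in [N]. *)
Lemma facet_moment : exists2 r : R, 0 < r & exists C : R, forall N (A : {fset 'rV[int]_d}),
  \sum_(m <- A) facet_weight N m / N.+1%:R * expR (r * `|2 * pi * dotp xi (lat m)|) <= C.
Proof.
(* The least decay rate along the other generators; the default 1 serves when there are none. *)
pose c0 : R := \big[Num.min/1]_(k | k != i) dotp eta (row k w).
have c00 : 0 < c0 by apply: lt_bigmin => // k; exact: etak.
have c0k k : k != i -> c0 <= dotp eta (row k w) by move=> ki; exact: bigmin_le_cond.
pose X0 : R := \sum_k `|dotp xi (row k w)|.
have X00 : 0 <= X0 by exact: sumr_ge0.
have X0k k : `|dotp xi (row k w)| <= X0 by rewrite /X0 (bigD1 k)//= lerDl sumr_ge0.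
(* The factor [expR (r * _)] consumes at most half of the decay [2 * pi * c0] in each direction
   [k != i]; the rate [pi * c0] kept in [b] is what remains. *)
pose r : R := c0 / 2 / (X0 + 1).
have X1 : 0 < X0 + 1 by lra.
have r0 : 0 < r by rewrite !divr_gt0.
have rX : r * X0 <= c0 / 2.
  have : r * (X0 + 1) = c0 / 2 by rewrite /r divfK// gt_eqF.
  by rewrite mulrDr mulr1; lra.
have pi0 := pi_gt0 R.
pose b N k : R := if k == i then 2 * pi / N.+1%:R else pi * c0.
have b0 N k : 0 < b N k by rewrite /b; case: ifP => _; rewrite !mulr_gt0// invr_gt0.
have K0 : 0 < kappa by exact: kappa_gt0.
pose P := \prod_(k | k != i) (1 - expR (- (pi * c0)))^-1.
have P0 : 0 <= P.
  by apply: prodr_ge0 => k _; rewrite invr_ge0 subr_ge0 -[leRHS]expR0 ler_expR oppr_le0 mulr_ge0 ?ltW.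
exists r => //; exists (kappa * (cell_bound w * ((1 + 2 * pi) / (2 * pi) * P))) => N A.
have N0 : (0 : R) < N.+1%:R by rewrite ltr0n.
have bound : \sum_(m <- A) facet_weight N m * expR (r * `|2 * pi * dotp xi (lat m)|) <=
    kappa * (cell_bound w * \prod_j (1 - expR (- b N j))^-1).
  apply: (cone_sum_le wf) => // [|m hm|m hm]; first exact: ltW.
    by rewrite /facet_weight omega_out// !mul0r.
  rewrite /facet_weight -mulrA -expRD; apply: ler_pM; rewrite ?omega_ge0 ?expR_ge0 ?omega_le//.
  rewrite -expR_sum ler_expR sumrN.
  pose c k : R := if k == i then 0 else X0.
  have hx : `|dotp xi (lat m)| <= \sum_k L m k * c k.
    rewrite (dotp_crd _ _ wf); apply: le_trans (ler_norm_sum _ _ _) _.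
    apply: ler_sum => k _; rewrite normrM (ger0_norm (hm k)); apply: ler_wpM2l => //.
    by rewrite /c; case: eqP => [->|//]; rewrite xii normr0.
  have h2 : r * (2 * pi * \sum_k L m k * c k) + \sum_k b N k * L m k <=
      2 * pi * dotp (approach N) (lat m).
    rewrite (dotp_crd _ _ wf) !mulr_sumr -big_split/=; apply: ler_sum => k _.
    rewrite dotp_approach.
    have -> : r * (2 * pi * (L m k * c k)) + b N k * L m k =
      (2 * pi * (r * c k) + b N k) * L m k by ring.
    have -> : 2 * pi * (L m k * (dotp eta (row k w) + N.+1%:R^-1)) =
      (2 * pi * (dotp eta (row k w) + N.+1%:R^-1)) * L m k by ring.
    apply: ler_wpM2r => //.
    rewrite /c /b; have [->|ki] := eqVneq k i; first by rewrite etai mulr0 mulr0 !add0r.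
    have g1 := ler_wpM2l (ltW pi0) (c0k k ki); have g2 := ler_wpM2l (ltW pi0) rX.
    have : 0 <= pi * N.+1%:R^-1 :> R by rewrite mulr_ge0 ?invr_ge0// ltW.
    move: g1 g2; clearbody r c0 X0; move: (dotp eta _) (N.+1%:R^-1) (pi : R) => e v q.
    lra.
  have pi2 : 0 <= 2 * pi :> R by rewrite mulr_ge0 ?ltW.
  have h3 : r * `|2 * pi * dotp xi (lat m)| <= r * (2 * pi * \sum_k L m k * c k).
    by apply: ler_wpM2l; [exact: ltW|rewrite normrM (ger0_norm pi2) ler_wpM2l].
  lra.
have -> : \sum_(m <- A) facet_weight N m / N.+1%:R * expR (r * `|2 * pi * dotp xi (lat m)|) =
  N.+1%:R^-1 * \sum_(m <- A) facet_weight N m * expR (r * `|2 * pi * dotp xi (lat m)|).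
  by rewrite mulr_sumr; apply: eq_bigr => m _; rewrite mulrAC mulrC.
have Ni0 : 0 <= N.+1%:R^-1 :> R by rewrite invr_ge0.
apply: le_trans (ler_wpM2l Ni0 bound) _.
rewrite (bigD1 i)//= [b N i]/b eqxx.
have -> : \prod_(k | k != i) (1 - expR (- b N k))^-1 = P.
  by apply: eq_bigr => k /negbTE ki; rewrite /b ki.
set x := 2 * pi / N.+1%:R.
have x0 : 0 < x by rewrite /x !mulr_gt0// invr_gt0.
(* The geometric series along the ray [i] has ratio [expR (- x)] with [x] of order [1 / N], so its
   sum grows like [N]; dividing by [N.+1] leaves a bound uniform in [N]. *)
have hx : N.+1%:R^-1 * (1 - expR (- x))^-1 <= (1 + 2 * pi) / (2 * pi).
  have e1 : x / (1 + x) <= 1 - expR (- x).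
    rewrite expRN lerBrDr -lerBrDl.
    have -> : 1 - x / (1 + x) = (1 + x)^-1 by field; rewrite gt_eqF//; lra.
    by rewrite lef_pV2 ?posrE ?expR_gt0 ?expR_ge1Dx//; lra.
  have e2 : (1 - expR (- x))^-1 <= (1 + x) / x.
    rewrite -[leRHS]invf_div lef_pV2 ?posrE//; last by rewrite divr_gt0//; lra.
    by apply: lt_le_trans e1; rewrite divr_gt0//; lra.
  apply: le_trans (ler_wpM2l Ni0 e2) _.
  have -> : N.+1%:R^-1 * ((1 + x) / x) = (1 + x) / (2 * pi).
    rewrite /x; move: (pi : R) N.+1%:R (lt0r_neq0 pi0) (lt0r_neq0 N0) => q n q0 n0.
    by field; rewrite q0 n0.
  apply: ler_wpM2r; first by rewrite invr_ge0 mulr_ge0 ?ltW.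
  have pi2 : 0 <= 2 * pi :> R by rewrite mulr_ge0 ?ltW.
  have N1 : 1 <= N.+1%:R :> R by rewrite ler1n.
  by rewrite lerD2l /x ler_pdivrMr//; exact: ler_peMr.
have -> : N.+1%:R^-1 * (kappa * (cell_bound w * ((1 - expR (- x))^-1 * P))) =
  kappa * (cell_bound w * ((N.+1%:R^-1 * (1 - expR (- x))^-1) * P)) by ring.
apply: ler_wpM2l; first exact: ltW.
apply: ler_wpM2l; first by rewrite /cell_bound.
exact: ler_wpM2r.
Qed.

(** Each of the points [pt 0], ..., [pt N] has weight at least [kappa * expR (- H)]: its [i]-th
    coordinate is at most [D * N.+1] and decays at rate [N.+1%:R^-1], while its other coordinates
    are at most [D]. There are [N.+1] such points. *)
Lemma facet_mass : exists pt : nat -> 'rV[int]_d, exists2 c : R, 0 < c &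
  forall N (A : {fset 'rV[int]_d}), (forall q, (q <= N)%N -> pt q \in A) ->
    c <= \sum_(m <- A) facet_weight N m / N.+1%:R.
Proof.
have [pt [D [ptI D0 pt0 ptD pti]]] := ray_points.
have pi0 := pi_gt0 R; have K0 : 0 < kappa by exact: kappa_gt0.
have pi2 : 0 <= 2 * pi :> R by rewrite mulr_ge0 ?ltW.
pose H : R := 2 * pi * \sum_k D * (dotp eta (row k w) + 1).
exists pt, (kappa * expR (- H)); first by rewrite mulr_gt0 ?expR_gt0.
move=> N A ptA; have N0 : (0 : R) < N.+1%:R by rewrite ltr0n.
pose B : {fset 'rV[int]_d} := [fset pt (val q) | q in {: 'I_N.+1}]%fset.
have BA : (B `<=` A)%fset.
  by apply/fsubsetP => m /imfsetP[q _ ->]; apply: ptA; rewrite -ltnS ltn_ord.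
have w0 m : 0 <= facet_weight N m / N.+1%:R.
  by rewrite mulr_ge0 ?facet_weight_ge0// invr_ge0.
apply: le_trans (sum_fsubset_le w0 BA).
rewrite big_imfset/=; last by move=> a b _ _ /ptI/val_inj.
rewrite big_enum/=.
have -> : kappa * expR (- H) = \sum_(q < N.+1) kappa * expR (- H) / N.+1%:R.
  by rewrite sumr_const card_ord -[RHS]mulr_natr divfK// gt_eqF.
apply: ler_sum => q _; apply: ler_wpM2r; first by rewrite invr_ge0.
rewrite /facet_weight (omega_interior p1 wf (pt0 _)).
apply: ler_wpM2l; first exact: ltW.
rewrite ler_expR lerN2; apply: ler_wpM2l => //.
rewrite (dotp_crd _ _ wf); apply: ler_sum => k _; rewrite dotp_approach.
have [->|ki] := eqVneq k i.
  rewrite etai !add0r mulr1 ler_pdivrMr//; apply: le_trans (pti q) _.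
  by apply: ler_wpM2l => //; rewrite ler_nat ltn_ord.
apply: ler_pM => //; first by rewrite ltW// pt0.
- by rewrite addr_ge0 ?eta_ge0// invr_ge0.
- exact: ptD.
- by rewrite lerD2l invf_le1// ler1n.
Qed.

Lemma term_approach N t n m :
  term p w (ri (t *: xi + lat n) (approach N)) m =
  (facet_weight N m)%:C * cis (t * (2 * pi * dotp xi (lat m))).
Proof.
rewrite /term char_shift /facet_weight rmorphM dotpZl.
rewrite [2 * pi * (t * _)]mulrCA.
by rewrite mulrA.
Qed.

(** Along [t *: xi + lat n] with imaginary part [approach N], the partial sums divided by [N.+1] are
    the averages [wsum] of [cis (t * x)]. A bound on [F] makes them tend to 0 for [t] near 1, and
    [negligible_mass] then contradicts [facet_mass]. *)
Lemma facet_unbounded (F : 'rV[R[i]]_d -> R[i]) n (M dl : R) : 0 < dl ->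
  (forall s, tube w s -> F s = solid_angle_series p (cone_of w) s) ->
  ~ (forall s, tube w s -> supnorm (s - ri (xi + lat n) eta) < dl -> nc (F s) <= M).
Proof.
move=> dl0 HF bounded.
have [r r0 [C moment]] := facet_moment.
have [pt [c c0 mass]] := facet_mass.
(* The modulus of a term depends only on the imaginary part of its argument, so one finite set for
   each [N] controls the tails for all [t] at once. *)
have tail N : exists A0 : {fset 'rV[int]_d}, forall A, (A0 `<=` A)%fset ->
    forall B, [disjoint B & A]%fset -> \sum_(m <- B) facet_weight N m <= 1.
  have ts := tube_approach N 0.
  apply: (@bounded_tail R _ (facet_weight N)
    (kappa * (cell_bound w * \prod_j (1 - expR (- (2 * pi * beta w (ri 0 (approach N)) j)))^-1)) 1).
  - exact: facet_weight_ge0.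
  - move=> A; have := sum_nc_term p1 wf A ts; apply: le_trans.
    by rewrite le_eqVlt; apply/orP; left; apply/eqP; apply: eq_bigr => m _; rewrite nc_term// ipart_ri.
  - exact: ltr01.
have [A0 HA0] := choice tail.
pose S N : {fset 'rV[int]_d} := (A0 N `|` [fset pt (val q) | q in {: 'I_N.+1}])%fset.
have A0S N : (A0 N `<=` S N)%fset by exact: fsubsetUl.
have ptS N q : (q <= N)%N -> pt q \in S N.
  rewrite -ltnS => qN; rewrite inE; apply/orP; right; apply/imfsetP.
  by exists (Ordinal qN).
pose A N m := facet_weight N m / N.+1%:R.
pose X m := 2 * pi * dotp xi (lat m).
have A_ge0 N m : 0 <= A N m by rewrite mulr_ge0 ?facet_weight_ge0// invr_ge0.
have momentS N : \sum_(m <- S N) A N m * expR (r * `|X m|) <= C by exact: moment.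
pose k := supnorm (ri xi 0) + 1; have k0 : 0 < k by have := supnorm_ge0 (ri xi 0); rewrite /k; lra.
have dk : 0 < dl / 2 / k by rewrite !divr_gt0.
suff near1 t : `|t - 1| < dl / 2 / k -> negligible_sum S A X (fun x => cis (t * x)).
  have [|N HN] := negligible_mass r0 A_ge0 momentS dk near1 (e := c / 2).
    by rewrite divr_gt0.
  have := HN N (leqnn N); have := mass N (S N) (ptS N).
  have -> : wsum S A X N (fun=> 1) = (\sum_(m <- S N) A N m)%:C.
    by rewrite /wsum raddf_sum; apply: eq_bigr => m _; rewrite mulr1.
  rewrite nc_real ger0_norm; last by apply: sumr_ge0.
  by rewrite -/(A N); lra.
move=> t1 e e0.
pose v := supnorm (ri 0 u) + 1; have v0 : 0 < v by have := supnorm_ge0 (ri 0 u); rewrite /v; lra.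
pose M1 : R := `|M| + 1; have M10 : 0 < M1 by rewrite /M1; have := normr_ge0 M; lra.
(* The first threshold brings [s] within [dl] of the facet point. The second makes the average at
   most [e], since the partial sum is at most [M1]: the bound on [F] plus 1 for the tail. *)
exists (maxn (Num.truncn (v / (dl / 2))) (Num.truncn (M1 / e))) => N.
rewrite geq_max => /andP[N1 N2]; have N0 : (0 : R) < N.+1%:R by rewrite ltr0n.
have big (x y : R) : 0 < y -> (Num.truncn (x / y) <= N)%N -> N.+1%:R^-1 * x <= y :> R.
  move=> y0 h; have : x / y < N.+1%:R.
    by apply: lt_le_trans (truncnS_gt _) _; rewrite ler_nat.
  by rewrite ltr_pdivrMr// => h'; rewrite ler_pdivrMl// ltW// mulrC.
have dl2 : 0 < dl / 2 by rewrite divr_gt0.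
have {}N1 := big _ _ dl2 N1.
have {}N2 := big _ _ e0 N2.
pose s := ri (t *: xi + lat n) (approach N).
have ts : tube w s by exact: tube_approach.
have sz : supnorm (s - ri (xi + lat n) eta) < dl.
  have -> : s - ri (xi + lat n) eta =
      (t - 1)%:C *: ri xi 0 + (N.+1%:R^-1)%:C *: ri 0 u.
    apply/rowP => j; rewrite !mxE; apply/eqP; rewrite eq_complex /=.
    by apply/andP; split; apply/eqP; ring.
  apply: le_lt_trans (supnormD _ _) _.
  have h1 := supnormZ (t - 1)%:C (ri xi 0); have h2 := supnormZ (N.+1%:R^-1)%:C (ri 0 u).
  rewrite nc_real in h1; rewrite nc_real ger0_norm ?invr_ge0// in h2.
  have h3 : `|t - 1| * supnorm (ri xi 0) <= `|t - 1| * k by rewrite ler_wpM2l// lerDl.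
  have h4 : N.+1%:R^-1 * supnorm (ri 0 u) <= N.+1%:R^-1 * v :> R.
    by rewrite ler_wpM2l ?invr_ge0// lerDl.
  apply: le_lt_trans (lerD (le_trans h1 h3) (le_trans h2 h4)) _.
  by rewrite [ltRHS]splitr ltr_leD// -ltr_pdivlMr.
have hu1 := series_usum p1 wf ts; rewrite -HF// in hu1.
have h5 : nc (\sum_(m <- S N) term p w s m - F s) <= 1.
  apply: (usum_tail hu1) => B BS.
  have := HA0 N (S N) (A0S N) B BS; apply: le_trans.
  rewrite le_eqVlt; apply/orP; left; apply/eqP; apply: eq_bigr => m _.
  by rewrite nc_term// ipart_ri.
have h6 := bounded s ts sz.
have -> : wsum S A X N (fun x => cis (t * x)) =
    (N.+1%:R^-1)%:C * \sum_(m <- S N) term p w s m.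
  rewrite /wsum mulr_sumr; apply: eq_bigr => m _.
  by rewrite term_approach /A rmorphM mulrA [(N.+1%:R^-1)%:C * _]mulrC.
rewrite ComplexField.Normc.normcM nc_real ger0_norm ?invr_ge0//.
apply: le_trans N2; apply: ler_wpM2l; first by rewrite invr_ge0.
rewrite -[X in nc X](subrK (F s)); apply: le_trans (le_normcD _ _) _.
by rewrite /M1; have := ler_norm M; lra.
Qed.

End Weights.

End FacetPoint.

(** * Density of the pairings of the lattice with an irrational vector *)

Section LatticeDensity.
Context {R : realType} {d : nat}.

Lemma latZ (z : int) (m : 'rV[int]_d) : lat (z *: m) = z%:~R *: lat m :> 'rV[R]_d.
Proof. exact: map_mxZ. Qed.

(* If the subgroup [{<n, v>}] of R is not dense, it is generated by some
   [g > 0], and then [v / g] is an integer vector. *)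
Lemma lat_dense (v : 'rV[R]_d) : v != 0 ->
  ~ (exists (m : 'rV[int]_d), exists2 a : R, 0 < a & lat m = a *: v) ->
  forall x e : R, 0 < e -> exists n : 'rV[int]_d, `|dotp (lat n) v - x| < e.
Proof.
move=> v0 irr x e e0; pose G := [set dotp (lat n) v | n in [set: 'rV[int]_d]].
have GB a b (z : int) : G a -> G b -> G (a - z%:~R * b).
  move=> [m _ <-] [n _ <-]; exists (m - z *: n) => //.
  by rewrite latD latN latZ dotpDl dotpNl dotpZl.
have Gv k : G (v 0 k).
  exists (delta_mx 0 k) => //; rewrite /dotp (bigD1 k)//= big1 => [|j jk].
    by rewrite !mxE !eqxx mul1r addr0.
  by rewrite !mxE (negbTE jk) andbF mul0r.
have [k vk] : exists k, v 0 k != 0.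
  apply: contrapT => h; move/eqP: v0; apply; apply/rowP => k; rewrite mxE.
  by apply/eqP/negPn/negP => hk; apply: h; exists k.
have G0 : G 0 by have := GB _ _ 1 (Gv k) (Gv k); rewrite mul1r subrr.
have Gp : exists2 g, G g & 0 < g.
  have [v1|v1] := ltP 0 (v 0 k); first by exists (v 0 k).
  exists (0 - 1%:~R * v 0 k); first exact: GB.
  by rewrite mul1r sub0r oppr_gt0 lt_neqAle vk.
have near_multiple (g a : R) : 0 < g ->
    0 <= a - (Num.floor (a / g))%:~R * g < g.
  move=> g0; have := floor_le_tmp (a / g); have := floorD1_gt (a / g).
  rewrite intrD ltr_pdivrMr// ler_pdivlMr// mulrDl mul1r => h1 h2.
  by apply/andP; split; lra.
(* With an element of [G] in []0, e[], one of its multiples is within [e] of [x]. Otherwise [G] is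
   discrete. *)
have [[g Gg /andP[g0 ge]]|small] := pselect (exists2 g, G g & 0 < g < e).
  have [n _ hn] := Gg; exists (Num.floor (x / g) *: n).
  rewrite latZ dotpZl hn; have := near_multiple g x g0.
  by rewrite distrC => /andP[h1 h2]; rewrite ger0_norm//; lra.
exfalso; apply: irr; pose P := [set g | G g /\ 0 < g].
have infP : has_inf P.
  have [g Gg g0] := Gp; split; first by exists g.
  by exists 0 => y [_ /ltW].
(* Such a [g] is already the least positive element: a smaller [b] would put [g - b] in []0, e[]. *)
have [g [Gg g0] gi] := inf_adherent e0 infP.
have gmin b : G b -> 0 < b -> g <= b.
  move=> Gb b0; rewrite leNgt; apply/negP => bg; apply: small.
  exists (g - 1%:~R * b); first exact: GB.
  have : inf P <= b by apply: ge_inf; [exact: infP.2|].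
  by rewrite mul1r => ?; apply/andP; split; lra.
exists (\row_j Num.floor (v 0 j / g)), g^-1; first by rewrite invr_gt0.
apply/rowP => j; rewrite !mxE.
have /andP[h1 h2] := near_multiple g (v 0 j) g0.
have h3 := GB _ _ (Num.floor (v 0 j / g)) (Gv j) Gg.
have : v 0 j - (Num.floor (v 0 j / g))%:~R * g = 0.
  apply/eqP; rewrite eq_le h1 andbT leNgt; apply/negP => /(gmin _ h3).
  by rewrite leNgt h2.
move/eqP; rewrite subr_eq0 => /eqP e1.
by rewrite [X in _ = _ * X]e1 [RHS]mulrC mulfK// gt_eqF.
Qed.

End LatticeDensity.

Section Irrational.
Context {R : realType} {d : nat}.
Local Open Scope complex_scope.
Variables (p : R) (w : 'M[R]_d) (i : 'I_d).
Hypotheses (p1 : 1 <= p) (wf : row_free w).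
Hypothesis irr : ~ (exists m, exists2 a : R, 0 < a & lat m = a *: row i w).
Variables (F : 'rV[R[i]]_d -> R[i]).
Hypothesis FK : is_solid_angle_gf p (cone_of w) F.

Lemma row_neq0 : row i w != 0.
Proof.
apply/eqP => r0; have := crd_row i i wf; rewrite eqxx r0 /crd mul0mx mxE.
by move/esym/eqP; rewrite oner_eq0.
Qed.

Section Quotient.
Variables (a : 'rV[R[i]]_d) (r : R) (g h : 'rV[R[i]]_d -> R[i]).
Hypotheses (hg : holomorphic_on [set z | supnorm (z - a) < r] g)
  (hh : holomorphic_on [set z | supnorm (z - a) < r] h)
  (Fgh : forall z, supnorm (z - a) < r -> h z != 0 -> F z = g z / h z).

Lemma quotient_bounded z : supnorm (z - a) < r -> h z != 0 ->
  exists (M : R), exists2 dl : R, 0 < dl & forall s, supnorm (s - z) < dl -> nc (F s) <= M.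
Proof.
move=> za hz; have n0 : 0 < nc (h z).
  by rewrite lt_neqAle nc_ge0 eq_sym andbT; apply: contra hz => /eqP /ComplexField.Normc.eq0_normc ->.
have n2 : 0 < nc (h z) / 2 by rewrite divr_gt0.
have [e1 e10 H1] := holomorphic_cont (hh za) n2.
have [e2 e20 H2] := holomorphic_cont (hg za) ltr01.
exists ((nc (g z) + 1) / (nc (h z) / 2)), (Num.min (Num.min e1 e2) (r - supnorm (z - a))).
  by rewrite !lt_min e10 e20 subr_gt0.
move=> s; rewrite !lt_min => /andP[/andP[/H1 s1 /H2 s2] s3].
have sa : supnorm (s - a) < r by have := supnorm_tri s z a; lra.
have h1 : nc (h z) / 2 <= nc (h s).
  have := nc_dist (h s) (h z); rewrite ler_norml => /andP[? _]; lra.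
have hs : h s != 0.
  by apply: contraTneq h1 => ->; rewrite ComplexField.Normc.normc0 -ltNge.
rewrite (Fgh sa hs) ComplexField.Normc.normcM ComplexField.Normc.normcV.
apply: ler_pM; rewrite ?invr_ge0 ?nc_ge0//.
  by have := nc_dist (g s) (g z); rewrite ler_norml => /andP[_ ?]; lra.
by rewrite lef_pV2 ?posrE//; exact: lt_le_trans h1.
Qed.

(** If [h] were nonzero at this point, it would be nonzero at a nearby point [xi + lat n] with [xi]
    orthogonal to [row i w], and [F] would be bounded there, against [facet_unbounded]. *)
Lemma denominator_on_facet x eta : dotp eta (row i w) = 0 ->
  (forall k, k != i -> 0 < dotp eta (row k w)) ->
  supnorm (ri x eta - a) < r -> h (ri x eta) = 0.
Proof.
move=> ei ek za; apply/eqP/negPn/negP => hz.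
have [e1 e10 H1] := neq0_near (hh za) hz.
have [v hv] := dual_vector wf (fun=> 1); have [u hu] := dual_vector wf (fun=> 1).
pose k := supnorm (ri v 0) + 1; have k0 : 0 < k by have := supnorm_ge0 (ri v 0); rewrite /k; lra.
pose e := Num.min e1 (r - supnorm (ri x eta - a)).
have e0 : 0 < e by rewrite lt_min e10 subr_gt0.
have [n hn] := lat_dense row_neq0 irr (dotp x (row i w)) (divr_gt0 e0 k0).
set t := dotp (lat n) _ - _ in hn.
(* Since [v] pairs to 1 with [row i w], the correction [t *: v] makes [xi] orthogonal to it; by
   density [t] is small, so [xi + lat n] is close to [x]. *)
pose xi := x + t *: v - lat n.
have xii : dotp xi (row i w) = 0.
  by rewrite !dotpDl dotpZl dotpNl hv mulr1 /t; ring.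
have close : supnorm (ri (xi + lat n) eta - ri x eta) < e.
  have -> : ri (xi + lat n) eta - ri x eta = t%:C *: ri v 0.
    apply/rowP => j; rewrite !mxE; apply/eqP; rewrite eq_complex /=.
    by apply/andP; split; apply/eqP; ring.
  apply: le_lt_trans (supnormZ _ _) _; rewrite nc_real.
  move: hn; rewrite ltr_pdivlMr//; apply: le_lt_trans.
  by apply: ler_wpM2l => //; rewrite /k; lra.
move: close; rewrite lt_min => /andP[/H1 hz' c2].
have za' : supnorm (ri (xi + lat n) eta - a) < r.
  by have := supnorm_tri (ri (xi + lat n) eta) (ri x eta) a; lra.
have [M [dl dl0 HM]] := quotient_bounded za' hz'.
have HF s : tube w s -> F s = solid_angle_series p (cone_of w) s.
  by move=> ts; apply: FK.2; rewrite series_domainE.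
apply: (facet_unbounded p1 wf ei ek xii hu (n := n) dl0 HF (M := M)) => s _; exact: HM.
Qed.

End Quotient.

Lemma irrational_case : False.
Proof.
have [eta heta] := dual_vector wf (fun j => (j != i)%:R).
have [v hv] := dual_vector wf (fun=> 1).
pose s0 := ri 0 eta.
have [r [g [h [r0 hg hh hd Fgh]]]] := meromorphic_ball s0 FK.1.
have W0 := basis_size_ge0 w; set W := basis_size w in W0.
pose k := supnorm (ri v 0); have k0 : 0 <= k by exact: supnorm_ge0.
(* Within [(W + 1)^-1] of [s0] the pairings of the imaginary part with the other generators stay
   positive. *)
pose r' := Num.min r (W + 1)^-1.
have r'0 : 0 < r' by rewrite lt_min r0 invr_gt0; lra.
(* [rho * c] adds up the distances in [dist]: from [s0] to [z], from [z] to [z'], and along the disc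
   of radius [rho * (W + 1)], with one [rho] to spare. *)
pose c := 1 + (2 * W + 1) * k + 1.
have c0 : 0 < c by have := mulr_ge0 W0 k0; rewrite /c; lra.
pose rho : R := r' / c; have rho0 : 0 < rho by rewrite divr_gt0.
have rhoc : rho * c = r' by rewrite /rho divfK// gt_eqF.
have [z zs hz] : exists2 z, supnorm (z - s0) < rho & h z != 0.
  by apply: hd => //; rewrite subrr supnorm0.
move/eqP: hz; apply; set t0 := beta w z i.
have t0le : `|t0| <= rho * W.
  have -> : t0 = beta w (z - s0) i.
    rewrite (_ : t0 = beta w ((z - s0) + s0) i); last by rewrite subrK.
    by rewrite betaD beta_ri heta eqxx addr0.
  apply: le_trans (beta_le _ _ _) _; apply: ler_wpM2r => //; exact: ltW.
(* [z'] lies on the hypersurface where the imaginary part pairs to 0 with [row i w], and real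
   multiples of [v] do not leave it. So [h] vanishes at real [t] on this complex line, hence on the
   disc, which contains [i t0], the parameter of [z]. *)
pose z' := z - (0 +i* t0) *: ri v 0.
have dist t : nc t < rho * (W + 1) -> supnorm (z' + t *: ri v 0 - s0) < r'.
  move=> ht; have -> : z' + t *: ri v 0 - s0 =
      (z - s0) + ((- (0 +i* t0)) *: ri v 0 + t *: ri v 0).
    by rewrite /z' scaleNr addrAC [z - _ - s0]addrAC -addrA.
  apply: le_lt_trans (supnormD _ _) _.
  have h1 := supnormD ((- (0 +i* t0)) *: ri v 0) (t *: ri v 0).
  have h2 := supnormZ (- (0 +i* t0)) (ri v 0); have h3 := supnormZ t (ri v 0).
  rewrite normcN nc_imag -/k in h2; rewrite -/k in h3.
  have h4 := ler_wpM2r k0 t0le; have h5 := ler_wpM2r k0 (ltW ht).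
  have e1 : rho * c = rho + rho * W * k + rho * (W + 1) * k + rho by rewrite /c; ring.
  by rewrite -rhoc e1; lra.
have r'r t : nc t < rho * (W + 1) -> supnorm (z' + t *: ri v 0 - s0) < r.
  by move=> /dist; rewrite lt_min => /andP[].
have ipv (b : R[i]) : ipart (b *: ri v 0) = complex.Im b *: v.
  by apply/rowP => j; rewrite !mxE /=; case: b => b1 b2 /=; rewrite mulr0 add0r.
have -> : z = z' + (0 +i* t0) *: ri v 0 by rewrite /z' subrK.
have hl : line_hol h [set z | supnorm (z - s0) < r] := holomorphic_line hh.
apply: (@vanish_real_axis R (fun t => h (z' + t *: ri v 0)) (rho * (W + 1))).
- by move=> t ht; apply: hl; exact: r'r.
- move=> x xr; have ht : nc x%:C < rho * (W + 1) by rewrite nc_real.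
  set q := z' + _; have qr : supnorm (q - s0) < r' := dist _ ht.
  rewrite [q]ri_parts; apply: (denominator_on_facet hg hh Fgh).
  + have -> : ipart q = ipart z - t0 *: v.
      rewrite /q /z' -scaleNr !ipartD !ipv /= scale0r addr0 scaleNr.
      by [].
    by rewrite dotpDl dotpNl dotpZl hv mulr1 -/(beta w z i) -/t0 subrr.
  + move=> j ji; rewrite -/(beta w q j) -[q](subrK s0) betaD beta_ri heta ji.
    have := beta_le w (q - s0) j; rewrite ler_norml => /andP[h1 _].
    have h2 : supnorm (q - s0) * (W + 1) < 1.
      rewrite -ltr_pdivlMr; last by lra.
      by rewrite div1r; move: qr; rewrite lt_min => /andP[].
    have := supnorm_ge0 (q - s0); rewrite -/W in h1; rewrite mulrDr mulr1 in h2.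
    by rewrite mulr1n; lra.
  + by rewrite -ri_parts; exact: r'r.
- by rewrite nc_imag; apply: le_lt_trans t0le _; rewrite ltr_pM2l//; lra.
Qed.

End Irrational.

Theorem theorem3p1 (R : realType) (p : R) (hp : 1 <= p) (d : nat)
    (K : set 'rV[R]_d) (hK : simple_cone K)
    (alpha : 'rV[R[i]]_d -> R[i]) (halpha : is_solid_angle_gf p K alpha) :
  mero_eq (fun s => alpha (- s)) (fun s => (-1) ^+ d * alpha s).
Proof.
case: hK halpha => w wf -> halpha.
have [rat|] := pselect (forall j, exists m : 'rV[int]_d,
    exists2 a : R, 0 < a & lat m = a *: row j w).
  have [y Hy] := choice rat.
  have Hy' j : exists a : R, 0 < a /\ lat (y j) = a *: row j w.
    by have [a a0 ya] := Hy j; exists a.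
  have [a Ha] := choice Hy'.
  exact: (rational_case hp wf (fun j => (Ha j).1) (fun j => (Ha j).2) halpha).
move=> irr; exfalso; apply: irr => j; apply: contrapT => irr.
exact: (irrational_case hp wf irr halpha).
Qed.
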